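(* Let $G$ be a finitely generated infinite group with polynomial growth, $F$ a fixed finite symmetric generating set of $G$ containing the identity, $d=d(G)$ the order of growth of $G$, and let $f$ be a polynomial with $\deg f=d$ and $0<\lambda\le 1$ a constant such that $\lambda f(n)\le |F^n|\le f(n)$ for all $n\in\mathbb{N}$. Suppose that $0<\alpha<1$ and $C>0$, and let $\sigma_{\alpha,C}(x)=e^{C\tau(x)^\alpha}$ $(x\in G)$, where $\tau=\tau_F$ is the length function. Then the algebraic centre $Z\ell^1(G,\sigma_{\alpha,C})$ is isomorphic to a $Q$-algebra. In this case, $Z\ell^1(G,\sigma_{\alpha,C})$ satisfies the multi-variable $(\delta,L)$-von Neumann inequality with $$\delta=e^{-1}\left(1+K_G\,M\,2^{\beta-1}\left[1+\sum_{n=1}^\infty\frac{f(n)-\lambda f(n-1)}{(1+n)^{2\beta}}\right]^{1/2}\right)^{-1}\quad\text{and}\quad L=1,$$ where $$\beta=\max\left\{1,\ \frac{6}{C\alpha(1-\alpha)},\ \frac{d+(1-\delta_1(\lambda))}{2}\right\},$$ with $\delta_1$ the Dirac function at $1$ (that is, $\delta_1(\lambda)=1$ if $\lambda=1$ and $\delta_1(\lambda)=0$ otherwise), and $$M=\max\{e^{p(t)-p(s)-p(r)}: t,s,r\in[0,4K]\cap\mathbb{Z}\},\quad p(x)=Cx^\alpha-\beta\ln(1+x),\quad K=\left(\frac{\beta^2}{C\alpha(1-\alpha)}\right)^{1/\alpha}.$$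
   Context: All groups are discrete. For a finitely generated group $G$ with a finite symmetric generating set $F$ containing the identity $e_G$, put $F^n=\{u_1\cdots u_n: u_i\in F,\ i=1,\dots,n\}$ for $n\in\mathbb{N}$. $G$ has polynomial growth if $|F^n|$ is bounded by a polynomial in $n$; the least degree of such a polynomial is the order of growth $d(G)$ (independent of $F$). The length function is $\tau(x)=\tau_F(x)=\inf\{n\in\mathbb{N}: x\in F^n\}$ for $x\ne e_G$, and $\tau(e_G)=0$. For a weight $\omega$ on $G$ (a function $\omega:G\to(0,\infty)$ with $\omega(xy)\le\omega(x)\omega(y)$ for all $x,y\in G$), $\ell^1(G,\omega)$ is the convolution algebra of functions $g:G\to\mathbb{C}$ with $\|g\|=\sum_{x\in G}|g(x)|\omega(x)<\infty$. $ZA$ denotes the algebraic centre of an algebra $A$. A $Q$-algebra is a (commutative) Banach algebra that is a quotient of a uniform algebra. A commutative Banach algebra $A$ satisfies the multi-variable $(\delta,L)$-von Neumann inequality if for every $n\in\mathbb{N}$, all $a_1,\dots,a_n\in A$ with $\|a_i\|\le\delta$ $(i=1,\dots,n)$, and every polynomial $P$ in $n$ variables without constant term, $\|P(a_1,\dots,a_n)\|\le L\|P\|_\infty$, where $\|P\|_\infty=\sup\{|P(z_1,\dots,z_n)|: |z_i|\le 1,\ i=1,\dots,n\}$. $K_G$ denotes Grothendieck's constant (a universal constant; the subscript does not refer to the group $G$). In the formulas, $e$ is Euler's number. *)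

(* Defs.v *)
From HB Require Import structures.
From mathcomp Require Import all_boot all_order all_algebra.
From mathcomp Require Import all_classical all_reals all_analysis.
From mathcomp Require Import finmap complex.
(* Not imported: the notations of mpoly clash with those of mathcomp-analysis. *)
From mathcomp Require mpoly.

Set Implicit Arguments.
Unset Strict Implicit.
Unset Printing Implicit Defensive.

Import Order.TTheory GRing.Theory Num.Theory.
Import numFieldNormedType.Exports.
Import Normc.

Local Open Scope classical_set_scope.
Local Open Scope complex_scope.
Local Open Scope ring_scope.

(** * Finitely generated groups *)

Definition is_subgroup (G : groupType) (H : set G) : Prop :=
  [/\ H 1%g, forall x y, H x -> H y -> H (x * y)%g
    & forall x, H x -> H x^-1%g].

Definition generates (G : groupType) (F : set G) : Prop :=
  forall H : set G, is_subgroup H -> F `<=` H -> H = [set: G].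

Definition symmetric_generating_set (G : groupType) (F : set G) : Prop :=
  [/\ finite_set F, F 1%g, forall x, F x -> F x^-1%g & generates F].

(* The index n ranges over all of nat; F^0 is [set 1], the empty product. *)
Definition word_ball (G : groupType) (F : set G) (n : nat) : set G :=
  [set x | exists u : 'I_n -> G,
    (forall i, F (u i)) /\ x = (\prod_(i < n) u i)%g].

Definition ball_size (G : groupType) (F : set G) (n : nat) : nat :=
  (#|` fset_set (word_ball F n)|)%fset.

(* Junk value 0 outside the subgroup generated by F. *)
Definition word_length (G : groupType) (F : set G) (x : G) : nat :=
  xget 0%N [set n | word_ball F n x /\
                    forall m, word_ball F m x -> (n <= m)%N].

Definition growth_bound (R : realType) (G : groupType) (F : set G)
    (P : {poly R}) : Prop :=
  forall n, (ball_size F n)%:R <= P.[n%:R].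

Definition polynomial_growth (R : realType) (G : groupType) (F : set G) : Prop :=
  exists P : {poly R}, growth_bound F P.

Definition order_of_growth (R : realType) (G : groupType) (F : set G)
    (d : nat) : Prop :=
  (exists P : {poly R}, growth_bound F P /\ (size P).-1 = d) /\
  (forall P : {poly R}, growth_bound F P -> (d <= (size P).-1)%N).

(** * Normed algebras as raw data *)

(* A complex, not necessarily unital, normed algebra whose elements are the
   members of a subset of an ambient type. *)
Record normed_algebra (R : realType) := NormedAlgebra {
  na_sort : Type;
  na_set : set na_sort;
  na_zero : na_sort;
  na_add : na_sort -> na_sort -> na_sort;
  na_scale : R[i] -> na_sort -> na_sort;
  na_mul : na_sort -> na_sort -> na_sort;
  na_norm : na_sort -> R }.

Arguments na_sort {R} A : rename.
Arguments na_set {R} A : rename.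
Arguments na_zero {R} A : rename.
Arguments na_add {R A} : rename.
Arguments na_scale {R A} : rename.
Arguments na_mul {R A} : rename.
Arguments na_norm {R A} : rename.

Definition na_centre (R : realType) (A : normed_algebra R) : normed_algebra R :=
  {| na_set := [set a | na_set A a /\
                        forall b, na_set A b -> na_mul a b = na_mul b a];
     na_zero := na_zero A;
     na_add := @na_add R A;
     na_scale := @na_scale R A;
     na_mul := @na_mul R A;
     na_norm := @na_norm R A |}.

(* Isomorphism of Banach algebras; it need not be isometric. *)
Definition na_isomorphic (R : realType) (A B : normed_algebra R) : Prop :=
  exists phi : na_sort A -> na_sort B,
    [/\ set_bij (na_set A) (na_set B) phi,
        forall a b, na_set A a -> na_set A b ->
          phi (na_add a b) = na_add (phi a) (phi b),
        forall (c : R[i]) a, na_set A a ->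
          phi (na_scale c a) = na_scale c (phi a),
        forall a b, na_set A a -> na_set A b ->
          phi (na_mul a b) = na_mul (phi a) (phi b)
      & exists k1 k2 : R, [/\ 0 < k1, 0 < k2 &
          forall a, na_set A a ->
            k1 * na_norm a <= na_norm (phi a) <= k2 * na_norm a]].

(** * Quotients of uniform algebras *)

Definition sup_norm (R : realType) (X : Type) (u : X -> R[i]) : R :=
  sup [set normc (u x) | x in [set: X]].

Definition uniformly_closed (R : realType) (X : Type) (U V : set (X -> R[i])) :=
  forall v, V v ->
    (forall e : R, 0 < e -> exists2 u, U u & forall x, normc (v x - u x) <= e) ->
    U v.

(* A closed subalgebra of C(X), X compact Hausdorff, that contains the
   constants and separates the points. *)
Definition uniform_algebra (R : realType) (X : topologicalType)
    (U : set (X -> R[i])) : Prop :=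
  [/\ compact [set: X], hausdorff_space X
    & [/\ U `<=` [set u | continuous (u : X -> R[i]^o)],
          forall c : R[i], U (fun=> c),
          forall u v, U u -> U v -> U (fun x => u x + v x) /\ U (fun x => u x * v x),
          uniformly_closed U [set u | continuous (u : X -> R[i]^o)]
        & forall x y, x != y -> exists2 u, U u & u x != u y]].

Definition closed_ideal (R : realType) (X : Type) (U I : set (X -> R[i])) : Prop :=
  [/\ I `<=` U, I (fun=> 0),
      forall u v, I u -> I v -> I (fun x => u x + v x),
      forall u v, U u -> I v -> I (fun x => u x * v x)
    & uniformly_closed I U].

Definition coset (R : realType) (X : Type) (I : set (X -> R[i]))
    (u : X -> R[i]) : set (X -> R[i]) :=
  [set v | exists2 w, I w & v = (fun x => u x + w x)].

(* The elements of U / I are the cosets themselves. The term [w] in I makes the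
   set of all products (or multiples) of representatives a full coset. *)
Definition quotient_algebra (R : realType) (X : Type) (U I : set (X -> R[i])) :
    normed_algebra R :=
  {| na_set := [set coset I u | u in U];
     na_zero := I;
     na_add := fun P Q => [set v | exists p q,
       [/\ P p, Q q & v = (fun x => p x + q x)]];
     na_scale := fun c P => [set v | exists p w,
       [/\ P p, I w & v = (fun x => c * p x + w x)]];
     na_mul := fun P Q => [set v | exists p q w,
       [/\ P p, Q q, I w & v = (fun x => p x * q x + w x)]];
     na_norm := fun P => inf [set sup_norm p | p in P] |}.

Definition isomorphic_to_Q_algebra (R : realType) (A : normed_algebra R) : Prop :=
  exists (X : topologicalType) (U I : set (X -> R[i])),
    [/\ uniform_algebra U, closed_ideal U I
      & na_isomorphic A (quotient_algebra U I)].

(** * The von Neumann inequality *)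

(* The product a_0^(m_0) ... a_(n-1)^(m_(n-1)), without using a unit. The value
   for m = 0 is irrelevant: it is only used for polynomials without constant
   term. *)
Definition na_monomial (R : realType) (A : normed_algebra R) (n : nat)
    (a : 'I_n -> na_sort A) (m : mpoly.multinom n) : na_sort A :=
  if flatten [seq nseq (mpoly.fun_of_multinom m i) (a i) | i <- enum 'I_n]
    is x :: s then foldl (@na_mul R A) x s else na_zero A.

Definition na_eval (R : realType) (A : normed_algebra R) (n : nat)
    (P : mpoly.mpoly n R[i]) (a : 'I_n -> na_sort A) : na_sort A :=
  \big[@na_add R A / na_zero A]_(m <- mpoly.msupp P)
    na_scale (mpoly.mcoeff m P) (na_monomial a m).

Definition polydisc_norm (R : realType) (n : nat) (P : mpoly.mpoly n R[i]) : R :=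
  sup [set normc (mpoly.meval z P) |
        z in [set z : 'I_n -> R[i] | forall i, normc (z i) <= 1]].

Definition von_Neumann (R : realType) (A : normed_algebra R) (delta L : R) : Prop :=
  forall (n : nat) (a : 'I_n -> na_sort A),
    (forall i, na_set A (a i) /\ na_norm (a i) <= delta) ->
  forall P : mpoly.mpoly n R[i], mpoly.mcoeff (mpoly.mnm0 (n:=n)) P = 0 ->
    na_norm (na_eval P a) <= L * polydisc_norm P.

(** * Weighted group algebras *)

Definition real_sum (R : realType) (T : choiceType) (f : T -> R) : R :=
  fine (\esum_(x in [set: T]) ((EFin \o f)^\+ x) -
        \esum_(x in [set: T]) ((EFin \o f)^\- x))%E.

(* The sum of an absolutely summable family of complex numbers. *)
Definition complex_sum (R : realType) (T : choiceType) (f : T -> R[i]) : R[i] :=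
  real_sum (fun x => complex.Re (f x)) +i* real_sum (fun x => complex.Im (f x)).

Definition convolution (R : realType) (G : groupType) (g h : G -> R[i]) : G -> R[i] :=
  fun x => complex_sum (fun y => g y * h (y^-1 * x)%g).

Definition l1_norm (R : realType) (G : groupType) (w : G -> R) (g : G -> R[i]) :
    \bar R :=
  \esum_(x in [set: G]) (normc (g x) * w x)%:E.

Definition l1_algebra (R : realType) (G : groupType) (w : G -> R) :
    normed_algebra R :=
  {| na_set := [set g : G -> R[i] | (l1_norm w g < +oo)%E];
     na_zero := fun=> 0;
     na_add := fun g h x => g x + h x;
     na_scale := fun c g x => c * g x;
     na_mul := @convolution R G;
     na_norm := fun g => fine (l1_norm w g) |}.

Definition exp_weight (R : realType) (G : groupType) (F : set G) (alpha C : R) :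
    G -> R :=
  fun x => expR (C * (word_length F x)%:R `^ alpha).

(** * The constants *)

Definition inner (R : realType) (k : nat) (x y : 'rV[R[i]]_k) : R[i] :=
  \sum_(l < k) x 0 l * (y 0 l)^*.

(* The complex Grothendieck constant. The finitely many vectors involved span a
   finite-dimensional Hilbert space, hence C^k for all k suffices. *)
Definition Grothendieck_constant (R : realType) : R :=
  inf [set K : R | forall (m n k : nat) (A : 'M[R[i]]_(m, n)),
    (forall (s : 'I_m -> R[i]) (t : 'I_n -> R[i]),
       (forall i, normc (s i) <= 1) -> (forall j, normc (t j) <= 1) ->
       normc (\sum_(i < m) \sum_(j < n) A i j * s i * t j) <= 1) ->
    forall (x : 'I_m -> 'rV[R[i]]_k) (y : 'I_n -> 'rV[R[i]]_k),
      (forall i, normc (inner (x i) (x i)) <= 1) ->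
      (forall j, normc (inner (y j) (y j)) <= 1) ->
      normc (\sum_(i < m) \sum_(j < n) A i j * inner (x i) (y j)) <= K].

Definition beta_const (R : realType) (d : nat) (lambda alpha C : R) : R :=
  Num.max 1 (Num.max (6 / (C * alpha * (1 - alpha)))
                     ((d%:R + (1 - (lambda == 1)%:R)) / 2)).

Definition K_const (R : realType) (alpha C beta : R) : R :=
  (beta ^+ 2 / (C * alpha * (1 - alpha))) `^ alpha^-1.

Definition p_fun (R : realType) (alpha C beta x : R) : R :=
  C * x `^ alpha - beta * ln (1 + x).

(* t, s, r range over the integers of [0, 4K]; the maximands are positive, so
   the default value 0 plays no role. *)
Definition M_const (R : realType) (alpha C beta : R) : R :=
  let p := p_fun alpha C beta in
  let N := (Num.truncn (4 * K_const alpha C beta)).+1 in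
  \big[Num.max/0]_(t < N) \big[Num.max/0]_(s < N) \big[Num.max/0]_(r < N)
    expR (p t%:R - p s%:R - p r%:R).

Definition growth_series (R : realType) (f : {poly R}) (lambda beta : R) : \bar R :=
  (\sum_(1 <= n <oo)
     ((f.[n%:R] - lambda * f.[n.-1%:R]) / (1 + n%:R) `^ (2 * beta))%:E)%E.

(* Computed in the extended reals because the series may diverge (when beta is
   the third term of its maximum); delta is then 0. *)
Definition delta_const (R : realType) (d : nat) (f : {poly R})
    (lambda alpha C : R) : R :=
  let beta := beta_const d lambda alpha C in
  fine ((expR 1)^-1%:E *
        (1 + (Grothendieck_constant R * M_const alpha C beta
                * 2 `^ (beta - 1))%:E
             * sqrte (1 + growth_series f lambda beta))^-1)%E.

(* Main.v *)
(* The ratio w(xy) / (w(x) w(y)) is at most q(min(tau x, tau y)) with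
   q(n) = exp(- C (1 - alpha) n^alpha), and Q = (sum_(x != 1) q(tau x)^2)^(1/2) is
   finite because the growth is polynomial. By Grothendieck's inequality the ratio
   is therefore a bounded multiplier, so that the multiplication of l^1(G, w) is
   bounded for the injective tensor norm, by D = 3/2 + 2 K_G Q. Iterating this on
   a polarized homogeneous polynomial of degree k, which costs a further factor
   k^k / k! <= e^k, and summing over k gives the von Neumann inequality with L = 1
   on every ball of radius delta <= 1 / (1 + e D). The delta of the theorem
   qualifies: 5 q(n) (1 + n)^beta <= M 2^(beta - 1) for n > 0, and this 5 absorbs
   the factor 2 and the constant 3/2 in D. Finally, Davie's criterion turns a
   von Neumann inequality into a presentation as a quotient of a uniform
   algebra. *)

(* [Grothendieck_constant] is an infimum, which would be 0 over an empty set; so Grothendieck's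
   inequality is proved here from scratch, with the constant 98, and every estimate by the infimum
   is checked against all admissible constants. The bound by D concerns tensors, tested against
   independent functionals in each factor, whereas the supremum norm controls a polynomial only
   where equal letters receive equal values. Polarization bridges the gap: averaging over roots of
   unity gives each slot its own variable and at the same time isolates a homogeneous part. The
   factorial estimate is used in the form k^k <= e^(k-1) k!, and this is what lets the geometric
   series sum to 1 as soon as delta (1 + e D) <= 1. A presentation as a quotient requires some
   positive radius, while delta is 0 when the growth series diverges; a finite D is therefore
   produced in that case too, from the decay of q alone. *)
From HB Require Import structures.
Require Import Defs.
From mathcomp Require Import all_boot all_order all_algebra.
From mathcomp Require Import fingroup perm.
From mathcomp Require Import cyclic separable cyclotomic.
From mathcomp Require Import all_classical all_reals all_analysis.
From mathcomp Require Import finmap complex ring lra zify.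
From mathcomp Require mpoly.
Import Order.TTheory GRing.Theory Num.Theory.
Import numFieldNormedType.Exports.
Import Normc.

Set Implicit Arguments.
Unset Strict Implicit.
Unset Printing Implicit Defensive.

Local Open Scope classical_set_scope.
Local Open Scope ring_scope.

(** * Grothendieck's inequality *)

Section ComplexModulus.
Variable R : realType.
Implicit Types (z w : R[i]) (x : R).

Lemma norm_normc z : `|z| = (normc z)%:C%C.
Proof. by []. Qed.

Lemma normc_ge0 z : 0 <= normc z.
Proof. by rewrite -(@lecR R) -norm_normc normr_ge0. Qed.

Lemma normcD z w : normc (z + w) <= normc z + normc w.
Proof. exact: (@le_normcD R z w). Qed.

Lemma normc_opp z : normc (- z) = normc z.
Proof. exact: (@normcN R z). Qed.

Lemma normcB z w : normc (z - w) <= normc z + normc w.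
Proof. by rewrite -(normc_opp w); exact: normcD. Qed.

Lemma normc_eq0 z : (normc z == 0) = (z == 0).
Proof.
by apply/eqP/eqP => [/eq0_normc//|->]; exact: normc0.
Qed.

Lemma normc_sum (J : Type) (r : seq J) (P : pred J) (F : J -> R[i]) :
  normc (\sum_(j <- r | P j) F j) <= \sum_(j <- r | P j) normc (F j).
Proof.
elim/big_rec2 : _ => [|j y x _ le_xy]; first by rewrite normc0.
by rewrite (le_trans (normcD _ _)) // lerD2l.
Qed.

Lemma normc_prod (J : Type) (r : seq J) (P : pred J) (F : J -> R[i]) :
  normc (\prod_(j <- r | P j) F j) = \prod_(j <- r | P j) normc (F j).
Proof. by apply: (big_morph (@normc R)) => [z w|]; rewrite ?normcM ?normc1. Qed.

Lemma normcX z n : normc (z ^+ n) = normc z ^+ n.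
Proof.
by elim: n => [|n IHn]; rewrite ?expr0 ?normc1 // !exprS normcM IHn.
Qed.

Lemma normc_real x : normc x%:C%C = `|x|.
Proof. by rewrite /normc /= expr0n addr0 sqrtr_sqr. Qed.

Lemma normc_nat n : normc (n%:R : R[i]) = n%:R.
Proof.
have -> : (n%:R : R[i]) = (n%:R : R)%:C%C by rewrite rmorph_nat.
by rewrite normc_real normr_nat.
Qed.

Lemma normc_conj z : normc z^* = normc z.
Proof.
have : `|z^*| = `|z| by rewrite norm_conjC.
by rewrite !norm_normc => -[].
Qed.

Lemma normc_sqr z : (normc z ^+ 2)%:C%C = z * z^*.
Proof. by rewrite rmorphXn /= -norm_normc normCK. Qed.

Lemma normc_Re z : `|complex.Re z| <= normc z.
Proof. by rewrite -(@lecR R) -norm_normc normc_ge_Re. Qed.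

Lemma normc_Im z : `|complex.Im z| <= normc z.
Proof.
case: z => a b /=; rewrite -sqrtr_sqr ler_wsqrtr //.
by rewrite lerDr sqr_ge0.
Qed.

Lemma normc_le_ReIm z : normc z <= `|complex.Re z| + `|complex.Im z|.
Proof.
have -> : z = (complex.Re z)%:C%C + (complex.Im z)%:C%C * 'i%C.
  by case: z => a b /=; congr Complex => /=; ring.
rewrite (le_trans (normcD _ _)) // normcM !normc_real /=.
rewrite !(mul0r, mulr0, mulr1, addr0, add0r, subr0).
by rewrite expr0n expr1n /= add0r sqrtr1 mulr1.
Qed.

(* The value at [z = 0] is 1, so that a phase always has modulus one. *)
Definition phase z : R[i] := if z == 0 then 1 else (normc z)%:C%C / z.

Lemma normc_phase z : normc (phase z) = 1.
Proof.
rewrite /phase; case: eqVneq => [_|z0]; first exact: normc1.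
rewrite normcM normcV normc_real ger0_norm ?normc_ge0 // divff //.
by rewrite normc_eq0.
Qed.

Lemma phaseM z : phase z * z = (normc z)%:C%C.
Proof.
rewrite /phase; case: eqVneq => [->|z0]; first by rewrite mulr0 normc0.
by rewrite divfK.
Qed.

(** ['X^n - 1] is separable in characteristic 0, so it has n distinct roots, and n distinct n-th
    roots of unity include a primitive one. *)
Lemma prim_root_exists n : (0 < n)%N -> exists z : R[i], n.-primitive_root z.
Proof.
move=> n_gt0; set p : {poly R[i]} := 'X^n - 1.
have [s def_p] := closed_field_poly_normal p.
have p_mon : p \is monic by rewrite monicXnsubC.
move: def_p; rewrite (monicP p_mon) scale1r => def_p.
have sz_s : size s = n.
  apply: succn_inj; rewrite -(size_prod_XsubC s id) -def_p.
  by rewrite size_XnsubC.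
have s_root : all n.-unity_root s.
  by apply/allP => z zs; rewrite /root_of_unity -/p def_p root_prod_XsubC.
have s_uniq : uniq s.
  rewrite -separable_prod_XsubC -def_p.
  by rewrite separable_Xn_sub_1 // pnatr_eq0 -lt0n.
by have /hasP[z] := has_prim_root n_gt0 s_root s_uniq (eq_leq (esym sz_s));
  exists z.
Qed.

End ComplexModulus.

(** * Grothendieck's inequality with the constant 98 *)

Section Grothendieck.
Variable R : realType.
Local Notation C := R[i].

Lemma sum_complexR (J : Type) (r : seq J) (P : pred J) (F : J -> R) :
  (\sum_(j <- r | P j) F j)%:C%C = \sum_(j <- r | P j) (F j)%:C%C :> C.
Proof. exact: (rmorph_sum (real_complex R)). Qed.

Lemma sum_normc_sqr (J : Type) (r : seq J) (P : pred J) (x : J -> C) :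
  (\sum_(j <- r | P j) normc (x j) ^+ 2)%:C%C =
  \sum_(j <- r | P j) x j * (x j)^*.
Proof. by rewrite sum_complexR; apply: eq_bigr => j _; exact: normc_sqr. Qed.

Lemma expr4 (x : R) : x ^+ 4 = (x ^+ 2) ^+ 2.
Proof. by rewrite -exprM. Qed.

(** The two sides differ by 8 times the square of the imaginary part of z times the conjugate of w.
    This is the fourth moment after one more random sign; the coefficient 6 is what keeps the
    constant 3 of [rademacher] stable under induction. *)
Lemma normc_fourth (z w : C) :
  normc (z + w) ^+ 4 + normc (z - w) ^+ 4 <=
  2 * (normc z ^+ 4 + 6 * (normc z ^+ 2 * normc w ^+ 2) + normc w ^+ 4).
Proof.
have sq (v : C) : normc v ^+ 2 = complex.Re v ^+ 2 + complex.Im v ^+ 2.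
  by case: v => a b /=; rewrite sqr_sqrtr // addr_ge0 ?sqr_ge0.
rewrite !expr4 !sq; case: z => a b; case: w => c d /=.
rewrite -subr_ge0.
have -> : 2 * ((a ^+ 2 + b ^+ 2) ^+ 2 +
               6 * ((a ^+ 2 + b ^+ 2) * (c ^+ 2 + d ^+ 2)) +
               (c ^+ 2 + d ^+ 2) ^+ 2) -
          (((a + c) ^+ 2 + (b + d) ^+ 2) ^+ 2 +
           ((a - c) ^+ 2 + (b - d) ^+ 2) ^+ 2) =
          8 * (a * d - b * c) ^+ 2 by ring.
by rewrite mulr_ge0 ?sqr_ge0.
Qed.

Definition rademacher_sum (L : eqType) (s : seq L) (Om : Type)
    (e : Om -> L -> bool) (x : L -> C) (w : Om) : C :=
  \sum_(l <- s) (-1) ^+ e w l * x l.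

(* Independent signs have fourth moments bounded by 3; the sample space is built
   by adjoining one coin at a time. *)
Lemma rademacher (L : eqType) (s : seq L) : uniq s ->
  exists (Om : finType) (e : Om -> L -> bool), [/\ (0 < #|Om|)%N,
    forall x y, \sum_w rademacher_sum s e x w * (rademacher_sum s e y w)^* =
      #|Om|%:R * \sum_(l <- s) x l * (y l)^*
  & forall x, \sum_w normc (rademacher_sum s e x w) ^+ 4 <=
      3 * #|Om|%:R * (\sum_(l <- s) normc (x l) ^+ 2) ^+ 2].
Proof.
elim: s => [|a s IHs] /=.
  move=> _; exists unit, (fun _ _ => false); rewrite /rademacher_sum.
  split=> [|x y|x]; first by rewrite card_unit.
    rewrite big_nil mulr0 big1 // => w _.
    by rewrite big_nil mul0r.
  by rewrite big1 => [|w _]; rewrite big_nil ?normc0 expr0n // mulr0.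
case/andP=> a_s /IHs[Om [e [Om_gt0 e_in e_four]]].
pose e' (w : Om * bool) l := if l == a then w.2 else e w.1 l.
have rsE x w : rademacher_sum (a :: s) e' x w =
    rademacher_sum s e x w.1 + (-1) ^+ w.2 * x a.
  rewrite /rademacher_sum big_cons /e' eqxx addrC; congr (_ + _).
  apply: eq_big_seq => l ls; rewrite ifN //.
  by apply: contraNneq a_s => <-.
have sumb (V : zmodType) (f : Om * bool -> V) :
    \sum_w f w = \sum_w (f (w, true) + f (w, false)).
  transitivity (\sum_p (fun w b => f (w, b)) p.1 p.2).
    by apply: eq_bigr => -[].
  rewrite -(pair_bigA _ (fun w b => f (w, b))) /=.
  by apply: eq_bigr => w _; rewrite big_bool.
have sN : #|{: Om * bool}|%:R = 2 * #|Om|%:R :> R.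
  by rewrite card_prod card_bool natrM mulrC.
exists (Om * bool)%type, e'; split=> [|x y|x].
- by rewrite card_prod card_bool muln_gt0 Om_gt0.
- rewrite sumb (eq_bigr (fun w => 2 * (rademacher_sum s e x w *
      (rademacher_sum s e y w)^*) + 2 * (x a * (y a)^*))); last first.
    move=> w _; rewrite !rsE /= expr0 expr1 !mul1r !mulN1r !rmorphD !rmorphN /=.
    ring.
  rewrite big_split /= -!mulr_sumr e_in sumr_const big_cons card_prod card_bool.
  by rewrite natrM -mulr_natl; ring.
have e_two : \sum_w normc (rademacher_sum s e x w) ^+ 2 =
    #|Om|%:R * \sum_(l <- s) normc (x l) ^+ 2.
  apply: (@complexI R); rewrite sum_normc_sqr e_in rmorphM /= sum_normc_sqr.
  by rewrite (rmorph_nat (real_complex R)).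
rewrite sumb.
apply: (le_trans (ler_sum (G := fun w => 2 *
    (normc (rademacher_sum s e x w) ^+ 4 +
     6 * (normc (rademacher_sum s e x w) ^+ 2 * normc (x a) ^+ 2) +
     normc (x a) ^+ 4)) _ _)).
  move=> w _; rewrite !rsE /= expr0 expr1 mul1r mulN1r addrC.
  exact: normc_fourth.
rewrite -mulr_sumr !big_split /= -mulr_sumr -mulr_suml e_two sumr_const.
rewrite sN big_cons -[_ *+ #|_|]mulr_natl.
set S := \sum_(l <- s) _; set N := #|Om|%:R; set b := normc (x a).
have := e_four x; rewrite -/N -/S; set S4 := \sum_w _ => le_S4.
have N_ge0 : 0 <= N by rewrite ler0n.
have S_ge0 : 0 <= S by apply: sumr_ge0 => l _; rewrite sqr_ge0.
rewrite [b ^+ 4]expr4.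
have b_ge0 := sqr_ge0 b; move: (b ^+ 2) b_ge0 => c c_ge0.
have := mulr_ge0 N_ge0 (sqr_ge0 c); lra.
Qed.

Definition bilinear_bound (I J : finType) (T : I -> J -> C) (k : R) :=
  forall (s : I -> C) (t : J -> C),
    (forall i, normc (s i) <= 1) -> (forall j, normc (t j) <= 1) ->
    normc (\sum_i \sum_j T i j * s i * t j) <= k.

(** The coordinate type [L] is left free so that the same bound also applies to functions on the
    sample space of the random signs. *)
Definition hilbert_bound (I J : finType) (T : I -> J -> C) (k : R) :=
  forall (L : finType) (x : I -> L -> C) (y : J -> L -> C),
    (forall i, \sum_l normc (x i l) ^+ 2 <= 1) ->
    (forall j, \sum_l normc (y j l) ^+ 2 <= 1) ->
    normc (\sum_i \sum_j T i j * \sum_l x i l * (y j l)^*) <= k.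

(** A crude bound that depends on [T]. It makes the supremum over all vectors finite, so that the
    self-improving estimate can be applied to it. *)
Lemma hilbert_bound_finite (I J : finType) (T : I -> J -> C) :
  hilbert_bound T (\sum_i \sum_j normc (T i j)).
Proof.
move=> L x y x1 y1.
apply: (le_trans (normc_sum _ _ _)); apply: ler_sum => i _.
apply: (le_trans (normc_sum _ _ _)); apply: ler_sum => j _.
rewrite normcM ler_piMr ?normc_ge0 //.
apply: (le_trans (normc_sum _ _ _)).
apply: (@le_trans _ _ (\sum_l 2^-1 * (normc (x i l) ^+ 2 + normc (y j l) ^+ 2))).
  apply: ler_sum => l _; rewrite normcM normc_conj.
  have := sqr_ge0 (normc (x i l) - normc (y j l)); nra.
rewrite -mulr_sumr big_split /=; have := x1 i; have := y1 j; lra.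
Qed.

Lemma bilinear_bound_scale (I J : finType) (T : I -> J -> C) k (c : R)
    (s : I -> C) (t : J -> C) : bilinear_bound T k -> 0 < c ->
  (forall i, normc (s i) <= c) -> (forall j, normc (t j) <= c) ->
  normc (\sum_i \sum_j T i j * (s i * t j)) <= k * c ^+ 2.
Proof.
move=> Tk c_gt0 s_le t_le.
have cC_neq0 : c%:C%C != 0 :> C by rewrite (inj_eq (@complexI R) c 0) gt_eqF.
have le1 z : normc z <= c -> normc (z / c%:C%C) <= 1.
  move=> z_le; rewrite normcM normcV normc_real gtr0_norm //.
  by rewrite ler_pdivrMr // mul1r.
have := Tk _ _ (fun i => le1 _ (s_le i)) (fun j => le1 _ (t_le j)).
rewrite -(ler_pM2r (exprn_gt0 2 c_gt0)); apply: le_trans.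
rewrite -[c ^+ 2]ger0_norm ?sqr_ge0 // -normc_real -normcM mulr_suml le_eqVlt.
apply/orP; left; apply/eqP; congr normc; apply: eq_bigr => i _.
rewrite mulr_suml; apply: eq_bigr => j _; rewrite rmorphXn /=.
by field.
Qed.

(* Truncating the Rademacher sums at height 7 leaves remainders of L2-norm at
   most 1/4, since 3 / 7 ^ 2 <= (1/4) ^ 2. *)
Lemma hilbert_bound_improve (I J : finType) (T : I -> J -> C) (k : R) :
  bilinear_bound T 1 -> hilbert_bound T k -> hilbert_bound T (49 + k / 2).
Proof.
move=> T1 Tk L x y x1 y1.
have [Om [e [Om_gt0 e_in e_four]]] := rademacher (index_enum_uniq L).
set N : R := #|Om|%:R; have N_gt0 : 0 < N by rewrite ltr0n.
pose X v w := rademacher_sum (index_enum L) e v w.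
pose U v w := if normc (X v w) <= 7 then X v w else 0.
pose V v w := X v w - U v w.
(* Multiplication by [q] turns the counting measure of [Om] into a probability measure, so that
   [X v] has the norm of [v]. *)
pose q : C := (Num.sqrt N)^-1%:C%C.
have q2 : q * q^* = N^-1%:C%C.
  rewrite -normc_sqr normc_real real_normK ?num_real // exprVn sqr_sqrtr // ltW.
have sq_q z : normc (q * z) ^+ 2 = N^-1 * normc z ^+ 2.
  rewrite normcM exprMn; congr (_ * _); apply: (@complexI R).
  by rewrite normc_sqr q2.
have X2 v : \sum_w normc (X v w) ^+ 2 = N * \sum_l normc (v l) ^+ 2.
  apply: (@complexI R); rewrite sum_normc_sqr e_in rmorphM /= sum_normc_sqr.
  by rewrite (rmorph_nat (real_complex R)).
have U_le v w : normc (U v w) <= 7 by rewrite /U; case: ifP; rewrite // normc0.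
have X_1 v : \sum_l normc (v l) ^+ 2 <= 1 ->
    \sum_w normc (q * X v w) ^+ 2 <= 1.
  move=> v1; under eq_bigr do rewrite sq_q.
  by rewrite -mulr_sumr X2 mulKf ?gt_eqF.
have U_1 v : \sum_l normc (v l) ^+ 2 <= 1 ->
    \sum_w normc (q * U v w) ^+ 2 <= 1.
  move=> /X_1; apply: le_trans; apply: ler_sum => w _; rewrite !sq_q.
  rewrite ler_pM2l ?invr_gt0 // /U; case: ifP => // _.
  by rewrite normc0 expr0n sqr_ge0.
have V_1 v : \sum_l normc (v l) ^+ 2 <= 1 ->
    \sum_w normc (4 * (q * V v w)) ^+ 2 <= 1.
  move=> v1.
  (* The remainder is nonzero only where |X| > 7, and there |X|^2 <= |X|^4 / 49. With the fourth
     moment 3, the factor 4 is affordable because 16 * 3 / 49 <= 1. *)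
  have V4 w : normc (V v w) ^+ 2 <= normc (X v w) ^+ 4 / 49.
    rewrite /V /U; case: ifPn => [_|].
      rewrite subrr normc0 expr0n mulr_ge0 ?invr_ge0 //.
      by rewrite expr4 sqr_ge0.
    rewrite subr0 -ltNge => X_gt; rewrite ler_pdivlMr //.
    rewrite expr4 [_ ^+ 2 ^+ 2]expr2 ler_wpM2l ?sqr_ge0 //; nra.
  apply: (@le_trans _ _ (\sum_w 16 * N^-1 * (normc (X v w) ^+ 4 / 49))).
    apply: ler_sum => w _; rewrite normcM exprMn sq_q normc_nat mulrA.
    rewrite (_ : 4 ^+ 2 = 16 :> R); last by ring.
    by rewrite ler_wpM2l ?V4 // mulr_ge0 ?invr_ge0 // ltW.
  rewrite -mulr_sumr -mulr_suml; have := e_four v; rewrite -/N.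
  set W := \sum_w _; set S := \sum_(l <- _) _ => W_le.
  have S_ge0 : 0 <= S by apply: sumr_ge0 => l _; rewrite sqr_ge0.
  have : S ^+ 2 <= 1 by rewrite expr_le1.
  have : N^-1 * W <= 3 * S ^+ 2.
    by rewrite ler_pdivrMl // mulrA [N * 3]mulrC.
  lra.
pose B (g h : Om -> C) := N^-1%:C%C * \sum_w g w * (h w)^*.
have BE (g h : Om -> C) : B g h = \sum_w (q * g w) * (q * h w)^*.
  rewrite /B mulr_sumr; apply: eq_bigr => w _.
  by rewrite rmorphM mulrACA q2.
(* X X = U U + U V + V X. The first term costs 7^2 = 49 pointwise; each of the others contains a
   remainder of norm at most 1/4 and costs k / 4. *)
have -> : \sum_i \sum_j T i j * (\sum_l x i l * (y j l)^*) =
    \sum_i \sum_j T i j * B (U (x i)) (U (y j)) +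
    \sum_i \sum_j T i j * B (U (x i)) (V (y j)) +
    \sum_i \sum_j T i j * B (V (x i)) (X (y j)).
  rewrite -!big_split /=; apply: eq_bigr => i _.
  rewrite -!big_split /=; apply: eq_bigr => j _.
  rewrite -!mulrDr -!big_split /=; congr (_ * _).
  transitivity (N^-1%:C%C * \sum_w X (x i) w * (X (y j) w)^*).
    rewrite e_in mulrA -[#|Om|%:R](rmorph_nat (real_complex R)).
    by rewrite -rmorphM mulVf ?gt_eqF // mul1r.
  congr (_ * _); apply: eq_bigr => w _; rewrite /V rmorphB; ring.
rewrite (_ : 49 + k / 2 = 49 + k / 4 + k / 4); last by field.
apply: (le_trans (normcD _ _)); apply: lerD; last first.
  have := Tk Om (fun i w => 4 * (q * V (x i) w)) (fun j w => q * X (y j) w)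
    (fun i => V_1 _ (x1 i)) (fun j => X_1 _ (y1 j)).
  rewrite ler_pdivlMr // mulrC -[4 in X in _ -> X](normc_nat R) -normcM mulr_sumr.
  apply: le_trans; rewrite le_eqVlt; apply/orP; left; apply/eqP.
  congr normc; apply: eq_bigr => i _; rewrite mulr_sumr.
  apply: eq_bigr => j _; rewrite mulrCA; congr (_ * _); rewrite BE mulr_sumr.
  apply: eq_bigr => w _; exact: mulrA.
apply: (le_trans (normcD _ _)); apply: lerD; last first.
  have := Tk Om (fun i w => q * U (x i) w) (fun j w => 4 * (q * V (y j) w))
    (fun i => U_1 _ (x1 i)) (fun j => V_1 _ (y1 j)).
  rewrite ler_pdivlMr // mulrC -[4 in X in _ -> X](normc_nat R) -normcM mulr_sumr.
  apply: le_trans; rewrite le_eqVlt; apply/orP; left; apply/eqP.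
  congr normc; apply: eq_bigr => i _; rewrite mulr_sumr.
  apply: eq_bigr => j _; rewrite mulrCA; congr (_ * _); rewrite BE mulr_sumr.
  by apply: eq_bigr => w _; rewrite [in RHS]rmorphM rmorph_nat mulrCA.
have -> : \sum_i \sum_j T i j * B (U (x i)) (U (y j)) =
    N^-1%:C%C * \sum_w \sum_i \sum_j T i j * (U (x i) w * (U (y j) w)^*).
  rewrite [in RHS]exchange_big mulr_sumr; apply: eq_bigr => i _.
  rewrite [in RHS]exchange_big mulr_sumr; apply: eq_bigr => j _.
  by rewrite -mulr_sumr mulrCA.
rewrite normcM normc_real ger0_norm; last by rewrite invr_ge0 ltW.
rewrite ler_pdivrMl //; apply: (le_trans (normc_sum _ _ _)).
apply: (@le_trans _ _ (\sum_(w : Om) 49)); last first.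
  by rewrite sumr_const -[X in X <= _]mulr_natl.
apply: ler_sum => w _.
rewrite (_ : 49 = 1 * 7 ^+ 2); last by ring.
by apply: bilinear_bound_scale => // j; rewrite normc_conj.
Qed.

(** The supremum of all the values is finite and is itself a Hilbert bound; the improvement turns it
    into sup <= 49 + sup / 2, which forces sup <= 98. *)
Theorem Grothendieck_inequality (I J : finType) (T : I -> J -> C) :
  bilinear_bound T 1 -> hilbert_bound T 98.
Proof.
move=> T1.
pose E := [set v : R | exists (L : finType) (x : I -> L -> C) (y : J -> L -> C),
    [/\ forall i, \sum_l normc (x i l) ^+ 2 <= 1,
        forall j, \sum_l normc (y j l) ^+ 2 <= 1
      & v = normc (\sum_i \sum_j T i j * \sum_l x i l * (y j l)^*)]].
have E_ub : has_ubound E.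
  exists (\sum_i \sum_j normc (T i j)) => _ [L [x [y [x1 y1 ->]]]].
  exact: hilbert_bound_finite.
have E_sup : hilbert_bound T (sup E).
  by move=> L x y x1 y1; apply: ub_le_sup => //; exists L, x, y.
have : sup E <= 49 + sup E / 2.
  apply: sup_le_ub => [|_ [L [x [y [x1 y1 ->]]]]]; last first.
    exact: hilbert_bound_improve.
  have zero_le1 : \sum_(l : unit) normc (0 : C) ^+ 2 <= 1.
    by rewrite big1 // => l _; rewrite normc0 expr0n.
  exists (normc (\sum_i \sum_j T i j * \sum_(l : unit) 0 * 0^*)).
  by exists unit, (fun _ _ => 0), (fun _ _ => 0).
move=> sup_le L x y x1 y1; apply: le_trans (E_sup _ _ _ x1 y1) _; lra.
Qed.

End Grothendieck.

(** * The infimum [Grothendieck_constant] as an admissible constant *)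

Section GrothendieckConstant.
Variable R : realType.
Local Notation C := R[i].
Local Notation KG := (Grothendieck_constant R).

Definition Grothendieck_bounds : set R :=
  [set K : R | forall (m n k : nat) (A : 'M[R[i]]_(m, n)),
    (forall (s : 'I_m -> R[i]) (t : 'I_n -> R[i]),
       (forall i, normc (s i) <= 1) -> (forall j, normc (t j) <= 1) ->
       normc (\sum_(i < m) \sum_(j < n) A i j * s i * t j) <= 1) ->
    forall (x : 'I_m -> 'rV[R[i]]_k) (y : 'I_n -> 'rV[R[i]]_k),
      (forall i, normc (inner (x i) (x i)) <= 1) ->
      (forall j, normc (inner (y j) (y j)) <= 1) ->
      normc (\sum_(i < m) \sum_(j < n) A i j * inner (x i) (y j)) <= K].

Lemma normc_inner k (x : 'rV[C]_k) :
  normc (inner x x) = \sum_(l < k) normc (x 0 l) ^+ 2.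
Proof.
rewrite /inner -sum_normc_sqr normc_real ger0_norm //.
by apply: sumr_ge0 => l _; rewrite sqr_ge0.
Qed.

Lemma Grothendieck_bounds_neq0 : Grothendieck_bounds !=set0.
Proof.
exists 98 => m n k A A1 x y x1 y1.
apply: (@Grothendieck_inequality R 'I_m 'I_n (fun i j => A i j) A1 'I_k
  (fun i l => x i 0 l) (fun j l => y j 0 l)) => [i|j].
- by rewrite -normc_inner.
- by rewrite -normc_inner.
Qed.

Lemma Grothendieck_constant_ge (v : R) :
  (forall K, Grothendieck_bounds K -> v <= K) -> v <= KG.
Proof. by move=> v_le; apply: lb_le_inf Grothendieck_bounds_neq0 _. Qed.

Lemma Grothendieck_constant_ge1 : 1 <= KG.
Proof.
apply: Grothendieck_constant_ge => K.
have one_inner : inner (const_mx 1 : 'rV[C]_1) (const_mx 1) = 1.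
  by rewrite /inner big_ord1 !mxE mul1r rmorph1.
move=> /(_ 1%N 1%N 1%N (const_mx 1)) K_ge.
have := K_ge _ (fun=> const_mx 1) (fun=> const_mx 1).
rewrite one_inner !big_ord1 mxE mulr1 normc1; apply => // s t s1 t1.
by rewrite !big_ord1 mxE mul1r normcM mulr_ile1 ?normc_ge0.
Qed.

Lemma Grothendieck_constant_hilbert (I J : finType) (T : I -> J -> C) :
  bilinear_bound T 1 -> hilbert_bound T KG.
Proof.
move=> T1 L x y x1 y1; apply: Grothendieck_constant_ge => K.
move=> /(_ #|I| #|J| #|L| (\matrix_(i < #|I|, j < #|J|) T (enum_val i) (enum_val j))).
have sumE (S : finType) (V : zmodType) (g : S -> V) :
    \sum_(i < #|S|) g (enum_val i) = \sum_i g i.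
  by rewrite [RHS](reindex _ (onW_bij _ (@enum_val_bij S))).
move=> /(_ _ (fun i => \row_(l < #|L|) x (enum_val i) (enum_val l))
             (fun j => \row_(l < #|L|) y (enum_val j) (enum_val l))).
have -> : \sum_i \sum_j T i j * (\sum_l x i l * (y j l)^*) =
    \sum_(i < #|I|) \sum_(j < #|J|)
      (\matrix_(i < #|I|, j < #|J|) T (enum_val i) (enum_val j)) i j *
      inner (\row_(l < #|L|) x (enum_val i) (enum_val l))
            (\row_(l < #|L|) y (enum_val j) (enum_val l)).
  rewrite -(sumE I); apply: eq_bigr => i _.
  rewrite -(sumE J); apply: eq_bigr => j _.
  rewrite mxE -(sumE L); congr (_ * _).
  by apply: eq_bigr => l _; rewrite !mxE.
apply=> [s t s1 t1|i|j].
- have := T1 (s \o enum_rank) (t \o enum_rank) (fun i => s1 _) (fun j => t1 _).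
  rewrite -(sumE I); apply: le_trans; rewrite le_eqVlt; apply/orP; left.
  apply/eqP; congr normc; apply: eq_bigr => i _.
  rewrite -(sumE J); apply: eq_bigr => j _.
  by rewrite mxE /= !enum_valK.
- rewrite normc_inner; apply: le_trans (x1 (enum_val i)).
  by rewrite -(sumE L) le_eqVlt; apply/orP; left; apply/eqP;
    apply: eq_bigr => l _; rewrite mxE.
- rewrite normc_inner; apply: le_trans (y1 (enum_val j)).
  by rewrite -(sumE L) le_eqVlt; apply/orP; left; apply/eqP;
    apply: eq_bigr => l _; rewrite mxE.
Qed.

(** Indicator vectors isolate a single entry. This settles the degenerate scale k = 0, at which a
    form cannot be normalized. *)
Lemma bilinear_bound0 (I J : finType) (T : I -> J -> C) :
  bilinear_bound T 0 -> forall i j, T i j = 0.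
Proof.
move=> T0 i j; apply: eq0_normc; apply/eqP; rewrite eq_le normc_ge0 andbT.
have le1 (S : eqType) (a b : S) : normc ((a == b)%:R : C) <= 1.
  by rewrite normc_nat; case: eqP.
have := T0 (fun i' => (i' == i)%:R) (fun j' => (j' == j)%:R)
  (fun=> le1 _ _ _) (fun=> le1 _ _ _).
rewrite (bigD1 i) //= [X in _ + X]big1 ?addr0 => [|i' /negPf ->].
  rewrite (bigD1 j) //= [X in _ + X]big1 ?addr0 => [|j' /negPf ->].
    by rewrite !eqxx !mulr1.
  by rewrite mulr0.
by rewrite big1 // => j' _; rewrite mulr0 mul0r.
Qed.

(** Homogeneity reduces this to the normalized case. Where a scale is 0 the data vanish, so the
    factorization v = c (c^-1 v) holds there as well. *)
Lemma Grothendieck_bound (I J L : finType) (T : I -> J -> C) (k a b : R)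
    (x : I -> L -> C) (y : J -> L -> C) :
  bilinear_bound T k -> 0 <= k -> 0 <= a -> 0 <= b ->
  (forall i, \sum_l normc (x i l) ^+ 2 <= a ^+ 2) ->
  (forall j, \sum_l normc (y j l) ^+ 2 <= b ^+ 2) ->
  normc (\sum_i \sum_j T i j * \sum_l x i l * (y j l)^*) <= KG * (k * a * b).
Proof.
move=> Tk k0 a0 b0 xa yb.
have vec (S : finType) (c : R) (v : S -> L -> C) : 0 <= c ->
    (forall i, \sum_l normc (v i l) ^+ 2 <= c ^+ 2) ->
    (forall i l, v i l = c%:C%C * ((c^-1)%:C%C * v i l)) /\
    (forall i, \sum_l normc ((c^-1)%:C%C * v i l) ^+ 2 <= 1).
  move=> c0 vc; have [c_eq0|c_neq0] := eqVneq c 0.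
    have v0 i l : v i l = 0.
      apply: eq0_normc; apply/eqP; rewrite -sqrf_eq0 eq_le sqr_ge0 andbT.
      have := vc i; rewrite c_eq0 expr0n /=; apply: le_trans.
      rewrite (bigD1 l) //= lerDl.
      by apply: sumr_ge0 => l' _; rewrite sqr_ge0.
    split=> [i l|i]; first by rewrite v0 !mulr0.
    by rewrite big1 // => l _; rewrite v0 mulr0 normc0 expr0n.
  have c_gt0 : 0 < c by rewrite lt_def c_neq0.
  split=> [i l|i].
    by rewrite mulrA -rmorphM divff // mul1r.
  under eq_bigr do rewrite normcM exprMn normc_real ger0_norm ?invr_ge0 //.
  by rewrite -mulr_sumr exprVn mulrC ler_pdivrMr ?exprn_gt0 // mul1r.
have [xE x1] := vec _ _ _ a0 xa.
have [yE y1] := vec _ _ _ b0 yb.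
have [TE T1] : (forall i j, T i j = k%:C%C * ((k^-1)%:C%C * T i j)) /\
    bilinear_bound (fun i j => (k^-1)%:C%C * T i j) 1.
  have [k_eq0|k_neq0] := eqVneq k 0.
    rewrite k_eq0 in Tk; have T0 := bilinear_bound0 Tk.
    split=> [i j|s t _ _]; first by rewrite T0 !mulr0.
    rewrite big1 ?normc0 // => i _; rewrite big1 // => j _.
    by rewrite T0 mulr0 !mul0r.
  have k_gt0 : 0 < k by rewrite lt_def k_neq0.
  split=> [i j|s t s1 t1]; first by rewrite mulrA -rmorphM divff // mul1r.
  under eq_bigr do (under eq_bigr do rewrite -!mulrA; rewrite -mulr_sumr).
  rewrite -mulr_sumr normcM normc_real ger0_norm ?invr_ge0 //.
  rewrite mulrC ler_pdivrMr // mul1r.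
  by under eq_bigr do under eq_bigr do rewrite mulrA; exact: Tk.
have -> : \sum_i \sum_j T i j * (\sum_l x i l * (y j l)^*) =
    (k * a * b)%:C%C * \sum_i \sum_j ((k^-1)%:C%C * T i j) *
      \sum_l ((a^-1)%:C%C * x i l) * ((b^-1)%:C%C * y j l)^*.
  rewrite mulr_sumr; apply: eq_bigr => i _.
  rewrite mulr_sumr; apply: eq_bigr => j _.
  have -> : \sum_l x i l * (y j l)^* = (a * b)%:C%C *
      \sum_l ((a^-1)%:C%C * x i l) * ((b^-1)%:C%C * y j l)^*.
    rewrite mulr_sumr; apply: eq_bigr => l _; rewrite {1}xE {1}yE.
    have bJ : (b%:C%C)^* = b%:C%C :> C := conjc_real b.
    by rewrite rmorphM [X in _ * (X * _) = _]bJ mulrACA [(a * b)%:C%C]rmorphM.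
  rewrite {1}TE -[k * a * b]mulrA [(k * (a * b))%:C%C]rmorphM.
  by rewrite mulrACA.
rewrite normcM normc_real ger0_norm ?mulr_ge0 // mulrC ler_wpM2r ?mulr_ge0 //.
exact: Grothendieck_constant_hilbert.
Qed.

End GrothendieckConstant.

(** * Weighted group algebras *)

Section AbsolutelySummable.
Variables (R : realType) (T : choiceType).
Local Notation C := R[i].
Implicit Types (u : T -> R) (f g : T -> C) (X Y : {fset T}).

Lemma ler_sum_fsubset u X Y : (forall x, 0 <= u x) -> (X `<=` Y)%fset ->
  \sum_(x <- X) u x <= \sum_(x <- Y) u x.
Proof.
move=> u0 XY; rewrite [leRHS](big_fsetID _ (mem X)) /=.
rewrite (_ : [fset x | x in Y & x \in X]%fset = X) ?lerDl ?sumr_ge0 //.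
apply/fsetP => x; rewrite !inE /=.
by apply/andP/idP => [[]//|xX]; split=> //; exact: (fsubsetP XY).
Qed.

Lemma esum_le_finite u (B : R) : (forall X, \sum_(x <- X) u x <= B) ->
  (\esum_(x in [set: T]) (u x)%:E <= B%:E)%E.
Proof.
move=> uB; apply: ge_ereal_sup => _ [X [finX _] <-].
by rewrite fsbig_finite //= sumEFin lee_fin.
Qed.

Lemma sum_le_esum u X : (forall x, 0 <= u x) ->
  ((\sum_(x <- X) u x)%:E <= \esum_(x in [set: T]) (u x)%:E)%E.
Proof.
move=> u0; apply: esum_ge; exists [set` X]; first by split.
by rewrite fsbig_finite //= set_fsetK sumEFin.
Qed.

Lemma fine_esum_ge u X : (forall x, 0 <= u x) ->
  (\esum_(x in [set: T]) (u x)%:E < +oo)%E ->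
  \sum_(x <- X) u x <= fine (\esum_(x in [set: T]) (u x)%:E).
Proof.
move=> u0 u_fin; rewrite -lee_fin fineK ?sum_le_esum //.
by rewrite ge0_fin_numE // esum_ge0 // => x _; rewrite lee_fin.
Qed.

Lemma fine_esum_le u (B : R) : (forall x, 0 <= u x) ->
  (forall X, \sum_(x <- X) u x <= B) ->
  fine (\esum_(x in [set: T]) (u x)%:E) <= B.
Proof.
move=> u0 uB; have le_B := esum_le_finite uB.
rewrite -lee_fin fineK // ge0_fin_numE; last first.
  by apply: esum_ge0 => x _; rewrite lee_fin.
exact: le_lt_trans le_B (ltry _).
Qed.

Lemma esum_finite_approx u (e : R) : (forall x, 0 <= u x) ->
  (\esum_(x in [set: T]) (u x)%:E < +oo)%E -> 0 < e ->
  exists X, fine (\esum_(x in [set: T]) (u x)%:E) - e <= \sum_(x <- X) u x.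
Proof.
move=> u0 u_fin e0.
have u_fin_num : (\esum_(x in [set: T]) (u x)%:E)%E \is a fin_num.
  by rewrite ge0_fin_numE // esum_ge0 // => x _; rewrite lee_fin.
have [_ [X [finX _] <-] lt_X] := ub_ereal_sup_adherent e0 u_fin_num.
exists (fset_set X); rewrite -lee_fin EFinB fineK //.
by move: lt_X; rewrite fsbig_finite //= sumEFin => /ltW.
Qed.

Definition csummable f := (\esum_(x in [set: T]) (normc (f x))%:E < +oo)%E.

Lemma csummableP f (B : R) :
  (forall X, \sum_(x <- X) normc (f x) <= B) -> csummable f.
Proof. by move=> fB; exact: le_lt_trans (esum_le_finite fB) (ltry _). Qed.

(** A finite set that nearly exhausts both the positive and the negative part stays good when
    enlarged, since the partial sums of each part are monotone. *)
Lemma real_sum_approx u (e : R) :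
  (\esum_(x in [set: T]) (`|u x|)%:E < +oo)%E -> 0 < e ->
  exists X, forall Y, (X `<=` Y)%fset ->
    `|real_sum u - \sum_(x <- Y) u x| <= e.
Proof.
move=> u_fin e0.
pose p x := Num.max (u x) 0; pose n x := Num.max (- u x) 0.
have p0 x : 0 <= p x by rewrite le_max lexx orbT.
have n0 x : 0 <= n x by rewrite le_max lexx orbT.
have le_fin v : (forall x, v x <= `|u x|) ->
    (\esum_(x in [set: T]) (v x)%:E < +oo)%E.
  move=> v_le; apply: le_lt_trans u_fin; apply: le_esum => x _.
  by rewrite lee_fin.
have p_fin : (\esum_(x in [set: T]) (p x)%:E < +oo)%E.
  by apply: le_fin => x; rewrite ge_max ler_norm normr_ge0.
have n_fin : (\esum_(x in [set: T]) (n x)%:E < +oo)%E.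
  by apply: le_fin => x; rewrite ge_max -normrN ler_norm normr_ge0.
have -> : real_sum u = fine (\esum_(x in [set: T]) (p x)%:E)%E -
                       fine (\esum_(x in [set: T]) (n x)%:E)%E.
  rewrite /real_sum fineB; last 2 first.
  - rewrite ge0_fin_numE; last first.
      by apply: esum_ge0 => x _; rewrite funeposE le_max lexx orbT.
    rewrite (eq_esum (b := fun x => (p x)%:E)) // => x _.
    by rewrite funeposE /= /p EFin_max.
  - rewrite ge0_fin_numE; last first.
      by apply: esum_ge0 => x _; rewrite funenegE le_max lexx orbT.
    rewrite (eq_esum (b := fun x => (n x)%:E)) // => x _.
    by rewrite funenegE /= /n EFin_max.
  congr (fine _ - fine _); apply: eq_esum => x _.
    by rewrite funeposE /= /p EFin_max.
  by rewrite funenegE /= /n EFin_max.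
have e2 : 0 < e / 2 by rewrite divr_gt0.
have [X1 X1P] := esum_finite_approx p0 p_fin e2.
have [X2 X2P] := esum_finite_approx n0 n_fin e2.
exists (X1 `|` X2)%fset => Y /fsubUsetP[X1Y X2Y].
have -> : \sum_(x <- Y) u x = \sum_(x <- Y) p x - \sum_(x <- Y) n x.
  rewrite -sumrB; apply: eq_bigr => x _.
  by rewrite /p /n /Order.max; case: ltP => ?; case: ltP => ?; lra.
have := fine_esum_ge Y p0 p_fin; have := fine_esum_ge Y n0 n_fin.
have := ler_sum_fsubset p0 X1Y; have := ler_sum_fsubset n0 X2Y.
by rewrite ler_norml => *; apply/andP; split; lra.
Qed.

Lemma complex_sum_approx f (e : R) : csummable f -> 0 < e ->
  exists X, forall Y, (X `<=` Y)%fset ->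
    normc (complex_sum f - \sum_(x <- Y) f x) <= e.
Proof.
move=> f_fin e0; have e2 : 0 < e / 2 by rewrite divr_gt0.
have part_fin (u : T -> R) : (forall x, `|u x| <= normc (f x)) ->
    (\esum_(x in [set: T]) (`|u x|)%:E < +oo)%E.
  by move=> u_le; apply: le_lt_trans f_fin; apply: le_esum => x _;
    rewrite lee_fin.
have [X1 X1P] := real_sum_approx (part_fin _ (fun x => normc_Re (f x))) e2.
have [X2 X2P] := real_sum_approx (part_fin _ (fun x => normc_Im (f x))) e2.
exists (X1 `|` X2)%fset => Y /fsubUsetP[/X1P le_Re /X2P le_Im].
apply: le_trans (normc_le_ReIm _) _.
have ReB (z w : C) : complex.Re (z - w) = complex.Re z - complex.Re w.
  by case: z; case: w.
have ImB (z w : C) : complex.Im (z - w) = complex.Im z - complex.Im w.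
  by case: z; case: w.
have ReD : {morph (@complex.Re R) : z w / z + w}.
  by case=> a b; case.
have ImD : {morph (@complex.Im R) : z w / z + w}.
  by case=> a b; case.
rewrite ReB ImB (big_morph _ ReD (erefl _)) (big_morph _ ImD (erefl _)) /=.
by lra.
Qed.

(** Limits along finite sets are unique. Linearity of [complex_sum] and its value on one-point
    families are derived through this criterion. *)
Lemma complex_sum_unique f (s : C) : csummable f ->
  (forall e : R, 0 < e -> exists X, forall Y, (X `<=` Y)%fset ->
     normc (s - \sum_(x <- Y) f x) <= e) -> complex_sum f = s.
Proof.
move=> f_fin s_approx; apply/eqP; rewrite -subr_eq0 -normc_eq0.
rewrite eq_le normc_ge0 andbT; apply/ler_addgt0Pl => e e0; rewrite addr0.
have e2 : 0 < e / 2 by rewrite divr_gt0.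
have [X XP] := complex_sum_approx f_fin e2.
have [Y YP] := s_approx _ e2.
have := XP (X `|` Y)%fset (fsubsetUl _ _).
have := YP (X `|` Y)%fset (fsubsetUr _ _).
set v := \sum_(x <- _) _ => le1 le2.
rewrite (_ : _ - _ = (complex_sum f - v) - (s - v)); last by ring.
by apply: le_trans (normcB _ _) _; lra.
Qed.

Lemma csummable_ler f g (k : R) : csummable g ->
  (forall x, normc (f x) <= k * normc (g x)) -> 0 <= k -> csummable f.
Proof.
move=> g_fin f_le k0; apply: csummableP => X.
apply: (@le_trans _ _ (\sum_(x <- X) k * normc (g x))).
  exact: ler_sum.
rewrite -mulr_sumr; apply: ler_wpM2l => //.
by apply: fine_esum_ge => // x; exact: normc_ge0.
Qed.

Lemma csummableD f g : csummable f -> csummable g ->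
  csummable (fun x => f x + g x).
Proof.
move=> f_fin g_fin; apply: csummableP => X.
apply: (@le_trans _ _ (\sum_(x <- X) normc (f x) + \sum_(x <- X) normc (g x))).
  by rewrite -big_split; apply: ler_sum => x _; exact: normcD.
by apply: lerD; apply: fine_esum_ge => // x; exact: normc_ge0.
Qed.

Lemma csummableZ (c : C) f : csummable f -> csummable (fun x => c * f x).
Proof.
move=> f_fin; apply: (csummable_ler (k := normc c) f_fin); rewrite ?normc_ge0 //.
by move=> x; rewrite normcM.
Qed.

Lemma complex_sumD f g : csummable f -> csummable g ->
  complex_sum (fun x => f x + g x) = complex_sum f + complex_sum g.
Proof.
move=> f_fin g_fin; apply: complex_sum_unique; first exact: csummableD.
move=> e e0; have e2 : 0 < e / 2 by rewrite divr_gt0.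
have [X XP] := complex_sum_approx f_fin e2.
have [Y YP] := complex_sum_approx g_fin e2.
exists (X `|` Y)%fset => Z /fsubUsetP[/XP le1 /YP le2].
rewrite big_split /= opprD addrACA.
by apply: le_trans (normcD _ _) _; lra.
Qed.

Lemma complex_sumZ (c : C) f : csummable f ->
  complex_sum (fun x => c * f x) = c * complex_sum f.
Proof.
move=> f_fin; apply: complex_sum_unique; first exact: csummableZ.
move=> e e0; have e2 : 0 < e / (1 + normc c).
  by rewrite divr_gt0 // ltr_pwDl ?normc_ge0.
have [X XP] := complex_sum_approx f_fin e2.
exists X => Y /XP le1; rewrite -mulr_sumr -mulrBr normcM.
have := normc_ge0 c; have := normc_ge0 (complex_sum f - \sum_(x <- Y) f x).
rewrite ler_pdivlMr in le1; last by rewrite ltr_pwDl ?normc_ge0.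
by move=> *; nra.
Qed.

Lemma complex_sum_single f a : (forall x, x != a -> f x = 0) ->
  complex_sum f = f a.
Proof.
move=> f0; apply: complex_sum_unique.
  apply: (csummableP (B := normc (f a))) => X.
  have [aX|aX] := boolP (a \in X).
    rewrite (big_fsetD1 a) //= big_seq big1 ?addr0 // => x.
    by rewrite !inE => /andP[/f0-> _]; rewrite normc0.
  rewrite big_seq big1 ?normc_ge0 // => x xX.
  by rewrite f0 ?normc0 //; apply: contraNneq aX => <-.
move=> e e0; exists [fset a]%fset => Y; rewrite fsub1set => aY.
rewrite (big_fsetD1 a) //= big_seq big1 ?addr0.
  by rewrite subrr normc0 ltW.
by move=> x; rewrite !inE => /andP[/f0].
Qed.

End AbsolutelySummable.

(** * Convolution on the weighted l1 space *)

Record weight (R : realType) (G : groupType) := Weight {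
  weight_fun :> G -> R;
  weight_gt0 : forall x, 0 < weight_fun x;
  weightM : forall x y, weight_fun (x * y)%g <= weight_fun x * weight_fun y }.

Section WeightedNorm.
Variables (R : realType) (G : groupType) (w : weight R G).
Local Notation C := R[i].
Implicit Types (g h : G -> C) (X Y Z : {fset G}) (x y z : G).

Let term_ge0 g x : 0 <= normc (g x) * w x.
Proof. by rewrite mulr_ge0 ?normc_ge0 ?(ltW (weight_gt0 _ _)). Qed.

Definition l1_set : {pred G -> C} := fun g => `[< (l1_norm w g < +oo)%E >].
Definition l1_real_norm g : R := fine (l1_norm w g).

Lemma l1_real_norm_ge0 g : 0 <= l1_real_norm g.
Proof. by rewrite fine_ge0 // esum_ge0 // => x _; rewrite lee_fin. Qed.

Lemma l1_sum_le g X : g \in l1_set ->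
  \sum_(x <- X) normc (g x) * w x <= l1_real_norm g.
Proof. by move=> /asboolP g_fin; apply: fine_esum_ge. Qed.

Lemma l1_real_norm_le g (B : R) :
  (forall X, \sum_(x <- X) normc (g x) * w x <= B) -> l1_real_norm g <= B.
Proof. by move=> gB; apply: fine_esum_le. Qed.

Lemma l1_setP g (B : R) :
  (forall X, \sum_(x <- X) normc (g x) * w x <= B) -> g \in l1_set.
Proof.
move=> gB; apply/asboolP; exact: le_lt_trans (esum_le_finite gB) (ltry _).
Qed.

Lemma l1_point_le g x : g \in l1_set -> normc (g x) * w x <= l1_real_norm g.
Proof. by move=> /(l1_sum_le [fset x]%fset); rewrite big_seq_fset1. Qed.

Lemma l1_real_norm_eq0 g x : g \in l1_set -> l1_real_norm g <= 0 -> g x = 0.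
Proof.
move=> /(l1_point_le x) gx g0; apply: eq0_normc; apply/eqP.
rewrite eq_le normc_ge0 andbT -(pmulr_lle0 _ (weight_gt0 w x)).
exact: le_trans gx g0.
Qed.

Lemma l1_set_submod : submod_closed l1_set.
Proof.
split=> [|c g h gl hl].
  apply: (@l1_setP _ 0) => X; rewrite big1 // => x _.
  by rewrite normc0 mul0r.
apply: (@l1_setP _ (normc c * l1_real_norm g + l1_real_norm h)) => X.
have := l1_sum_le X gl; have := l1_sum_le X hl => le_h.
move/(ler_wpM2l (normc_ge0 c)); rewrite mulr_sumr => le_g.
apply: le_trans (lerD le_g le_h); rewrite -big_split; apply: ler_sum => x _ /=.
rewrite mulrA -mulrDl ler_wpM2r ?(ltW (weight_gt0 _ _)) // -normcM.
exact: (normcD (c * g x) (h x)).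
Qed.

(** One factor is bounded in the supremum norm: w z <= w y * w (y^-1 z), and |h| w is at every point
    at most the norm of [h]. This makes the series of each single value of the convolution
    converge. *)
Lemma weight_shift_le g h Y z :
  g \in l1_set -> h \in l1_set ->
  \sum_(y <- Y) normc (g y * h (y^-1 * z)%g) * w z <=
  l1_real_norm g * l1_real_norm h.
Proof.
move=> gl hl; apply: (@le_trans _ _
  (\sum_(y <- Y) normc (g y) * w y * l1_real_norm h)).
  apply: ler_sum => y _; rewrite normcM -mulrA -mulrA.
  rewrite ler_wpM2l ?normc_ge0 //.
  apply: le_trans (ler_wpM2l (ltW (weight_gt0 w y)) (l1_point_le (y^-1 * z)%g hl)).
  rewrite mulrCA ler_wpM2l ?normc_ge0 //.
  by have := weightM w y (y^-1 * z)%g; rewrite mulKVg.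
by rewrite -mulr_suml ler_wpM2r ?l1_real_norm_ge0 ?l1_sum_le.
Qed.

Lemma convolution_summable g h z : g \in l1_set -> h \in l1_set ->
  csummable (fun y => g y * h (y^-1 * z)%g).
Proof.
move=> gl hl.
apply: (csummableP (B := l1_real_norm g * l1_real_norm h / w z)) => Y.
rewrite ler_pdivlMr ?weight_gt0 // mulr_suml; exact: weight_shift_le.
Qed.

(** Fubini is applied to finite sums only: the finitely many values on [Z] are replaced by partial
    sums over one common finite set [Y], up to an arbitrarily small error. *)
Lemma convolution_sum_le g h Z : g \in l1_set -> h \in l1_set ->
  \sum_(z <- Z) normc (convolution g h z) * w z <=
  l1_real_norm g * l1_real_norm h.
Proof.
move=> gl hl; apply/ler_addgt0Pl => e e0.
(* A pointwise error e / (1 + S) costs at most e in the weighted sum; the 1 keeps the divisor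
   positive when [Z] is empty. *)
set S := \sum_(z <- Z) w z.
have S0 : 0 < 1 + S.
  by rewrite ltr_pwDl // sumr_ge0 // => z _; rewrite ltW ?weight_gt0.
have e2 : 0 < e / (1 + S) by rewrite divr_gt0.
have /choice[X XP] : forall z, exists X, forall Y, (X `<=` Y)%fset ->
    normc (convolution g h z - \sum_(y <- Y) g y * h (y^-1 * z)%g) <=
    e / (1 + S).
  by move=> z; apply: complex_sum_approx => //; exact: convolution_summable.
pose Y := (\bigcup_(z <- Z) X z)%fset.
apply: (@le_trans _ _ (\sum_(z <- Z)
    (e / (1 + S) * w z +
     \sum_(y <- Y) normc (g y) * w y *
       (normc (h (y^-1 * z)%g) * w (y^-1 * z)%g)))).
  rewrite !big_seq; apply: ler_sum => z zZ.
  have XY : (X z `<=` Y)%fset by exact: bigfcup_sup.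
  have := normcD (convolution g h z - \sum_(y <- Y) g y * h (y^-1 * z)%g)
    (\sum_(y <- Y) g y * h (y^-1 * z)%g); rewrite subrK => le1.
  apply: le_trans (ler_wpM2r (ltW (weight_gt0 w z)) le1) _.
  rewrite mulrDl; apply: lerD.
    by rewrite ler_wpM2r ?(ltW (weight_gt0 _ _)) // XP.
  apply: le_trans (ler_wpM2r (ltW (weight_gt0 w z)) (normc_sum _ _ _)) _.
  rewrite mulr_suml; apply: ler_sum => y _.
  rewrite normcM mulrACA ler_wpM2l ?mulr_ge0 ?normc_ge0 //.
  by have := weightM w y (y^-1 * z)%g; rewrite mulKVg.
rewrite big_split /= -mulr_sumr -/S; apply: lerD.
  by rewrite -mulrA ler_piMr ?(ltW e0) // mulrC ler_pdivrMr // mul1r lerDr.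
rewrite exchange_big /=; apply: (@le_trans _ _
  (\sum_(y <- Y) normc (g y) * w y * l1_real_norm h)).
  apply: ler_sum => y _; rewrite -mulr_sumr ler_wpM2l //.
  have := l1_sum_le ((fun z => y^-1 * z)%g @` Z)%fset hl.
  by rewrite big_imfset //= => z1 z2 _ _; exact: mulgI.
by rewrite -mulr_suml ler_wpM2r ?l1_real_norm_ge0 ?l1_sum_le.
Qed.

Lemma convolution_l1 g h : g \in l1_set -> h \in l1_set ->
  convolution g h \in l1_set.
Proof. by move=> gl hl; apply: l1_setP => Z; exact: convolution_sum_le. Qed.

Lemma convolution_norm_le g h : g \in l1_set -> h \in l1_set ->
  l1_real_norm (convolution g h) <= l1_real_norm g * l1_real_norm h.
Proof.
by move=> gl hl; apply: l1_real_norm_le => Z; exact: convolution_sum_le.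
Qed.

Lemma convolution_linearl (c : C) g g' h :
  g \in l1_set -> g' \in l1_set -> h \in l1_set ->
  convolution (fun x => c * g x + g' x) h =
  fun x => c * convolution g h x + convolution g' h x.
Proof.
move=> gl g'l hl; apply/funext => z; rewrite /convolution.
have s1 := convolution_summable z gl hl.
have s2 := convolution_summable z g'l hl.
rewrite -complex_sumZ // -complex_sumD //; last exact: csummableZ.
by congr complex_sum; apply/funext => y; ring.
Qed.

Lemma convolution_linearr (c : C) g h h' :
  g \in l1_set -> h \in l1_set -> h' \in l1_set ->
  convolution g (fun x => c * h x + h' x) =
  fun x => c * convolution g h x + convolution g h' x.
Proof.
move=> gl hl h'l; apply/funext => z; rewrite /convolution.
have s1 := convolution_summable z gl hl.
have s2 := convolution_summable z gl h'l.
rewrite -complex_sumZ // -complex_sumD //; last exact: csummableZ.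
by congr complex_sum; apply/funext => y; ring.
Qed.

Definition dirac_fun x : G -> C := fun y => (y == x)%:R.

Lemma dirac_fun_sum x X (F : G -> R) : (forall x, 0 <= F x) ->
  \sum_(y <- X) normc (dirac_fun x y) * F y <= F x.
Proof.
move=> F0; have dE y : y != x -> normc (dirac_fun x y) * F y = 0.
  by rewrite /dirac_fun => /negPf->; rewrite normc0 mul0r.
have [xX|xX] := boolP (x \in X).
  rewrite (big_fsetD1 x) //= big_seq big1 ?addr0.
    by rewrite /dirac_fun eqxx normc1 mul1r.
  by move=> y; rewrite !inE => /andP[/dE].
rewrite big_seq big1 ?F0 // => y yX; apply: dE.
by apply: contraNneq xX => <-.
Qed.

Lemma dirac_fun_l1 x : dirac_fun x \in l1_set.
Proof.
apply: (@l1_setP _ (w x)) => X; apply: dirac_fun_sum => y.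
by rewrite ltW ?weight_gt0.
Qed.

Lemma convolution_dirac x y :
  convolution (dirac_fun x) (dirac_fun y) = dirac_fun (x * y)%g.
Proof.
apply/funext => z; rewrite /convolution (complex_sum_single (a := x)).
  rewrite /dirac_fun eqxx mul1r; congr (_%:R); congr nat_of_bool.
  by apply/eqP/eqP => [<-|->]; rewrite ?mulKVg ?mulKg.
by move=> u /negPf u_x; rewrite /dirac_fun u_x mul0r.
Qed.

End WeightedNorm.

Record weighted_l1 (R : realType) (G : groupType) (w : weight R G) :=
  WeightedL1 { l1_fun :> G -> R[i]; l1P : l1_fun \in l1_set w }.

Section WeightedAlgebra.
Variables (R : realType) (G : groupType) (w : weight R G).
Local Notation C := R[i].
Local Notation A := (weighted_l1 w).

HB.instance Definition _ := [isSub for @l1_fun R G w].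
HB.instance Definition _ := [Choice of A by <:].
HB.instance Definition _ :=
  GRing.isSubmodClosed.Build C (G -> C) (l1_set w) (l1_set_submod w).
HB.instance Definition _ := [SubChoice_isSubLmodule of A by <:].

Implicit Types (a b c : A) (k : C) (x y : G).

Lemma l1_eqP a b : (forall x, a x = b x) -> a = b.
Proof. by move=> ab; apply: val_inj; apply/funext. Qed.

Lemma l1_addE a b x : (a + b) x = a x + b x. Proof. by []. Qed.
Lemma l1_oppE a x : (- a) x = - a x. Proof. by []. Qed.
Lemma l1_scaleE k a x : (k *: a) x = k * a x. Proof. by []. Qed.

Lemma l1_sumE (J : Type) (r : seq J) (P : pred J) (F : J -> A) x :
  (\sum_(j <- r | P j) F j) x = \sum_(j <- r | P j) F j x.
Proof. by apply: (big_morph (fun a : A => a x)) => [a b|]. Qed.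

Definition l1N a : R := l1_real_norm w a.

Lemma l1N_ge0 a : 0 <= l1N a.
Proof. exact: l1_real_norm_ge0. Qed.

Lemma l1N_sum_le a (X : {fset G}) : \sum_(x <- X) normc (a x) * w x <= l1N a.
Proof. exact: l1_sum_le (l1P a). Qed.

Lemma l1N_le a (B : R) :
  (forall X : {fset G}, \sum_(x <- X) normc (a x) * w x <= B) -> l1N a <= B.
Proof. exact: l1_real_norm_le. Qed.

Lemma l1N_eq0 a : l1N a <= 0 -> a = 0.
Proof. by move=> a0; apply: l1_eqP => x; exact: l1_real_norm_eq0 (l1P a) a0. Qed.

Lemma l1N0 : l1N 0 = 0.
Proof.
apply/eqP; rewrite eq_le l1N_ge0 andbT; apply: l1N_le => X.
by rewrite big1 // => x _; rewrite normc0 mul0r.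
Qed.

Lemma l1ND a b : l1N (a + b) <= l1N a + l1N b.
Proof.
apply: l1N_le => X; apply: le_trans (lerD (l1N_sum_le a X) (l1N_sum_le b X)).
rewrite -big_split; apply: ler_sum => x _ /=.
by rewrite -mulrDl ler_wpM2r ?(ltW (weight_gt0 _ _)) // normcD.
Qed.

Lemma l1NZ_le k a : l1N (k *: a) <= normc k * l1N a.
Proof.
apply: l1N_le => X.
apply: le_trans (ler_wpM2l (normc_ge0 k) (l1N_sum_le a X)).
by rewrite mulr_sumr; apply: ler_sum => x _; rewrite mulrA -normcM.
Qed.

Lemma l1NZ k a : l1N (k *: a) = normc k * l1N a.
Proof.
apply/eqP; rewrite eq_le l1NZ_le /=; have [->|k0] := eqVneq k 0.
  by rewrite normc0 mul0r l1N_ge0.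
have := l1NZ_le k^-1 (k *: a); rewrite scalerA mulVf // scale1r normcV.
by rewrite ler_pdivlMl // lt_def normc_ge0 normc_eq0 k0.
Qed.

Lemma l1N_opp a : l1N (- a) = l1N a.
Proof. by rewrite -scaleN1r l1NZ normc_opp normc1 mul1r. Qed.

Lemma l1NB a b : l1N (a - b) <= l1N a + l1N b.
Proof. by rewrite -(l1N_opp b); exact: l1ND. Qed.

Lemma l1N_sum (J : Type) (r : seq J) (P : pred J) (F : J -> A) :
  l1N (\sum_(j <- r | P j) F j) <= \sum_(j <- r | P j) l1N (F j).
Proof.
elim/big_rec2 : _ => [|j y x _ le_xy]; first by rewrite l1N0.
by rewrite (le_trans (l1ND _ _)) // lerD2l.
Qed.

Lemma l1N_eq0_eps a (k : R) : (forall e : R, 0 < e -> l1N a <= k * e) -> a = 0.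
Proof.
move=> a_le; apply: l1N_eq0; apply/ler_addgt0Pl => e e0; rewrite addr0.
have k1 : 0 < 1 + `|k| by rewrite ltr_pwDl.
apply: le_trans (a_le (e / (1 + `|k|)) _) _; first by rewrite divr_gt0.
rewrite mulrA ler_pdivrMr // mulrC ler_pM2l //.
by have := ler_norm k; lra.
Qed.

Definition l1_dirac x : A := WeightedL1 (dirac_fun_l1 w x).

Lemma l1_truncationE a (X : {fset G}) x :
  (\sum_(y <- X) a y *: l1_dirac y) x = if x \in X then a x else 0.
Proof.
rewrite l1_sumE; case: ifP => xX.
  rewrite (big_fsetD1 x xX) big_seq big1 => [|y].
    by rewrite [LHS]addr0 l1_scaleE /= /dirac_fun eqxx mulr1.
  rewrite !inE => /andP[y_x _].
  by rewrite l1_scaleE /= /dirac_fun eq_sym (negPf y_x) mulr0.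
rewrite big_seq big1 // => y yX.
rewrite l1_scaleE /= /dirac_fun (_ : _ == _ = false) ?mulr0 //.
by apply: contraFF xX => /eqP->.
Qed.

Lemma l1_truncation_approx a (e : R) : 0 < e -> exists X : {fset G},
  forall Y : {fset G}, (X `<=` Y)%fset ->
    l1N (a - \sum_(y <- Y) a y *: l1_dirac y) <= e.
Proof.
move=> e0.
have term_ge0 x : 0 <= normc (a x) * w x.
  by rewrite mulr_ge0 ?normc_ge0 ?(ltW (weight_gt0 _ _)).
have /asboolP a_fin := l1P a.
have [X XP] := esum_finite_approx term_ge0 a_fin e0.
exists X => Y XY; apply: l1N_le => Z.
have := l1N_sum_le a (Z `|` Y)%fset.
rewrite (big_fsetID _ (mem Y)) /=.
have -> : [fset x | x in (Z `|` Y)%fset & x \in Y]%fset = Y.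
  by apply/fsetP => x; rewrite !inE /=; case: (x \in Z); case: (x \in Y).
have -> : [fset x | x in (Z `|` Y)%fset & x \notin Y]%fset = (Z `\` Y)%fset.
  by apply/fsetP => x; rewrite !inE /=; case: (x \in Z); case: (x \in Y).
have := ler_sum_fsubset term_ge0 XY.
have -> : \sum_(x <- Z) normc ((a - \sum_(y <- Y) a y *: l1_dirac y) x) * w x =
    \sum_(x <- (Z `\` Y)%fset) normc (a x) * w x.
  have E x : (a - \sum_(y <- Y) a y *: l1_dirac y) x =
      if x \in Y then 0 else a x.
    rewrite l1_addE l1_oppE l1_truncationE.
    by case: ifP => _; rewrite ?subrr ?subr0.
  under eq_bigr do rewrite E.
  rewrite (big_fsetID _ (mem Y)) /= big_seq big1 ?add0r => [|x].
    rewrite (_ : [fset x | x in Z & x \notin Y]%fset = (Z `\` Y)%fset).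
      by apply: eq_big_seq => x; rewrite !inE => /andP[/negPf-> _].
    by apply/fsetP => x; rewrite !inE /= andbC.
  by rewrite !inE /= => /andP[_ ->]; rewrite normc0 mul0r.
by move: XP; rewrite -/(l1_real_norm w a) -/(l1N a); lra.
Qed.

(* A bounded linear map that kills the point masses vanishes: it kills all
   finitely supported functions, and these are dense. *)
Lemma l1_linear_eq0 (L : A -> A) (k : R) :
  (forall z a b, L (z *: a + b) = z *: L a + L b) ->
  (forall a, l1N (L a) <= k * l1N a) ->
  (forall x, L (l1_dirac x) = 0) -> forall a, L a = 0.
Proof.
move=> Llin Lk Ld a.
have L0 : L 0 = 0.
  by have := Llin (-1) 0 0; rewrite scaler0 addr0 scaleN1r addNr.
have Lsum (s : seq G) : L (\sum_(y <- s) a y *: l1_dirac y) = 0.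
  elim: s => [|x s IHs]; first by rewrite big_nil L0.
  by rewrite big_cons Llin IHs Ld scaler0 addr0.
have LB b c : L (b - c) = L b - L c.
  by rewrite addrC -[- c]scaleN1r Llin scaleN1r addrC.
apply: (@l1N_eq0_eps _ `|k|) => e e0.
have [X XP] := l1_truncation_approx a e0.
have := Lk (a - \sum_(y <- X) a y *: l1_dirac y).
rewrite LB Lsum subr0 => /le_trans; apply.
apply: (@le_trans _ _ (`|k| * l1N (a - \sum_(y <- X) a y *: l1_dirac y))).
  by rewrite ler_wpM2r ?l1N_ge0 ?ler_norm.
by rewrite ler_wpM2l ?XP.
Qed.

Definition l1_mul a b : A := WeightedL1 (convolution_l1 (l1P a) (l1P b)).

Lemma l1N_mul_le a b : l1N (l1_mul a b) <= l1N a * l1N b.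
Proof. exact: convolution_norm_le (l1P a) (l1P b). Qed.

Lemma l1_mul_linearl k a b c :
  l1_mul (k *: a + b) c = k *: l1_mul a c + l1_mul b c.
Proof. by apply: val_inj; exact: convolution_linearl (l1P a) (l1P b) (l1P c). Qed.

Lemma l1_mul_linearr k a b c :
  l1_mul c (k *: a + b) = k *: l1_mul c a + l1_mul c b.
Proof. by apply: val_inj; exact: convolution_linearr (l1P c) (l1P a) (l1P b). Qed.

Lemma l1_mul_dirac x y :
  l1_mul (l1_dirac x) (l1_dirac y) = l1_dirac (x * y)%g.
Proof. by apply: val_inj; exact: convolution_dirac. Qed.

(** The associator is linear and bounded in each argument and vanishes on point masses.
    [l1_linear_eq0] frees one argument at a time from being a point mass, so that no triple sum is
    rearranged. *)
Lemma l1_mulA : associative l1_mul.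
Proof.
pose T a b c := l1_mul a (l1_mul b c) - l1_mul (l1_mul a b) c.
have T_le a b c : l1N (T a b c) <= 2 * (l1N a * l1N b * l1N c).
  apply: le_trans (l1NB _ _) _.
  have := l1N_mul_le a (l1_mul b c); have := l1N_mul_le (l1_mul a b) c.
  have := ler_wpM2l (l1N_ge0 a) (l1N_mul_le b c).
  have := ler_wpM2r (l1N_ge0 c) (l1N_mul_le a b); lra.
suff T0 a b c : T a b c = 0 by move=> a b c; apply/subr0_eq/T0.
have arrange k (u u' v v' : A) :
    k *: u + u' - (k *: v + v') = k *: (u - v) + (u' - v').
  by rewrite scalerBr opprD addrACA.
apply: (l1_linear_eq0 (L := T a b) (k := 2 * (l1N a * l1N b))) => {c}.
- by move=> k c c'; rewrite /T !l1_mul_linearr arrange.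
- by move=> c; rewrite -mulrA; exact: T_le.
move=> z.
apply: (l1_linear_eq0 (L := fun b => T a b (l1_dirac z))
  (k := 2 * (l1N a * l1N (l1_dirac z)))) => {b}.
- by move=> k b b'; rewrite /T !(l1_mul_linearr, l1_mul_linearl) arrange.
- by move=> b; rewrite -mulrA [_ * l1N b]mulrAC; exact: T_le.
move=> y.
apply: (l1_linear_eq0 (L := fun a => T a (l1_dirac y) (l1_dirac z))
  (k := 2 * (l1N (l1_dirac y) * l1N (l1_dirac z)))) => {a}.
- by move=> k a a'; rewrite /T !(l1_mul_linearr, l1_mul_linearl) arrange.
- by move=> a; rewrite -mulrA mulrC [_ * _ * l1N a]mulrC mulrA;
  have := T_le a (l1_dirac y) (l1_dirac z); rewrite [2 * _]mulrC.
by move=> x; rewrite /T !l1_mul_dirac mulgA subrr.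
Qed.

Lemma l1_mul1l : left_id (l1_dirac 1%g) l1_mul.
Proof.
move=> a; apply/subr0_eq.
apply: (l1_linear_eq0 (L := fun a => l1_mul (l1_dirac 1%g) a - a)
  (k := l1N (l1_dirac 1%g) + 1)) => [k b c|b|x].
- by rewrite l1_mul_linearr scalerBr opprD addrACA.
- by rewrite mulrDl mul1r; apply: le_trans (l1NB _ _) _; rewrite lerD2r l1N_mul_le.
- by rewrite l1_mul_dirac mul1g subrr.
Qed.

Lemma l1_mul1r : right_id (l1_dirac 1%g) l1_mul.
Proof.
move=> a; apply/subr0_eq.
apply: (l1_linear_eq0 (L := fun a => l1_mul a (l1_dirac 1%g) - a)
  (k := l1N (l1_dirac 1%g) + 1)) => [k b c|b|x].
- by rewrite l1_mul_linearl scalerBr opprD addrACA.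
- rewrite mulrDl mul1r mulrC; apply: le_trans (l1NB _ _) _.
  by rewrite lerD2r l1N_mul_le.
- by rewrite l1_mul_dirac mulg1 subrr.
Qed.

Lemma l1_mulDl : left_distributive l1_mul +%R.
Proof. by move=> a b c; have := l1_mul_linearl 1 a b c; rewrite !scale1r. Qed.

Lemma l1_mulDr : right_distributive l1_mul +%R.
Proof. by move=> a b c; have := l1_mul_linearr 1 b c a; rewrite !scale1r. Qed.

Lemma l1_dirac1_neq0 : l1_dirac 1%g != 0.
Proof.
apply/eqP => /(congr1 (fun a : A => a 1%g)) /=.
by rewrite /dirac_fun eqxx => /eqP; rewrite oner_eq0.
Qed.

HB.instance Definition _ := GRing.Zmodule_isNzRing.Build A
  l1_mulA l1_mul1l l1_mul1r l1_mulDl l1_mulDr l1_dirac1_neq0.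

Lemma l1_scaleAl k a b : k *: (a * b) = (k *: a) * b.
Proof.
have := l1_mul_linearl k a 0 b; rewrite addr0 => e.
by rewrite [RHS]e -[l1_mul 0 b]/(0 * b) mul0r addr0.
Qed.

HB.instance Definition _ := GRing.Lmodule_isLalgebra.Build C A l1_scaleAl.

Lemma l1_scaleAr k a b : k *: (a * b) = a * (k *: b).
Proof.
have := l1_mul_linearr k b 0 a; rewrite addr0 => e.
by rewrite [RHS]e -[l1_mul a 0]/(a * 0) mulr0 addr0.
Qed.

HB.instance Definition _ := GRing.Lalgebra_isAlgebra.Build C A l1_scaleAr.

Lemma l1NM a b : l1N (a * b) <= l1N a * l1N b.
Proof. exact: l1N_mul_le. Qed.

Lemma l1_diracM x y : l1_dirac x * l1_dirac y = l1_dirac (x * y)%g.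
Proof. exact: l1_mul_dirac. Qed.

End WeightedAlgebra.

(** * Completeness and the injective tensor norm *)

Lemma real_cauchy_limit (R : realType) (v : nat -> R) :
  (forall e : R, 0 < e -> exists K, forall m n, (K <= m)%N -> (K <= n)%N ->
     `|v m - v n| <= e) ->
  exists l, forall e : R, 0 < e -> exists K, forall n, (K <= n)%N ->
    `|l - v n| <= e.
Proof.
move=> v_cauchy.
have /cvg_ex[l vl] : cvgn v.
  apply/cauchy_cvgP/cauchy_exP => e e0.
  have [K KP] := v_cauchy (e / 2) (divr_gt0 e0 (ltr0n _ 2)).
  exists (v K); exists K => // n /= Kn; rewrite /ball /=.
  by apply: le_lt_trans (KP _ _ (leqnn K) Kn) _; lra.
exists l => e e0.
have /cvgrPdist_le/(_ e e0)[K _ KP] := vl.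
by exists K => n Kn; exact: KP.
Qed.

Lemma complex_cauchy_limit (R : realType) (v : nat -> R[i]) :
  (forall e : R, 0 < e -> exists K, forall m n, (K <= m)%N -> (K <= n)%N ->
     normc (v m - v n) <= e) ->
  exists l, forall e : R, 0 < e -> exists K, forall n, (K <= n)%N ->
    normc (l - v n) <= e.
Proof.
move=> v_cauchy.
have ReB (z z' : R[i]) : complex.Re (z - z') = complex.Re z - complex.Re z'.
  by case: z; case: z'.
have ImB (z z' : R[i]) : complex.Im (z - z') = complex.Im z - complex.Im z'.
  by case: z; case: z'.
have [|a aP] := @real_cauchy_limit R (fun n => complex.Re (v n)).
  move=> e /v_cauchy[K KP]; exists K => m n Km Kn.
  by rewrite -ReB (le_trans (normc_Re _)) // KP.
have [|b bP] := @real_cauchy_limit R (fun n => complex.Im (v n)).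
  move=> e /v_cauchy[K KP]; exists K => m n Km Kn.
  by rewrite -ImB (le_trans (normc_Im _)) // KP.
exists (Complex a b) => e e0; have e2 : 0 < e / 2 by rewrite divr_gt0.
have [K1 K1P] := aP _ e2; have [K2 K2P] := bP _ e2.
exists (maxn K1 K2) => n; rewrite geq_max => /andP[/K1P le1 /K2P le2].
apply: le_trans (normc_le_ReIm _) _; rewrite ReB ImB /=; lra.
Qed.

Section Completeness.
Variables (R : realType) (G : groupType) (w : weight R G).
Local Notation C := R[i].
Local Notation A := (weighted_l1 w).
Implicit Types (a b : A) (X Y Z : {fset G}).

Lemma l1_complete (u : nat -> A) :
  (forall e : R, 0 < e -> exists K, forall m n, (K <= m)%N -> (K <= n)%N ->
     l1N (u m - u n) <= e) ->
  exists a, forall e : R, 0 < e -> exists K, forall n, (K <= n)%N ->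
    l1N (a - u n) <= e.
Proof.
move=> u_cauchy.
have /choice[f fP] : forall x, exists l, forall e : R, 0 < e -> exists K,
    forall n, (K <= n)%N -> normc (l - u n x) <= e.
  move=> x; apply: complex_cauchy_limit => e e0.
  have [K KP] := u_cauchy _ (mulr_gt0 e0 (weight_gt0 w x)).
  exists K => m n Km Kn; have := KP m n Km Kn.
  have := l1_point_le x (l1P (u m - u n)); rewrite -/(l1N _) => le1 le2.
  by rewrite -(ler_pM2r (weight_gt0 w x)) (le_trans le1).
have f_near X (e : R) : 0 < e -> exists K, forall n, (K <= n)%N ->
    \sum_(x <- X) normc (f x - u n x) * w x <= e.
  elim: (enum_fset X) e => [|x s IHs] e e0.
    by exists 0%N => n _; rewrite big_nil ltW.
  have e2 : 0 < e / 2 by rewrite divr_gt0.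
  have [K1 K1P] := IHs _ e2.
  have [K2 K2P] := fP x _ (divr_gt0 e2 (weight_gt0 w x)).
  exists (maxn K1 K2) => n; rewrite geq_max big_cons => /andP[/K1P le1 /K2P].
  by rewrite ler_pdivlMr ?weight_gt0 //; lra.
(* The threshold must not depend on [X]. An auxiliary index m, chosen after [X], brings u m close to
   the pointwise limit on [X]; the Cauchy bound then handles u m - u n. *)
have f_dist (e : R) : 0 < e -> exists K, forall n, (K <= n)%N -> forall X,
    \sum_(x <- X) normc (f x - u n x) * w x <= e.
  move=> e0; have e2 : 0 < e / 2 by rewrite divr_gt0.
  have [K KP] := u_cauchy _ e2; exists K => n Kn X.
  have [K' K'P] := f_near X _ e2.
  have := K'P _ (leq_maxr K K'); set m := maxn K K' => le1.
  have := l1N_sum_le (u m - u n) X.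
  move/le_trans/(_ (KP _ _ (leq_maxl K K') Kn)) => le2.
  apply: (@le_trans _ _ (\sum_(x <- X) normc (f x - u m x) * w x +
    \sum_(x <- X) normc ((u m - u n) x) * w x)); last by lra.
  rewrite -big_split; apply: ler_sum => x _ /=.
  rewrite -mulrDl ler_wpM2r ?(ltW (weight_gt0 _ _)) //.
  rewrite (_ : f x - u n x = (f x - u m x) + (u m - u n) x) ?normcD //.
  by rewrite l1_addE l1_oppE; ring.
have f_l1 : f \in l1_set w.
  have [K KP] := f_dist 1 ltr01.
  apply: (@l1_setP _ _ _ _ (1 + l1N (u K))) => X.
  apply: le_trans (lerD (KP _ (leqnn K) X) (l1N_sum_le (u K) X)).
  rewrite -big_split; apply: ler_sum => x _ /=.
  rewrite -mulrDl ler_wpM2r ?(ltW (weight_gt0 _ _)) //.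
  by rewrite -{1}(subrK (u K x) (f x)) normcD.
exists (WeightedL1 f_l1) => e /f_dist[K KP]; exists K => n Kn.
by apply: l1N_le => X; exact: KP.
Qed.

(** For |s| <= 1 this is a finitely supported functional in the unit ball of the dual space; such
    functionals determine the norm, by [l1N_dual_le]. *)
Definition pairing X (s : G -> C) a : C :=
  \sum_(x <- X) a x * (w x)%:C%C * s x.

Lemma pairing_le X s a (d : R) : 0 <= d -> (forall x, normc (s x) <= d) ->
  normc (pairing X s a) <= d * l1N a.
Proof.
move=> d0 s_le; apply: le_trans (normc_sum _ _ _) _.
apply: le_trans (ler_wpM2l d0 (l1N_sum_le a X)); rewrite mulr_sumr.
apply: ler_sum => x _.
rewrite !normcM normc_real ger0_norm ?(ltW (weight_gt0 _ _)) // mulrC.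
by rewrite ler_wpM2r ?mulr_ge0 ?normc_ge0 ?(ltW (weight_gt0 _ _)).
Qed.

Lemma pairing_sum X s (J : Type) (r : seq J) (P : pred J) (k : J -> C)
    (a : J -> A) :
  pairing X s (\sum_(j <- r | P j) k j *: a j) =
  \sum_(j <- r | P j) k j * pairing X s (a j).
Proof.
rewrite /pairing; under [RHS]eq_bigr do rewrite mulr_sumr.
rewrite exchange_big; apply: eq_bigr => x _.
by rewrite l1_sumE !mulr_suml; apply: eq_bigr => j _; rewrite l1_scaleE !mulrA.
Qed.

Lemma sum_norm_pairing a X : \sum_(x <- X) normc (a x) * w x =
  normc (pairing X (fun x => phase (a x)) a).
Proof.
rewrite /pairing (eq_bigr (fun x => (normc (a x) * w x)%:C%C)) => [|x _].
  rewrite -sum_complexR normc_real ger0_norm // sumr_ge0 // => x _.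
  by rewrite mulr_ge0 ?normc_ge0 ?(ltW (weight_gt0 _ _)).
by rewrite mulrAC [a x * _]mulrC phaseM rmorphM.
Qed.

Lemma l1N_dual_le a (B : R) :
  (forall X s, (forall x, normc (s x) <= 1) -> normc (pairing X s a) <= B) ->
  l1N a <= B.
Proof.
move=> aB; apply: l1N_le => X; rewrite sum_norm_pairing; apply: aB => x.
by rewrite normc_phase.
Qed.

Definition weight_ratio (x y : G) : R := w (x * y)%g / (w x * w y).

Definition finite_bilinear_bound X (T : G -> G -> C) (k : R) :=
  forall s t : G -> C, (forall x, normc (s x) <= 1) ->
    (forall y, normc (t y) <= 1) ->
    normc (\sum_(x <- X) \sum_(y <- X) T x y * s x * t y) <= k.

(** A Schur multiplier estimate. The factor [phi (x * y)] is a norming functional of a product,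
    pulled back along the multiplication; D must therefore be uniform in [phi]. *)
Definition ratio_multiplier_bound (D : R) :=
  forall X T (k : R) (phi : G -> C), 0 <= k -> finite_bilinear_bound X T k ->
    (forall x, normc (phi x) = 1) ->
    normc (\sum_(x <- X) \sum_(y <- X)
      T x y * ((weight_ratio x y)%:C%C * phi (x * y)%g)) <= D * k.

Definition truncation X a : A := \sum_(x <- X) a x *: l1_dirac w x.

Lemma truncationM_approx (J : Type) (r : seq J) (g h : J -> A) (e : R) :
  0 < e -> exists X, l1N (\sum_(j <- r) g j * h j -
    \sum_(j <- r) truncation X (g j) * truncation X (h j)) <= e.
Proof.
(* Asking for all larger [Y] lets the induction on the list take unions of finite sets. *)
suff : forall e : R, 0 < e -> exists X, forall Y, (X `<=` Y)%fset ->
    l1N (\sum_(j <- r) g j * h j -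
      \sum_(j <- r) truncation Y (g j) * truncation Y (h j)) <= e.
  by move=> suff_e /suff_e[X XP]; exists X; exact: XP.
elim: r => [|j r IHr] {}e e0.
  by exists fset0 => Y _; rewrite !big_nil subr0 l1N0 ltW.
have e2 : 0 < e / 2 by rewrite divr_gt0.
have [X1 X1P] := IHr _ e2.
pose q : R := 2 + l1N (g j) + l1N (h j).
have q_gt0 : 0 < q by rewrite !ltr_pwDl ?l1N_ge0 // addr_gt0.
pose e3 : R := Num.min 1 (e / 2 / q).
have e3_gt0 : 0 < e3 by rewrite lt_min ltr01 divr_gt0.
have e3q : e3 * q <= e / 2 by rewrite -ler_pdivlMr // ge_min lexx orbT.
have e3_1 : e3 <= 1 by rewrite ge_min lexx.
have [X2 X2P] := l1_truncation_approx (g j) e3_gt0.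
have [X3 X3P] := l1_truncation_approx (h j) e3_gt0.
exists (X1 `|` X2 `|` X3)%fset => Y /fsubUsetP[/fsubUsetP[/X1P le1 /X2P le2] /X3P le3].
rewrite !big_cons opprD addrACA; apply: le_trans (l1ND _ _) _.
suff : l1N (g j * h j - truncation Y (g j) * truncation Y (h j)) <= e / 2 by lra.
apply: le_trans e3q; rewrite -/(truncation Y _) in le2 le3.
rewrite (_ : _ - _ = (g j - truncation Y (g j)) * h j +
  (g j - (g j - truncation Y (g j))) * (h j - truncation Y (h j))); last first.
  by rewrite subKr mulrBl mulrBr addrA subrK.
apply: le_trans (l1ND _ _) _; move: le2 le3.
set u := g j - _; set v := h j - _ => le2 le3.
have le_uh : l1N (u * h j) <= e3 * l1N (h j).
  by apply: le_trans (l1NM _ _) _; rewrite ler_wpM2r ?l1N_ge0.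
have le_gv : l1N ((g j - u) * v) <= (l1N (g j) + 1) * e3.
  apply: le_trans (l1NM _ _) _; apply: ler_pM; rewrite ?l1N_ge0 //.
  apply: le_trans (l1NB _ _) _; rewrite lerD2l; exact: le_trans le2 e3_1.
by rewrite /q; lra.
Qed.

(* The multiplication is bounded for the injective tensor norm. *)
Lemma injective_multiplication (D : R) (J : Type) (r : seq J) (g h : J -> A)
    (k : R) :
  ratio_multiplier_bound D -> 0 <= k ->
  (forall X s t, (forall x, normc (s x) <= 1) -> (forall y, normc (t y) <= 1) ->
     normc (\sum_(j <- r) pairing X s (g j) * pairing X t (h j)) <= k) ->
  l1N (\sum_(j <- r) g j * h j) <= D * k.
Proof.
move=> DP k0 gh_le; apply/ler_addgt0Pl => e e0.
have [X XP] := truncationM_approx r g h e0.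
set v := \sum_(j <- r) truncation X _ * _ in XP.
suff v_le : l1N v <= D * k.
  rewrite -(subrK v (\sum_(j <- r) g j * h j)).
  by apply: le_trans (l1ND _ _) _; exact: lerD.
pose T0 x y := \sum_(j <- r) g j x * h j y.
have vE : v = \sum_(x <- X) \sum_(y <- X) T0 x y *: l1_dirac w (x * y)%g.
  rewrite /v /T0; under [RHS]eq_bigr => x _ do
    under eq_bigr => y _ do rewrite scaler_suml.
  under [RHS]eq_bigr => x _ do rewrite exchange_big.
  rewrite exchange_big; apply: eq_bigr => j _ /=.
  rewrite /truncation mulr_suml; apply: eq_bigr => x _.
  rewrite mulr_sumr; apply: eq_bigr => y _.
  by rewrite -scalerAl -scalerAr scalerA l1_diracM.
apply: l1N_le => Z.
(* The support of [v] lies in [XX]; once [Z] contains it, the norm of [v] unfolds into a full double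
   sum over [X]. *)
pose XX := [fset (x * y)%g | x in X, y in X]%fset.
have term_ge0 x : 0 <= normc (v x) * w x.
  by rewrite mulr_ge0 ?normc_ge0 ?(ltW (weight_gt0 _ _)).
apply: le_trans (ler_sum_fsubset term_ge0 (fsubsetUl Z XX)) _.
rewrite sum_norm_pairing; set phi := fun x => phase (v x).
(* Writing w (x y) as the ratio times w x * w y moves the weights into the form and leaves the
   multiplier. The weighted form is bounded by [k] because its values are the sums of products of
   pairings in the hypothesis. *)
have -> : pairing (Z `|` XX)%fset phi v = \sum_(x <- X) \sum_(y <- X)
    (T0 x y * (w x)%:C%C * (w y)%:C%C) *
    ((weight_ratio x y)%:C%C * phi (x * y)%g).
  rewrite {1}vE /pairing.
  under eq_bigr => z _ do rewrite l1_sumE !mulr_suml.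
  rewrite exchange_big; apply: eq_big_seq => x xX.
  under eq_bigr => z _ do rewrite l1_sumE !mulr_suml.
  rewrite exchange_big; apply: eq_big_seq => y yX.
  have xyZ : (x * y)%g \in (Z `|` XX)%fset.
    by rewrite inE; apply/orP; right; apply/imfset2P; exists x => //; exists y.
  rewrite (big_fsetD1 _ xyZ) big_seq big1 => [|z]; last first.
    rewrite !inE => /andP[/negPf z_xy _].
    by rewrite l1_scaleE /= /dirac_fun z_xy mulr0 !mul0r.
  rewrite [LHS]addr0 l1_scaleE /= /dirac_fun eqxx mulr1 [RHS]mulrA; congr (_ * _).
  rewrite -!mulrA -!rmorphM; congr (_ * _%:C%C).
  by rewrite /weight_ratio; field; rewrite !gt_eqF ?weight_gt0.
apply: DP => // [s t s1 t1|x]; last exact: normc_phase.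
apply: le_trans (gh_le X s t s1 t1); rewrite le_eqVlt; apply/orP; left.
apply/eqP; congr normc.
under [RHS]eq_bigr => j _ do rewrite /pairing mulr_suml.
rewrite [RHS]exchange_big; apply: eq_bigr => x _ /=.
under [RHS]eq_bigr => j _ do rewrite mulr_sumr.
rewrite [RHS]exchange_big; apply: eq_bigr => y _ /=.
rewrite /T0 !mulr_suml; apply: eq_bigr => j _; ring.
Qed.

End Completeness.

(** * Polynomials of commuting elements *)

Section MultilinearBound.
Variables (R : realType) (G : groupType) (w : weight R G).
Local Notation C := R[i].
Local Notation A := (weighted_l1 w).

(** Induction on the number of factors. Splitting off the last factor costs one D by
    [injective_multiplication]; paired with a functional, that factor becomes a scalar, which is
    absorbed by the coefficient and takes the place of the last variable in the hypothesis. Hence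
    every slot [l] needs its own function [z l]. *)
Lemma multilinear_bound (D : R) (I : Type) (a : I -> A) (d : R) (n : nat)
    (J : Type) (r : seq J) (c : J -> C) (m : J -> nat -> I) (k : R) :
  ratio_multiplier_bound w D -> 0 <= D -> (forall i, l1N (a i) <= d) -> 0 <= k ->
  (forall z : nat -> I -> C, (forall l i, normc (z l i) <= d) ->
     normc (\sum_(j <- r) c j * \prod_(l < n.+1) z l (m j l)) <= k) ->
  l1N (\sum_(j <- r) c j *: \prod_(l < n.+1) a (m j l)) <= D ^+ n * k.
Proof.
move=> DP D0 ad k0.
have pair_le X s i : (forall x, normc (s x) <= 1) ->
    normc (pairing X s (a i)) <= d.
  by move=> s1; apply: le_trans (pairing_le _ _ ler01 s1) _; rewrite mul1r.
elim: n c => [|n IHn] c c_le.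
  rewrite expr0 mul1r; apply: l1N_dual_le => X s s1.
  rewrite pairing_sum; have := c_le (fun _ i => pairing X s (a i)).
  under eq_bigr do rewrite big_ord1; under [in X in _ -> X]eq_bigr do rewrite big_ord1.
  by apply => _ i; exact: pair_le.
rewrite exprS -mulrA.
under eq_bigr do rewrite big_ord_recr /= scalerAl.
apply: (injective_multiplication DP) => [|X s t s1 t1].
  by rewrite mulr_ge0 ?exprn_ge0.
rewrite (_ : \sum_(j <- r) _ = pairing X s (\sum_(j <- r)
    (c j * pairing X t (a (m j n.+1))) *: \prod_(l < n.+1) a (m j l))).
    apply: le_trans (pairing_le _ _ ler01 s1) _; rewrite mul1r; apply: IHn => z zd.
  pose z' l := if l == n.+1 then fun i => pairing X t (a i) else z l.
  have := c_le z'; rewrite (eq_bigr (fun j => c j * pairing X t (a (m j n.+1)) *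
      \prod_(l < n.+1) z l (m j l))) => [|j _].
    by apply => l i; rewrite /z'; case: ifP => _; [exact: pair_le | exact: zd].
  rewrite big_ord_recr /= {2}/z' eqxx -mulrA; congr (_ * _).
  rewrite mulrC; congr (_ * _); apply: eq_bigr => l _.
  by rewrite /z' ltn_eqF.
rewrite pairing_sum; apply: eq_bigr => j _.
have := pairing_sum X s [:: tt] xpredT (fun=> c j)
  (fun=> \prod_(l < n.+1) a (m j l)).
by rewrite !big_seq1 => ->; rewrite mulrAC.
Qed.

End MultilinearBound.

(** * Averaging over roots of unity and polarization *)

Section RootsOfUnity.
Variables (R : realType) (N : nat) (xi : R[i]).
Hypothesis xi_prim : N.-primitive_root xi.

Lemma normc_prim_root : normc xi = 1.
Proof.
have N_gt0 := prim_order_gt0 xi_prim.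
have := congr1 (@normc R) (prim_expr_order xi_prim).
by rewrite normcX normc1 => /eqP; rewrite pexpr_eq1 ?normc_ge0 // => /eqP.
Qed.

Lemma sum_prim_root_exp m :
  \sum_(t < N) (xi ^+ t) ^+ m = if (N %| m)%N then N%:R else 0.
Proof.
case: ifP => Nm.
  rewrite (eq_bigr (fun=> 1)) => [|t _].
    by rewrite sumr_const card_ord.
  rewrite -exprM mulnC exprM; have -> : xi ^+ m = 1.
    by apply/eqP; rewrite -(prim_order_dvd xi_prim).
  by rewrite expr1n.
have xm1 : xi ^+ m != 1 by rewrite -(prim_order_dvd xi_prim) Nm.
apply: (mulfI (_ : xi ^+ m - 1 != 0)); first by rewrite subr_eq0.
rewrite mulr0; under eq_bigr do rewrite -exprM mulnC exprM.
by rewrite -subrX1 -exprM mulnC exprM (prim_expr_order xi_prim) expr1n subrr.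
Qed.

End RootsOfUnity.

Section Polarization.
Variables (R : realType) (I : eqType) (i0 : I).
Local Notation C := R[i].

Lemma sum_perm_finfun k (F : ('I_k -> 'I_k) -> C) :
  \sum_(f : {ffun 'I_k -> 'I_k} | injectiveb f) F f = \sum_(s : 'S_k) F s.
Proof.
rewrite (reindex (fun s : 'S_k => val s)) /=; last first.
  exists (insubd (1%g : 'S_k)) => [s _|f]; first exact: valKd.
  by rewrite inE => f_inj; rewrite /= insubdK.
apply: eq_big => [s|s _]; first by rewrite (valP s).
by rewrite pvalE.
Qed.

(* Averaging against the characters of (Z/N)^k extracts from a monomial its part
   that is linear in each of the [k] variables. *)
Lemma character_average (k N : nat) (xi : C) (s : seq I)
    (z : nat -> I -> C) : N.-primitive_root xi -> (1 < N)%N ->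
  (size s < N)%N ->
  \sum_(e : {ffun 'I_k -> 'I_N}) (\prod_(l < k) (xi ^+ e l) ^+ N.-1) *
     \prod_(i <- s) (\sum_(l < k) xi ^+ e l * z l i) =
  if size s == k then
    N%:R ^+ k * \sum_(p : 'S_k) \prod_(l < k) z l (nth i0 s (p l))
  else 0.
Proof.
move=> xi_prim N_gt1 sN; set n := size s.
pose fib (f : {ffun 'I_n -> 'I_k}) l := #|[pred j | f j == l]|.
have fib_sum f : (\sum_l fib f l = n)%N.
  rewrite -[RHS]card_ord -sum1_card (partition_big f xpredT) //=.
  by apply: eq_bigr => l _; rewrite sum1_card; apply: eq_card.
(* Summing over the characters keeps only exponents divisible by [N]. A slot used [fib f l] <= n < N
   times carries the exponent N - 1 + [fib f l], so it survives only if it is used exactly once. *)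
have fib_dvd f l : (N %| N.-1 + fib f l)%N = (fib f l == 1)%N.
  have fib_le : (fib f l <= n)%N.
    by apply: leq_trans (eq_leq (fib_sum f)); rewrite (bigD1 l) //= leq_addr.
  have := leq_ltn_trans fib_le sN; case: (fib f l) => [|[|m]] m_lt.
  - by rewrite addn0 gtnNdvd //; lia.
  - by rewrite addn1 prednK ?dvdnn // ltnW.
  - rewrite addnS -addSn prednK ?(ltnW N_gt1) // dvdn_addr ?dvdnn //.
    by rewrite gtnNdvd //; lia.
have expand e : \prod_(i <- s) (\sum_(l < k) xi ^+ e l * z l i) =
    \sum_(f : {ffun 'I_n -> 'I_k})
      \prod_l (xi ^+ e l) ^+ fib f l * \prod_(j < n) z (f j) (nth i0 s j).
  rewrite (big_nth i0) big_mkord bigA_distr_bigA; apply: eq_bigr => f _.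
  rewrite big_split /=; congr (_ * _).
  rewrite (partition_big f xpredT) //=; apply: eq_bigr => l _.
  rewrite (eq_bigr (fun=> xi ^+ e l)) => [|j /eqP-> //].
  by rewrite prodr_const.
under eq_bigr do rewrite expand mulr_sumr.
rewrite exchange_big /=.
have -> : \sum_(f : {ffun 'I_n -> 'I_k}) \sum_(e : {ffun 'I_k -> 'I_N})
    (\prod_(l < k) (xi ^+ e l) ^+ N.-1) *
    (\prod_l (xi ^+ e l) ^+ fib f l * \prod_(j < n) z (f j) (nth i0 s j)) =
    \sum_(f : {ffun 'I_n -> 'I_k} | [forall l, fib f l == 1%N])
      N%:R ^+ k * \prod_(j < n) z (f j) (nth i0 s j).
  rewrite [RHS]big_mkcond; apply: eq_bigr => f _.
  under eq_bigr do rewrite mulrA -big_split /=.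
  rewrite -mulr_suml.
  rewrite (eq_bigr (fun e : {ffun 'I_k -> 'I_N} =>
      \prod_l (xi ^+ e l) ^+ (N.-1 + fib f l))); last first.
    by move=> e _; apply: eq_bigr => l _; rewrite exprD.
  rewrite -(bigA_distr_bigA (fun l (t : 'I_N) => (xi ^+ t) ^+ (N.-1 + fib f l))).
  under eq_bigr do rewrite (sum_prim_root_exp xi_prim) fib_dvd.
  case: ifPn => [/forallP f1|/forallPn[l /negPf fl]].
    rewrite (eq_bigr (fun=> N%:R)) => [|l _]; last by rewrite f1.
    by rewrite prodr_const card_ord.
  by rewrite (bigD1 l) //= fl !mul0r.
case: eqP => [nk|nk]; last first.
  rewrite big1 // => f /forallP f1; case: nk; rewrite -(fib_sum f).
  by rewrite (eq_bigr (fun=> 1%N)) ?sum1_card ?card_ord // => l _; exact/eqP.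
move: @fib fib_sum fib_dvd expand; rewrite nk => fib _ _ _ {nk}.
rewrite -mulr_sumr; congr (_ * _).
rewrite (eq_bigl (fun f : {ffun 'I_k -> 'I_k} => injectiveb f)); last first.
  move=> f; apply/forallP/injectiveP => [f1 j j' jj'|f_inj l].
    have /card1P[x xP] := f1 (f j).
    have := xP j; have := xP j'; rewrite !inE -jj' eqxx.
    by move=> /esym/eqP-> /esym/eqP->.
  have [g fg gf] := injF_bij f_inj.
  rewrite /fib (eq_card (B := pred1 (g l))) ?card1 // => j.
  by rewrite !inE; apply/eqP/eqP => [<-|->].
rewrite (sum_perm_finfun (fun f => \prod_(j < k) z (f j) (nth i0 s j))).
rewrite (reindex_inj invg_inj); apply: eq_bigr => p _.
rewrite (reindex_inj (@perm_inj _ p)); apply: eq_bigr => l _.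
by rewrite permK.
Qed.

(** A polynomial is a list of coefficients with words, which can be evaluated in a noncommutative
    algebra and over an infinite set of letters. *)
Definition poly_eval (r : seq (C * seq I)) (z : I -> C) : C :=
  \sum_(t <- r) t.1 * \prod_(i <- t.2) z i.

(** At each character the argument of [r] is a sum of k terms of modulus at most 1/k, hence a point
    of the polydisc. The k-linear form is the average of N^k such values, each multiplied by a
    number of modulus 1. *)
Lemma polarization (r : seq (C * seq I)) (nu : R) (k : nat) (z : nat -> I -> C) :
  (forall y, (forall i, normc (y i) <= 1) -> normc (poly_eval r y) <= nu) ->
  (forall l i, normc (z l i) * k%:R <= 1) ->
  normc (\sum_(t <- r | size t.2 == k) t.1 *
    \sum_(p : 'S_k) \prod_(l < k) z l (nth i0 t.2 (p l))) <= nu.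
Proof.
move=> r_le z_le.
(* Large enough for [character_average] to apply to all words of [r] at once. *)
pose N := (\max_(t <- r) size t.2).+2.
have [xi xi_prim] := prim_root_exists R (ltn0Sn (\max_(t <- r) size t.2).+1).
rewrite -/N in xi_prim.
have N0 : 0 < N%:R ^+ k :> R by rewrite exprn_gt0 // ltr0n.
pose y (e : {ffun 'I_k -> 'I_N}) i := \sum_(l < k) xi ^+ e l * z l i.
have y1 e i : normc (y e i) <= 1.
  apply: le_trans (normc_sum _ _ _) _.
  case: k z_le {N0} e @y => [|k] z_le e y; first by rewrite big_ord0.
  apply: (@le_trans _ _ (\sum_(l < k.+1) k.+1%:R^-1)).
    apply: ler_sum => l _; rewrite normcM normcX (normc_prim_root xi_prim).
    by rewrite expr1n mul1r -[X in _ <= X]mul1r ler_pdivlMr ?ltr0n.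
  by rewrite sumr_const card_ord -[X in X <= _]mulr_natl divff // pnatr_eq0.
rewrite -(ler_pM2l N0) -[X in X * normc _](ger0_norm (ltW N0)) -normc_real.
rewrite -normcM rmorphXn /= rmorph_nat.
have -> : N%:R ^+ k * (\sum_(t <- r | size t.2 == k) t.1 *
      \sum_(p : 'S_k) \prod_(l < k) z l (nth i0 t.2 (p l))) =
    \sum_e (\prod_(l < k) (xi ^+ (e : {ffun 'I_k -> 'I_N}) l) ^+ N.-1) *
      poly_eval r (y e).
  under [RHS]eq_bigr do rewrite /poly_eval mulr_sumr.
  rewrite [RHS]exchange_big mulr_sumr big_mkcond /=; apply: eq_big_seq => t tr.
  have tN : (size t.2 < N)%N.
    by rewrite ltnS ltnW // ltnS (@leq_bigmax_seq _ r xpredT (fun t => size t.2)).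
  under [RHS]eq_bigr do rewrite mulrCA.
  rewrite -[RHS]mulr_sumr (character_average k _ xi_prim) //.
  by case: ifP => _; rewrite ?mulr0 // mulrCA.
apply: le_trans (normc_sum _ _ _) _.
apply: (@le_trans _ _ (\sum_(e : {ffun 'I_k -> 'I_N}) nu)).
  apply: ler_sum => e _; rewrite normcM normc_prod.
  rewrite big1 => [|l _]; last first.
    by rewrite !normcX (normc_prim_root xi_prim) !expr1n.
  by rewrite mul1r; apply: r_le; exact: y1.
by rewrite sumr_const card_ffun !card_ord -[X in X <= _]mulr_natl natrX.
Qed.

End Polarization.

Lemma commuting_prod_perm (A : nzRingType) (I : eqType) (a : I -> A)
    (s t : seq I) : (forall i j, a i * a j = a j * a i) -> perm_eq s t ->
  \prod_(i <- s) a i = \prod_(i <- t) a i.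
Proof.
move=> a_comm; elim: s t => [|x s IHs] t st.
  by rewrite (perm_nilP (_ : perm_eq t [::])) // perm_sym.
have x_t : x \in t by rewrite -(perm_mem st) mem_head.
case/splitPr: x_t st => t1 t2 st.
have : perm_eq (t1 ++ x :: t2) (x :: t1 ++ t2).
  by rewrite -cat1s perm_catCA.
move=> /(perm_trans st); rewrite perm_cons => /IHs s_t.
have move_x : a x * \prod_(i <- t1) a i = \prod_(i <- t1) a i * a x.
  elim: (t1) => [|y t' IHt]; first by rewrite big_nil mulr1 mul1r.
  by rewrite big_cons mulrA a_comm -mulrA IHt mulrA.
by rewrite big_cons s_t !big_cat big_cons /= !mulrA move_x.
Qed.

(** Each step of the induction is (1 + 1/(k+1))^(k+1) <= e. Degree 1 costs nothing, hence the
    exponent k in degree k + 1. *)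
Lemma expn_le_exp_fact (R : realType) k :
  k.+1%:R ^+ k.+1 <= expR 1 ^+ k * (k.+1`!)%:R :> R.
Proof.
elim: k => [|k IHk]; first by rewrite expr1 expr0 mul1r.
have step : k.+2%:R ^+ k.+1 <= expR 1 * k.+1%:R ^+ k.+1 :> R.
  rewrite -ler_pdivrMr ?exprn_gt0 // -expr_div_n.
  have -> : expR 1 = expR (k.+1%:R^-1) ^+ k.+1 :> R.
    by rewrite -expRM_natr mulVf // pnatr_eq0.
  apply: lerXn2r; rewrite ?nnegrE ?expR_ge0 ?divr_ge0 //.
  apply: le_trans (expR_ge1Dx _); rewrite -[k.+2]addn1 natrD mulrDl mul1r.
  by rewrite divff // pnatr_eq0.
rewrite exprS factS natrM mulrCA ler_wpM2l //.
apply: le_trans step _; rewrite [in X in _ <= X]exprS -mulrA.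
by rewrite ler_wpM2l ?expR_ge0.
Qed.

(** * The von Neumann inequality for commuting elements *)

Section VonNeumann.
Variables (R : realType) (G : groupType) (w : weight R G).
Local Notation C := R[i].
Local Notation A := (weighted_l1 w).
Variables (I : eqType) (a : I -> A) (d D : R).
Hypothesis a_comm : forall i j, a i * a j = a j * a i.
Hypothesis a_le : forall i, l1N (a i) <= d.
Hypothesis D_mult : ratio_multiplier_bound w D.
Hypothesis D_ge0 : 0 <= D.
Hypothesis d_ge0 : 0 <= d.

Definition poly_lift (B : lalgType C) (b : I -> B) (r : seq (C * seq I)) : B :=
  \sum_(t <- r) t.1 *: \prod_(i <- t.2) b i.

(** By commutativity, (k+1)! times the homogeneous part is the sum over all permutations of its
    words, that is, the polarized form with equal arguments in all slots; [multilinear_bound]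
    applies to it. The smallness demanded by [polarization] is reached by dividing each slot by
    (k+1) d, whence the factor (k+1)^(k+1) / (k+1)!. *)
Lemma homogeneous_bound (i0 : I) (r : seq (C * seq I)) (nu : R) k :
  (forall y, (forall i, normc (y i) <= 1) -> normc (poly_eval r y) <= nu) ->
  l1N (\sum_(t <- r | size t.2 == k.+1) t.1 *: \prod_(i <- t.2) a i) <=
  expR 1 ^+ k * D ^+ k * d ^+ k.+1 * nu.
Proof.
move=> r_le; set v := \sum_(t <- r | _) _.
have nu0 : 0 <= nu.
  have zero1 : normc (0 : C) <= 1 by rewrite normc0.
  by apply: le_trans (r_le (fun=> 0) (fun=> zero1)); exact: normc_ge0.
have q0 : 0 <= k.+1%:R * d by rewrite mulr_ge0.
pose r' := [seq (t, p) | t <- [seq t <- r | size t.2 == k.+1],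
                         p <- enum {perm 'I_k.+1}].
have sumr' (V : zmodType) (F : (C * seq I) * 'S_k.+1 -> V) :
    \sum_(tp <- r') F tp = \sum_(t <- r | size t.2 == k.+1) \sum_p F (t, p).
  rewrite big_allpairs_dep big_filter; apply: eq_bigr => t _.
  by rewrite big_enum.
pose m (tp : (C * seq I) * 'S_k.+1) l := nth i0 tp.1.2 (tp.2 (inord l)).
have vE : (k.+1`!)%:R *: v = \sum_(tp <- r') tp.1.1 *: \prod_(l < k.+1) a (m tp l).
  rewrite sumr' scaler_sumr; apply: eq_bigr => t /eqP tk.
  transitivity (\sum_(p : 'S_k.+1) t.1 *: \prod_(i <- t.2) a i).
    by rewrite sumr_const card_Sn scaler_nat.
  apply: eq_bigr => p _; congr (_ *: _); pose s' := [seq nth i0 t.2 (p l) | l <- enum 'I_k.+1].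
  rewrite (@commuting_prod_perm _ _ _ t.2 s') //.
    rewrite /s' big_map enumT [index_enum _]unlock; apply: eq_bigr => l _.
    by rewrite /m /= inord_val.
  have -> : t.2 = [seq nth i0 t.2 (l : nat) | l : 'I_k.+1 <- enum 'I_k.+1].
    rewrite (map_comp (nth i0 t.2) val) val_enum_ord -tk.
    by rewrite map_nth_iota0 // take_size.
  rewrite /s' (_ : [seq nth i0 t.2 (p l) | l <- enum 'I_k.+1] =
    [seq nth i0 t.2 (l : nat) | l : 'I_k.+1 <- [seq p l | l <- enum 'I_k.+1]]).
  apply: perm_map; apply: uniq_perm.
  - exact: enum_uniq.
  - by rewrite map_inj_uniq ?enum_uniq //; exact: perm_inj.
  - by move=> l; rewrite mem_enum; apply/esym/mapP; exists (p^-1%g l);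
      rewrite ?mem_enum // permKV.
  exact: (map_comp (fun l : 'I_k.+1 => nth i0 t.2 l) p).
have v_le : l1N ((k.+1`!)%:R *: v) <= D ^+ k * ((k.+1%:R * d) ^+ k.+1 * nu).
  rewrite vE; apply: (multilinear_bound (d := d)) => //.
    by rewrite mulr_ge0 ?exprn_ge0.
  move=> z z_le; set q := k.+1%:R * d.
  have zE l i : z l i = q%:C%C * ((q^-1)%:C%C * z l i).
    have [q_eq0|q_neq0] := eqVneq q 0.
      have d_eq0 : d = 0.
        by move/eqP: q_eq0; rewrite /q mulf_eq0 pnatr_eq0 => /eqP.
      rewrite q_eq0 mul0r; apply: eq0_normc; apply/eqP.
      by rewrite eq_le normc_ge0 andbT -d_eq0.
    by rewrite mulrA -rmorphM divff // mul1r.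
  rewrite sumr' (_ : \sum_(t <- r | _) _ = (q ^+ k.+1)%:C%C *
    \sum_(t <- r | size t.2 == k.+1) t.1 * \sum_(p : 'S_k.+1)
       \prod_(l < k.+1) ((q^-1)%:C%C * z l (nth i0 t.2 (p l)))); last first.
    rewrite mulr_sumr; apply: eq_bigr => t _.
    rewrite mulrCA; under eq_bigr do rewrite /=; rewrite -mulr_sumr.
    congr (_ * _); rewrite mulr_sumr; apply: eq_bigr => p _.
    rewrite rmorphXn -[in X in _ = X * _](card_ord k.+1) -prodr_const -big_split.
    by apply: eq_bigr => l _; rewrite /= -zE /m inord_val.
  rewrite normcM normc_real ger0_norm ?exprn_ge0 // ler_wpM2l ?exprn_ge0 //.
  apply: (@polarization R I i0 r nu k.+1 (fun l i => (q^-1)%:C%C * z l i)) => // l i.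
  rewrite normcM normc_real ger0_norm ?invr_ge0 //.
  have [q_eq0|q_neq0] := eqVneq q 0; first by rewrite q_eq0 invr0 !mul0r.
  rewrite -mulrA ler_pdivrMl ?mulr1; last by rewrite lt_def q_neq0.
  by rewrite mulrC ler_wpM2l.
have f0 : 0 < (k.+1`!)%:R :> R by rewrite ltr0n fact_gt0.
rewrite -(ler_pM2l f0); rewrite l1NZ normc_nat in v_le.
apply: le_trans v_le _; rewrite exprMn.
have := expn_le_exp_fact R k; set E := expR 1 ^+ k; set K := k.+1%:R ^+ k.+1.
have : 0 <= D ^+ k * d ^+ k.+1 * nu by rewrite !mulr_ge0 ?exprn_ge0.
set M := D ^+ k * d ^+ k.+1 * nu => M0 /(ler_wpM2r M0).
rewrite (_ : K * M = D ^+ k * (K * d ^+ k.+1 * nu)); last by rewrite /M; ring.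
move=> le1; apply: le_trans le1 _; rewrite le_eqVlt; apply/orP; left.
by apply/eqP; rewrite /M; ring.
Qed.

(** With x = e D d, degree k + 1 contributes at most d x^k nu; the assumption says d <= 1 - x, so
    the geometric series stays below nu. *)
Lemma poly_lift_bound (r : seq (C * seq I)) (nu : R) :
  d * (1 + expR 1 * D) <= 1 -> all (fun t => (0 < size t.2)%N) r ->
  (forall y, (forall i, normc (y i) <= 1) -> normc (poly_eval r y) <= nu) ->
  l1N (poly_lift a r) <= nu.
Proof.
move=> d_le r_pos r_le.
have nu0 : 0 <= nu.
  have zero1 : normc (0 : C) <= 1 by rewrite normc0.
  by apply: le_trans (r_le (fun=> 0) (fun=> zero1)); exact: normc_ge0.
(* The first letter of the first word serves as the default of [nth]; an empty list gives 0. *)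
case: r r_pos r_le => [|[c [|i0 s]] r] //.
  by move=> _ _; rewrite /poly_lift big_nil l1N0.
move: (_ :: r) => {c s}r r_pos r_le.
pose n := (\max_(t <- r) size t.2)%N.
have -> : poly_lift a r =
    \sum_(k < n) \sum_(t <- r | size t.2 == k.+1) t.1 *: \prod_(i <- t.2) a i.
  under eq_bigr do rewrite big_mkcond.
  rewrite exchange_big /=; apply: eq_big_seq => t tr.
  have t_pos := allP r_pos _ tr.
  have tn : ((size t.2).-1 < n)%N.
    by rewrite prednK // (@leq_bigmax_seq _ r xpredT (fun t => size t.2)).
  rewrite (bigD1 (Ordinal tn)) //= prednK // eqxx.
  rewrite [X in _ = _ + X]big1 ?addr0 // => k /eqP k_t.
  by case: eqP => // tk; case: k_t; apply: val_inj; rewrite /= tk.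
apply: le_trans (l1N_sum _ _ _) _.
apply: (@le_trans _ _ (\sum_(k < n) d * (expR 1 * D * d) ^+ k * nu)).
  apply: ler_sum => k _; apply: le_trans (homogeneous_bound i0 k r_le) _.
  by rewrite -exprMn exprS mulrCA -exprMn.
rewrite -mulr_suml -mulr_sumr ler_piMl //.
set x := expR 1 * D * d; have x0 : 0 <= x by rewrite !mulr_ge0 ?expR_ge0.
have S0 : 0 <= \sum_(k < n) x ^+ k by apply: sumr_ge0 => k _; rewrite exprn_ge0.
apply: (@le_trans _ _ ((1 - x) * \sum_(k < n) x ^+ k)).
  apply: ler_wpM2r => //; move: d_le; rewrite mulrDr mulr1 /x; lra.
have := subrX1 x n; have := exprn_ge0 n x0; set S := \sum_(k < n) _; lra.
Qed.

End VonNeumann.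

(** * The weight ratio as a bounded multiplier *)

Section RatioMultiplier.
Variables (R : realType) (G : groupType) (w : weight R G).
Local Notation C := R[i].
Local Notation KG := (Grothendieck_constant R).
Implicit Types (X : {fset G}) (T B : G -> G -> C) (x y : G).

Lemma finite_bilinear_bound_sub X T k : finite_bilinear_bound X T k ->
  bilinear_bound (fun x y : X => T (val x) (val y)) k.
Proof.
move=> Tk s t s1 t1.
have ext_le (u : X -> C) g : (forall i, normc (u i) <= 1) ->
    normc (oapp u 0 (insub g)) <= 1.
  by move=> u1; case: insub => [i|] /=; [exact: u1 | rewrite expr0n addr0 sqrtr0 ler01].
have := Tk (fun g => oapp s 0 (insub g)) (fun g => oapp t 0 (insub g))
  (fun g => ext_le _ _ s1) (fun g => ext_le _ _ t1).
congr (normc _ <= _); rewrite big_seq_fsetE /=; apply: eq_bigr => x _.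
rewrite big_seq_fsetE /=; apply: eq_bigr => y _.
by rewrite !valK.
Qed.

Lemma finite_bilinear_bound_tr X T k : finite_bilinear_bound X T k ->
  finite_bilinear_bound X (fun x y => T y x) k.
Proof.
move=> Tk s t s1 t1; have := Tk t s t1 s1; congr (normc _ <= _).
rewrite exchange_big; apply: eq_bigr => x _; apply: eq_bigr => y _.
exact: mulrAC.
Qed.

(* A matrix whose columns have bounded l2 norm is a bounded multiplier. *)
Lemma column_multiplier X T B (k Q : R) :
  finite_bilinear_bound X T k -> 0 <= k -> 0 <= Q ->
  (forall y, \sum_(x <- X) normc (B x y) ^+ 2 <= Q ^+ 2) ->
  normc (\sum_(x <- X) \sum_(y <- X) T x y * B x y) <= KG * Q * k.
Proof.
move=> Tk k0 Q0 BQ.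
(* [B x y] is the inner product of the x-th basis vector with the conjugated y-th column, vectors of
   norm at most 1 and [Q]. *)
have := @Grothendieck_bound R X X X _ k 1 Q (fun i l => (l == i)%:R)
  (fun j l => (B (val l) (val j))^*) (finite_bilinear_bound_sub Tk) k0 ler01 Q0.
rewrite mulr1 -mulrA [k * Q]mulrC.
rewrite big_seq_fsetE /=; under [in X in _ -> X]eq_bigr do rewrite big_seq_fsetE /=.
rewrite (eq_bigr (fun i : X => \sum_(j : X) T (val i) (val j) *
    B (val i) (val j))) => [|i _]; last first.
  apply: eq_bigr => j _; congr (_ * _).
  rewrite (bigD1 i) //= eqxx mul1r conjCK big1 ?addr0 // => l /negPf->.
  by rewrite mul0r.
apply=> [i|j].
  rewrite (bigD1 i) //= eqxx normc1 expr1n big1 ?addr0 // => l /negPf->.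
  by rewrite normc0 expr0n.
under eq_bigr do rewrite normc_conj.
by have := BQ (val j); rewrite big_seq_fsetE.
Qed.

(* On the row and the column of the identity the matrix [phi (x * y)] is
   [1/2 s t + 1/2 s t H] with [H = [[1, 1], [1, -1]]] according to whether [x] and
   [y] are the identity, a half-sum of three products of bounded functions. *)
Lemma cross_multiplier X T (k : R) (phi : G -> C) :
  finite_bilinear_bound X T k -> (forall x, normc (phi x) = 1) ->
  normc (\sum_(x <- X) \sum_(y <- X)
    T x y * (((x == 1%g) || (y == 1%g))%:R * phi (x * y)%g)) <= 3 / 2 * k.
Proof.
move=> Tk phi1.
pose s x := phi x; pose t y := phi y * (phi 1%g)^*.
pose s1 x := (x == 1%g)%:R * s x; pose s2 x := (x != 1%g)%:R * s x.
pose t2 y := (if y == 1%g then 1 else -1) * t y.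
have unit1 : phi 1%g * (phi 1%g)^* = 1.
  by rewrite -normc_sqr phi1 expr1n.
have s_le x : normc (s x) <= 1 by rewrite phi1.
have t_le x : normc (t x) <= 1 by rewrite normcM normc_conj !phi1 mulr1.
have s1_le x : normc (s1 x) <= 1.
  by rewrite /s1; case: eqP => _; rewrite ?mul1r ?mul0r ?normc0 ?ler01.
have s2_le x : normc (s2 x) <= 1.
  by rewrite /s2; case: eqP => _; rewrite ?mul1r ?mul0r ?normc0 ?ler01.
have t2_le y : normc (t2 y) <= 1.
  by rewrite /t2; case: eqP => _; rewrite ?mul1r ?mulN1r ?normc_opp.
have -> : \sum_(x <- X) \sum_(y <- X)
    T x y * (((x == 1%g) || (y == 1%g))%:R * phi (x * y)%g) =
    2^-1%:C%C * (\sum_(x <- X) \sum_(y <- X) T x y * s x * t y +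
    \sum_(x <- X) \sum_(y <- X) T x y * s1 x * t y +
    \sum_(x <- X) \sum_(y <- X) T x y * s2 x * t2 y).
  rewrite -!big_split mulr_sumr /=; apply: eq_bigr => x _.
  rewrite -!big_split mulr_sumr /=; apply: eq_bigr => y _.
  have half (z : C) : 2^-1%:C%C * (z + z) = z.
    rewrite -mulr2n -[z *+ 2]mulr_natl mulrA -(rmorph_nat (real_complex R)) -rmorphM.
    by rewrite mulVf ?mul1r // pnatr_eq0.
  rewrite -!mulrA -!mulrDr [RHS]mulrCA; congr (_ * _).
  rewrite /s1 /s2 /t2 /s /t.
  case: (eqVneq x 1%g) => [->|x1] /=.
    rewrite !(mul1r, mul0r, addr0) mul1g half.
    by rewrite mulrCA unit1 mulr1.
  case: (eqVneq y 1%g) => [->|y1] /=.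
    rewrite !(mul1r, mul0r, addr0) mulg1 half.
    by rewrite unit1 mulr1.
  by rewrite !(mul1r, mul0r, addr0, mulN1r, mulrN) subrr mulr0.
rewrite normcM normc_real ger0_norm ?invr_ge0 //.
rewrite ler_pdivrMl // (_ : 2 * (3 / 2 * k) = k + k + k); last by field.
apply: le_trans (normcD _ _) _; apply: lerD; last exact: Tk.
by apply: le_trans (normcD _ _) _; apply: lerD; exact: Tk.
Qed.

(** The matrix splits into the row and column of the identity, where the ratio is 1, and two
    triangles. In one the row index is the shorter element, so the columns are square summable
    through [q]; in the other the roles are exchanged. The costs are 3/2 and twice [KG * Q]. *)
Lemma weight_ratio_bound (q : G -> R) (tau : G -> nat) (Q : R) :
  w 1%g = 1 -> 0 <= Q ->
  (forall x y, x != 1%g -> (tau x <= tau y)%N -> weight_ratio w x y <= q x) ->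
  (forall x y, y != 1%g -> (tau y <= tau x)%N -> weight_ratio w x y <= q y) ->
  (forall X, \sum_(x <- X | x != 1%g) q x ^+ 2 <= Q ^+ 2) ->
  ratio_multiplier_bound w (3 / 2 + 2 * (KG * Q)).
Proof.
move=> w1 Q0 ratio_l ratio_r qQ X T k phi k0 Tk phi1.
have ratio_ge0 x y : 0 <= weight_ratio w x y.
  by rewrite ltW // divr_gt0 ?mulr_gt0 ?weight_gt0.
pose V x y := (weight_ratio w x y)%:C%C * phi (x * y)%g.
have V_norm x y : normc (V x y) = weight_ratio w x y.
  by rewrite normcM normc_real phi1 mulr1 ger0_norm.
pose B1 x y := if [&& x != 1%g, y != 1%g & (tau x <= tau y)%N] then V x y else 0.
pose B2 x y := if [&& x != 1%g, y != 1%g & (tau y < tau x)%N] then V x y else 0.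
have -> : \sum_(x <- X) \sum_(y <- X) T x y * V x y =
    \sum_(x <- X) \sum_(y <- X)
      T x y * (((x == 1%g) || (y == 1%g))%:R * phi (x * y)%g) +
    \sum_(x <- X) \sum_(y <- X) T x y * B1 x y +
    \sum_(x <- X) \sum_(y <- X) T x y * B2 x y.
  rewrite -!big_split /=; apply: eq_bigr => x _.
  rewrite -!big_split /=; apply: eq_bigr => y _.
  rewrite -!mulrDr; congr (_ * _); rewrite /B1 /B2 /V /weight_ratio.
  have w_neq0 z : w z != 0 by rewrite gt_eqF ?weight_gt0.
  case: (eqVneq x 1%g) => [->|x1] /=.
    by rewrite mul1g w1 mul1r divff // !mul1r !addr0.
  case: (eqVneq y 1%g) => [->|y1] /=.
    by rewrite mulg1 w1 mulr1 divff // !mul1r !addr0.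
  by rewrite mul0r add0r; case: leqP => _; rewrite ?addr0 ?add0r.
have sq_le (x : G) (v : C) (b : bool) : (b -> normc v <= q x) -> (b -> x != 1%g) ->
    normc (if b then v else 0) ^+ 2 <= if x != 1%g then q x ^+ 2 else 0.
  case: b => [/(_ isT) v_le /(_ isT) ->|_ _].
    by rewrite lerXn2r ?nnegrE ?normc_ge0 // (le_trans (normc_ge0 v)).
  by rewrite normc0 expr0n; case: ifP => // _; rewrite sqr_ge0.
have B1_le y : \sum_(x <- X) normc (B1 x y) ^+ 2 <= Q ^+ 2.
  apply: le_trans (qQ X); rewrite [in X in _ <= X]big_mkcond.
  apply: ler_sum => x _; apply: sq_le => /and3P[x1 y1 xy] //.
  by rewrite V_norm ratio_l.
have B2_le x : \sum_(y <- X) normc (B2 x y) ^+ 2 <= Q ^+ 2.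
  apply: le_trans (qQ X); rewrite [in X in _ <= X]big_mkcond.
  apply: ler_sum => y _; apply: sq_le => /and3P[x1 y1 xy] //.
  by rewrite V_norm ratio_r // ltnW.
have le0 := cross_multiplier Tk phi1.
have le1 := column_multiplier Tk k0 Q0 B1_le.
have := column_multiplier (B := fun y x => B2 x y)
  (finite_bilinear_bound_tr Tk) k0 Q0 B2_le; rewrite exchange_big /= => le2.
apply: le_trans (normcD _ _) _; apply: le_trans (lerD (normcD _ _) le2) _.
apply: le_trans (lerD (lerD le0 le1) (lexx _)) _; lra.
Qed.

End RatioMultiplier.

(** * Word length and exponential weights *)

Section PowerInequalities.
Variable R : realType.
Implicit Types (a s r v : R).

(** Convexity of the exponential: the tangent at a ln (1 + v) is evaluated at ln (1 + v) and at 0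
    with weights a and 1 - a, and the slope terms cancel. *)
Lemma powR_bernoulli a v : 0 <= a <= 1 -> 0 <= v -> (1 + v) `^ a <= 1 + a * v.
Proof.
move=> /andP[a0 a1] v0; have v1 : 0 < 1 + v by lra.
rewrite /powR gt_eqF //; set L := ln (1 + v).
have -> : 1 + a * v = a * expR L + (1 - a) * expR 0.
  by rewrite lnK // expR0; ring.
have tangent t : expR (a * L) * (1 + (t - a * L)) <= expR t.
  rewrite (_ : expR t = expR (a * L) * expR (t - a * L)).
    by rewrite ler_wpM2l ?expR_ge0 // expR_ge1Dx.
  by rewrite -expRD addrC subrK.
have := ler_wpM2l a0 (tangent L).
have a2 : 0 <= 1 - a by lra.
have := ler_wpM2l a2 (tangent 0); lra.
Qed.

(** Divided by r^a, this is (1 + v)^a <= 1 + a v <= 1 + a v^a for v = s / r <= 1. The factor a at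
    the smaller term is the gain over subadditivity and the source of the decay of the weight
    ratio. *)
Lemma powR_add_le a s r : 0 < a <= 1 -> 0 <= s <= r ->
  (s + r) `^ a <= r `^ a + a * s `^ a.
Proof.
move=> /andP[a0 a1] /andP[s0 sr].
have [r_eq0|r_neq0] := eqVneq r 0.
  have -> : s = 0 by lra.
  by rewrite r_eq0 addr0 powR0 ?gt_eqF // mulr0 addr0.
have r0 : 0 < r by rewrite lt_def r_neq0 (le_trans s0).
have [->|s_neq0] := eqVneq s 0.
  by rewrite add0r powR0 ?gt_eqF // mulr0 addr0.
have s_gt0 : 0 < s by rewrite lt_def s_neq0.
set v := s / r; have sE : s = v * r by rewrite /v divfK.
have v0 : 0 < v by rewrite divr_gt0.
have v1 : v <= 1 by rewrite ler_pdivrMr // mul1r.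
have -> : (s + r) `^ a = r `^ a * (1 + v) `^ a.
  rewrite -powRM ?(ltW r0) //; last by lra.
  by rewrite sE; congr (_ `^ _); ring.
have -> : s `^ a = r `^ a * v `^ a by rewrite sE powRM ?(ltW v0) ?(ltW r0) // mulrC.
rewrite [a * _]mulrCA -[X in _ <= X + _]mulr1 -mulrDr ler_wpM2l ?powR_ge0 //.
apply: le_trans (powR_bernoulli _ (ltW v0)) _; first by rewrite ltW.
by rewrite lerD2l ler_wpM2l ?(ltW a0) // ger1_powR ?v0.
Qed.

End PowerInequalities.

Section WordLength.
Variables (G : groupType) (F : set G).
Hypothesis F_gen : symmetric_generating_set F.
Local Notation ball := (word_ball F).
Local Notation tau := (word_length F).

Lemma word_ball0 x : ball 0 x <-> x = 1%g.
Proof.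
split=> [[u [_ ->]]|->]; first by rewrite big_ord0.
by exists (fun=> 1%g); rewrite big_ord0; split=> // -[].
Qed.

Lemma word_ballS n x : ball n.+1 x <-> exists y z, [/\ ball n y, F z & x = (y * z)%g].
Proof.
split=> [[u [uF ->]]|[y [z [[u [uF ->]] zF ->]]]].
  rewrite big_ord_recr /=; exists (\prod_(i < n) u (widen_ord (leqnSn n) i))%g.
  by exists (u ord_max); split=> //; exists (fun i => u (widen_ord (leqnSn n) i)).
exists (fun i : 'I_n.+1 => oapp u z (insub (val i))); split=> [i|].
  by case: insubP => [j|] /=.
rewrite big_ord_recr /= insubF ?ltnn //=; congr (_ * _)%g.
apply: eq_bigr => i _; rewrite insubT ?ltn_ord //= => i_n.
by congr u; apply: val_inj.
Qed.

Lemma word_ballD m n x y : ball m x -> ball n y -> ball (m + n) (x * y)%g.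
Proof.
move=> mx; elim: n y => [|n IHn] y.
  by move=> /word_ball0->; rewrite addn0 mulg1.
move=> /word_ballS[z [t [nz tF ->]]]; rewrite addnS; apply/word_ballS.
by exists (x * z)%g, t; split=> //; [exact: IHn | rewrite mulgA].
Qed.

Lemma word_ball_mono m n x : (m <= n)%N -> ball m x -> ball n x.
Proof.
case: F_gen => _ F1 _ _ mn mx; rewrite -(subnKC mn) -[x]mulg1.
apply: word_ballD => //; elim: (n - m)%N => [|k IHk]; first exact/word_ball0.
by apply/word_ballS; exists 1%g, 1%g; rewrite mulg1.
Qed.

Lemma word_ballV n x : ball n x -> ball n x^-1%g.
Proof.
case: F_gen => _ _ FV _; elim: n x => [|n IHn] x.
  by move=> /word_ball0->; rewrite invg1; exact/word_ball0.
move=> /word_ballS[y [z [ny zF ->]]]; rewrite invgM -add1n.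
apply: word_ballD; last exact: IHn.
apply/word_ballS; exists 1%g, z^-1%g; split; [exact/word_ball0|exact: FV|].
by rewrite mul1g.
Qed.

(** The union of the balls is a subgroup that contains [F]. Hence the default value of [word_length]
    never occurs. *)
Lemma word_ball_exhaust x : exists n, ball n x.
Proof.
case: (F_gen) => _ F1 _ /(_ [set x | exists n, ball n x]) gen.
have : [set x | exists n, ball n x] = [set: G].
  apply: gen => [|y yF]; last first.
    exists 1%N; apply/word_ballS; exists 1%g, y; rewrite mul1g.
    by split=> //; exact/word_ball0.
  split=> [|y z [m my] [n nz]|y [n ny]].
  - by exists 0%N; exact/word_ball0.
  - by exists (m + n)%N; exact: word_ballD.
  - by exists n; exact: word_ballV.
by move/seteqP => [_ /(_ x)]; apply.
Qed.

Lemma word_lengthP n x : ball n x <-> (tau x <= n)%N.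
Proof.
have [tau_ball tau_min] : ball (tau x) x /\ forall m, ball m x -> (tau x <= m)%N.
  rewrite /word_length; case: xgetP => [m -> //|/(_ _)].
  have ex_n : exists n, `[< ball n x >].
    by have [k kx] := word_ball_exhaust x; exists k; exact/asboolP.
  case: (ex_minnP ex_n) => k /asboolP kx k_min /(_ k) [].
  by split=> // m mx; apply: k_min; exact/asboolP.
by split=> [/tau_min//|le_n]; exact: word_ball_mono le_n tau_ball.
Qed.

Lemma word_length_eq0 x : (tau x == 0%N) = (x == 1%g).
Proof.
rewrite -leqn0; apply/idP/eqP => [/word_lengthP/word_ball0//|->].
by apply/word_lengthP; exact/word_ball0.
Qed.

Lemma word_lengthM x y : (tau (x * y)%g <= tau x + tau y)%N.
Proof. by apply/word_lengthP; apply: word_ballD; exact/word_lengthP. Qed.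

Lemma word_ball_finite n : finite_set (ball n).
Proof.
case: F_gen => F_fin _ _ _; elim: n => [|n IHn].
  by apply: (sub_finite_set _ (finite_set1 (1%g : G))) => x /word_ball0.
apply: (sub_finite_set _ (finite_image2 (fun x y : G => (x * y)%g) IHn F_fin)).
by move=> x /word_ballS[y [z [ny zF ->]]]; exists y => //; exists z.
Qed.

Definition ball_fset n : {fset G} := fset_set (ball n).

Lemma in_ball_fset n x : (x \in ball_fset n) = (tau x <= n)%N.
Proof.
rewrite in_fset_set; last exact: word_ball_finite.
by apply/idP/idP => [/set_mem/word_lengthP//|/word_lengthP/mem_set].
Qed.

(** At n = 0 the value is 0, since [0.-1] is 0; sums over spheres start at 1 and so leave out the
    identity. *)
Definition sphere_size (R : pzRingType) n : R :=
  (ball_size F n)%:R - (ball_size F n.-1)%:R.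

Lemma ball_sum (R : realType) (u : nat -> R) N :
  \sum_(x <- ball_fset N | x != 1%g) u (tau x) =
  \sum_(1 <= n < N.+1) sphere_size R n * u n.
Proof.
elim: N => [|N IHN].
  rewrite big_geq // big1_seq // => x /andP[x1]; rewrite in_ball_fset leqn0.
  by rewrite word_length_eq0 (negPf x1).
rewrite big_nat_recr //= -IHN big_mkcond (big_fsetID _ (mem (ball_fset N))) /=.
have -> : [fset x | x in ball_fset N.+1 & x \in ball_fset N]%fset = ball_fset N.
  apply/fsetP => x; rewrite !inE /= !in_ball_fset.
  by case: (leqP (tau x) N) => [/leqW->|]; rewrite ?andbF.
set S := [fset x | x in _ & _]%fset.
have SE : S = (ball_fset N.+1 `\` ball_fset N)%fset.
  by apply/fsetP => x; rewrite !inE /= andbC.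
rewrite -big_mkcond; congr (_ + _).
rewrite (eq_big_seq (fun=> u N.+1)) => [|x]; last first.
  rewrite SE !inE !in_ball_fset -ltnNge => /andP[xN xN1].
  have /eqP -> : tau x == N.+1 by rewrite eqn_leq xN1 xN.
  by rewrite -word_length_eq0 -lt0n (leq_trans _ xN).
rewrite SE big_const_seq count_predT iter_addr_0 -mulr_natl; congr (_ * _).
rewrite -/(#|` _|)%fset.
have sub : (ball_fset N `<=` ball_fset N.+1)%fset.
  by apply/fsubsetP => x; rewrite !in_ball_fset => /leqW.
rewrite cardfsDS // natrB ?fsubset_leq_card //.
Qed.

Lemma word_length_sum_le (R : realType) (u : nat -> R) (B : R) :
  (forall n, 0 <= u n) ->
  (forall N, \sum_(1 <= n < N.+1) sphere_size R n * u n <= B) ->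
  forall X : {fset G}, \sum_(x <- X | x != 1%g) u (tau x) <= B.
Proof.
move=> u0 uB X; pose N := (\max_(x <- X) tau x)%N.
apply: le_trans (uB N); rewrite -ball_sum !(big_mkcond (fun x => x != 1%g)).
apply: (ler_sum_fsubset (u := fun x => if x != 1%g then u (tau x) else 0)).
  by move=> x; case: ifP.
apply/fsubsetP => x xX; rewrite in_ball_fset.
exact: (@leq_bigmax_seq _ (enum_fset X) xpredT tau).
Qed.

End WordLength.

Section ExponentialWeight.
Variables (R : realType) (G : groupType) (F : set G) (alpha C : R).
Hypothesis F_gen : symmetric_generating_set F.
Hypothesis alpha01 : 0 < alpha < 1.
Hypothesis C_gt0 : 0 < C.
Local Notation tau := (word_length F).
Local Notation w := (exp_weight F alpha C).

Definition ratio_profile (n : nat) : R :=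
  expR (- (C * (1 - alpha) * n%:R `^ alpha)).

Lemma word_length_powR x y :
  (tau (x * y)%g)%:R `^ alpha <=
  (tau x)%:R `^ alpha + (tau y)%:R `^ alpha -
  (1 - alpha) * (minn (tau x) (tau y))%:R `^ alpha.
Proof.
have /andP[a0 a1] := alpha01.
have a01 : 0 < alpha <= 1 by rewrite a0 ltW.
have le1 : (tau (x * y)%g)%:R `^ alpha <= ((tau x)%:R + (tau y)%:R) `^ alpha.
  apply: ge0_ler_powR; rewrite ?nnegrE ?addr_ge0 ?(ltW a0) //.
  by rewrite -natrD ler_nat word_lengthM.
apply: le_trans le1 _; case: (leqP (tau x) (tau y)) => [xy|yx].
  apply: le_trans (powR_add_le a01 _) _; first by rewrite ler0n ler_nat.
  by lra.
rewrite addrC; apply: le_trans (powR_add_le a01 _) _; last by lra.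
by rewrite ler0n ler_nat ltnW.
Qed.

Lemma exp_weight_gt0 x : 0 < w x. Proof. exact: expR_gt0. Qed.

Lemma exp_weightM x y : w (x * y)%g <= w x * w y.
Proof.
rewrite /exp_weight -expRD ler_expR -mulrDr ler_wpM2l ?(ltW C_gt0) //.
apply: le_trans (word_length_powR x y) _; rewrite gerBl mulr_ge0 ?powR_ge0 //.
by have /andP[_] := alpha01; lra.
Qed.

Definition exp_weight_weight : weight R G := Weight exp_weight_gt0 exp_weightM.

Lemma exp_weight1 : exp_weight_weight 1%g = 1.
Proof.
rewrite /= /exp_weight.
have /eqP -> : tau 1%g == 0%N by rewrite word_length_eq0.
have /andP[a0 _] := alpha01.
by rewrite powR0 ?gt_eqF // mulr0 expR0.
Qed.

Lemma exp_weight_ratio x y : weight_ratio exp_weight_weight x y <=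
  ratio_profile (minn (tau x) (tau y)).
Proof.
have -> : weight_ratio exp_weight_weight x y =
    expR (C * (tau (x * y)%g)%:R `^ alpha -
          (C * (tau x)%:R `^ alpha + C * (tau y)%:R `^ alpha)).
  by rewrite expRB expRD.
rewrite /ratio_profile ler_expR.
by have := ler_wpM2l (ltW C_gt0) (word_length_powR x y); lra.
Qed.

Lemma exp_weight_multiplier (Q : R) : 0 <= Q ->
  (forall N, \sum_(1 <= n < N.+1) sphere_size F R n * ratio_profile n ^+ 2 <=
     Q ^+ 2) ->
  ratio_multiplier_bound exp_weight_weight
    (3 / 2 + 2 * (Grothendieck_constant R * Q)).
Proof.
move=> Q0 Q_le.
apply: (weight_ratio_bound (q := ratio_profile \o tau) (tau := tau)) => //.
- exact: exp_weight1.
- by move=> x y _ xy; have := exp_weight_ratio x y; rewrite (minn_idPl xy).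
- by move=> x y _ yx; have := exp_weight_ratio x y; rewrite (minn_idPr yx).
- apply: (word_length_sum_le F_gen (u := fun n => ratio_profile n ^+ 2)) => // n.
  exact: sqr_ge0.
Qed.

End ExponentialWeight.

(** * The constants *)

Section NumericBounds.
Variable R : realType.
Implicit Types (x y b c : R).

(** Negative x are allowed, so this certifies upper bounds of logarithms and, through exp (- x),
    lower ones. The exponent is a power of 2 so that six squarings compute it. *)
Lemma expR_ge_pow64 x : 0 <= 1 + x / 64 -> (1 + x / 64) ^+ 64 <= expR x.
Proof.
move=> x0; have -> : expR x = expR (x / 64) ^+ 64.
  by rewrite -expRM_natr divfK // pnatr_eq0.
by apply: lerXn2r; rewrite ?nnegrE ?expR_ge0 ?expR_ge1Dx.
Qed.

(** The numbers a1, ..., a6 are successive squares rounded down, which keeps the decimals short. *)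
Lemma pow64_ge (x a1 a2 a3 a4 a5 a6 : R) :
  0 <= a1 <= x ^+ 2 -> 0 <= a2 <= a1 ^+ 2 -> 0 <= a3 <= a2 ^+ 2 ->
  0 <= a4 <= a3 ^+ 2 -> 0 <= a5 <= a4 ^+ 2 -> a6 <= a5 ^+ 2 -> a6 <= x ^+ 64.
Proof.
have sqr_le (a b : R) : 0 <= a <= b -> a ^+ 2 <= b ^+ 2.
  by move=> /andP[a0 ab]; apply: lerXn2r; rewrite ?nnegrE ?(le_trans a0).
have step (a b t : R) : 0 <= t <= a ^+ 2 -> 0 <= a <= b -> 0 <= t <= b ^+ 2.
  by move=> /andP[-> ta] /sqr_le/(le_trans ta).
move=> h1 h2 h3 h4 h5 h6.
have -> : x ^+ 64 = (((((x ^+ 2) ^+ 2) ^+ 2) ^+ 2) ^+ 2) ^+ 2.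
  by rewrite -!exprM.
apply: le_trans h6 _; apply: sqr_le.
exact: step h5 (step _ _ _ h4 (step _ _ _ h3 (step _ _ _ h2 h1))).
Qed.

Lemma ln_le_of_expR x y : 0 < y -> y <= expR x -> ln y <= x.
Proof. by move=> y0 yx; rewrite -(expRK x) ler_ln ?posrE ?expR_gt0. Qed.

Lemma ln_ge_of_expRN x y : 0 < y -> y^-1 <= expR (- x) -> x <= ln y.
Proof.
move=> y0; rewrite expRN lef_pV2 ?posrE ?expR_gt0 // => xy.
by rewrite -[x]expRK ler_ln ?posrE ?expR_gt0.
Qed.

Lemma ln10_le : ln 10 <= 235 / 100 :> R.
Proof.
apply: ln_le_of_expR => //; apply: le_trans (expR_ge_pow64 _); last by lra.
by apply: (@pow64_ge _ (1 + 7/100 + 47/100/100) (1 + 15/100 + 49/100/100) (1 + 33/100 + 37/100/100)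
  (1 + 77/100 + 87/100/100) (3 + 16/100 + 37/100/100)); lra.
Qed.

Lemma ln92_le : ln (9 / 2) <= 155 / 100 :> R.
Proof.
apply: ln_le_of_expR; first by lra.
apply: le_trans (expR_ge_pow64 _); last by lra.
by apply: (@pow64_ge _ (1 + 4/100 + 90/100/100) (1 + 10/100 + 4/100/100) (1 + 21/100 + 8/100/100)
  (1 + 46/100 + 60/100/100) (2 + 14/100 + 91/100/100)); lra.
Qed.

Lemma ln6_ge : 175 / 100 <= ln 6 :> R.
Proof.
apply: ln_ge_of_expRN => //; apply: le_trans (expR_ge_pow64 _); last by lra.
by apply: (@pow64_ge _ (0 + 94/100 + 60/100/100) (0 + 89/100 + 49/100/100) (0 + 80/100 + 8/100/100)
  (0 + 64/100 + 12/100/100) (0 + 41/100 + 11/100/100)); lra.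
Qed.

Lemma ln4_ge : 135 / 100 <= ln 4 :> R.
Proof.
apply: ln_ge_of_expRN => //; apply: le_trans (expR_ge_pow64 _); last by lra.
by apply: (@pow64_ge _ (0 + 95/100 + 82/100/100) (0 + 91/100 + 81/100/100) (0 + 84/100 + 29/100/100)
  (0 + 71/100 + 4/100/100) (0 + 50/100 + 46/100/100)); lra.
Qed.

Lemma expR1_ge : 5 / 2 <= expR 1 :> R.
Proof.
apply: le_trans (expR_ge_pow64 _); last by lra.
by apply: (@pow64_ge _ (1 + 3/100) (1 + 6/100)
  (1 + 12/100 + 36/100/100) (1 + 26/100) (1 + 58/100 + 76/100/100)); lra.
Qed.

Lemma ln_le_sub1 x : 0 < x -> ln x <= x - 1.
Proof.
by move=> x0; have := @le_ln1Dx R (x - 1); rewrite subrKC; apply; lra.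
Qed.

(** The logarithm is replaced by its tangent at 1 for b <= 1.65 and by its tangent at 3 beyond. Both
    leave little room at 1.65, which dictates the accuracy of the numerical bounds. *)
Lemma ln_sqr_bound b : 1 <= b ->
  ln 10 + b * (3 * ln b - ln 6) <= b ^+ 2.
Proof.
move=> b1; have b0 : 0 < b by lra.
have := ln10_le; have := ln6_ge => l6 l10.
have [b_le|b_ge] := leP b (165 / 100).
  have h1 := ler_wpM2l (ltW b0) (ln_le_sub1 b0).
  have h2 : 0 <= (b - 1) * (165 / 100 - b) by apply: mulr_ge0; lra.
  have h3 := ler_wpM2l (ltW b0) l6.
  lra.
have b3 : 0 < b / 3 by lra.
have ln27 : 3 * ln 3 = ln (9 / 2) + ln 6 :> R.
  rewrite -lnM ?posrE ?divr_gt0 //.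
  rewrite (_ : 9 / 2 * 6 = 3 ^+ 3 :> R); last by field.
  by rewrite lnXn // mulr_natl.
have lnb : ln b = ln 3 + ln (b / 3).
  by rewrite -lnM ?posrE // mulrCA divff ?mulr1 // pnatr_eq0.
have := ln_le_sub1 b3; have := ln92_le => l92 lb.
have : b * (3 * ln b - ln 6) <= b * (b + ln (9 / 2) - 3).
  by apply: ler_wpM2l; [exact: ltW | lra].
have : b * ln (9 / 2) <= b * (155 / 100) by rewrite ler_wpM2l // ltW.
by nra.
Qed.

(** With c m^a = y b^2 and y >= 1, the assumption 6 <= b c yields m^a <= y b^3 / 6. After ln y <= y
    - 1 and [ln_sqr_bound], what remains is b (b - 1) (y - 1) >= 0. This is the use of the term 6 /
    (C alpha (1 - alpha)) in beta. *)
Lemma ln_le_large_power (a b c m : R) : 1 <= b -> 6 <= b * c -> 0 < m ->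
  b ^+ 2 <= c * m `^ a -> ln 10 + b * (a * ln m) <= c * m `^ a.
Proof.
move=> b1 bc m0; rewrite -ln_powR; have := powR_gt0 a m0.
move: (m `^ a) => u u0 bu; have b0 : 0 < b by lra.
have [y y1 uE] : exists2 y, 1 <= y & c * u = y * b ^+ 2.
  exists (c * u / b ^+ 2); last by rewrite divfK // expf_neq0 ?gt_eqF.
  by rewrite ler_pdivlMr ?mul1r // exprn_gt0.
have y0 : 0 < y by lra.
have ln_u : ln u <= ln y + 3 * ln b - ln 6.
  apply: (@le_trans _ _ (ln (y * b ^+ 3 / 6))).
    rewrite ler_ln ?posrE //; last by rewrite divr_gt0 ?mulr_gt0 ?exprn_gt0.
    rewrite ler_pdivlMr // exprS mulrCA -uE mulrA mulrC.
    by rewrite ler_wpM2r // ltW.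
  have b3 : 0 < b ^+ 3 by rewrite exprn_gt0.
  have yb : 0 < y * b ^+ 3 by rewrite mulr_gt0.
  by rewrite ln_div ?posrE // lnM ?posrE // lnXn // -[_ *+ 3]mulr_natl.
have h1 := ln_sqr_bound b1; have h2 := ler_wpM2l (ltW b0) ln_u.
have h3 := ler_wpM2l (ltW b0) (ln_le_sub1 y0).
have h4 : 0 <= b * (b - 1) * (y - 1).
  by rewrite !mulr_ge0 ?subr_ge0 // ltW.
by rewrite uE; lra.
Qed.

End NumericBounds.

Section Constants.
Variables (R : realType) (d : nat) (lambda alpha C : R).
Hypothesis alpha01 : 0 < alpha < 1.
Hypothesis C_gt0 : 0 < C.
Let beta := beta_const d lambda alpha C.
Let c := C * alpha * (1 - alpha).
Let M := M_const alpha C beta.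
Local Notation p := (p_fun alpha C beta).

Let alpha_gt0 : 0 < alpha. Proof. by case/andP: alpha01. Qed.
Let alpha_lt1 : alpha < 1. Proof. by case/andP: alpha01. Qed.
Let c_gt0 : 0 < c. Proof. by rewrite !mulr_gt0 // subr_gt0. Qed.

Lemma beta_ge1 : 1 <= beta.
Proof. by rewrite /beta /beta_const le_max lexx. Qed.

Lemma beta_c_ge6 : 6 <= beta * c.
Proof.
rewrite -ler_pdivrMr // /beta /beta_const.
by rewrite le_max [X in _ || X]le_max lexx orbT.
Qed.

Let N := Num.truncn (4 * K_const alpha C beta).

Lemma M_const_ge t s r : (t <= N)%N -> (s <= N)%N -> (r <= N)%N ->
  expR (p t%:R - p s%:R - p r%:R) <= M.
Proof.
move=> tN sN rN.
pose o i (iN : (i <= N)%N) : 'I_N.+1 := Ordinal (iN : (i < N.+1)%N).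
apply: (bigmax_sup (o _ tN)) => //; apply: (bigmax_sup (o _ sN)) => //.
exact: (bigmax_sup (o _ rN)).
Qed.

Lemma p_fun0 : p 0 = 0.
Proof. by rewrite /p_fun powR0 ?gt_eqF // addr0 ln1 !mulr0 subrr. Qed.

Lemma M_const_ge1 : 1 <= M.
Proof. by have := @M_const_ge 0%N 0%N 0%N; rewrite p_fun0 !subr0 expR0; apply. Qed.

Let n_le n : (0 < n)%N -> ln (1 + n%:R) <= ln 2 + ln n%:R :> R.
Proof.
move=> n0; rewrite -lnM ?posrE ?ltr0n // ler_ln ?posrE ?mulr_gt0 ?ltr0n //.
have : 1 <= n%:R :> R by rewrite ler1n.
by lra.
Qed.

(** The range n >= K, after taking logarithms. Passing from ln (1 + n) to ln n costs beta ln 2; the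
    factor 2^(beta - 1) pays all but one ln 2, which joins ln 5 to form the ln 10 of
    [ln_le_large_power]. *)
Let profile_le_large n : (0 < n)%N -> beta ^+ 2 <= c * n%:R `^ alpha ->
  beta * ln (1 + n%:R) + ln 5 - (beta - 1) * ln 2 <=
  C * (1 - alpha) * n%:R `^ alpha.
Proof.
move=> n0 n_large; have b1 := beta_ge1; have b0 : 0 < beta by lra.
have n_gt0 : 0 < n%:R :> R by rewrite ltr0n.
have main := ln_le_large_power b1 beta_c_ge6 n_gt0 n_large.
have ln10E : ln 10 = ln 2 + ln 5 :> R.
  by rewrite -lnM ?posrE //; congr ln; ring.
rewrite -(ler_pM2l alpha_gt0).
have -> : alpha * (C * (1 - alpha) * n%:R `^ alpha) = c * n%:R `^ alpha.
  by rewrite /c; ring.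
have h1 := ler_wpM2l (ltW alpha_gt0) (ler_wpM2l (ltW b0) (n_le n0)).
have ln10_ge0 : 0 <= ln 10 :> R by rewrite ln_ge0 // ler1n.
have h2 : alpha * ln 10 <= ln 10 by rewrite ler_piMl // ltW.
rewrite ln10E in main h2; lra.
Qed.

(** The case 4 K < 1, where the maximum M is over the single triple of zeros. From 4^alpha >= 1 +
    alpha ln 4 follows C (1 - alpha) >= ln 10; from c >= beta it follows that n^alpha >= 1 + alpha
    ln n suffices to dominate beta ln n. *)
Let profile_le_small n : (0 < n)%N -> 4 `^ alpha * beta ^+ 2 < c ->
  beta * ln (1 + n%:R) + ln 5 - (beta - 1) * ln 2 <=
  C * (1 - alpha) * n%:R `^ alpha.
Proof.
move=> n0 c_large; have b1 := beta_ge1; have b0 : 0 < beta by lra.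
have n_gt0 : 0 < n%:R :> R by rewrite ltr0n.
have b2 : beta <= beta ^+ 2 by rewrite expr2 ler_peMl // ltW.
have ln10E : ln 10 = ln 2 + ln 5 :> R.
  by rewrite -lnM ?posrE //; congr ln; ring.
set c' := C * (1 - alpha); have cE : c = alpha * c' by rewrite /c /c'; ring.
have pow4 : 1 + alpha * ln 4 <= 4 `^ alpha.
  by rewrite /powR gt_eqF // expR_ge1Dx.
have c'_ge : ln 10 <= c'.
  rewrite -(ler_pM2l alpha_gt0) -cE.
  apply: le_trans (ltW c_large); apply: (@le_trans _ _ (1 + alpha * ln 4)).
    have := ln10_le R; have := ln4_ge R => l4 l10.
    have := ler_wpM2l (ltW alpha_gt0) l4; have := ler_wpM2l (ltW alpha_gt0) l10.
    by have := alpha_lt1; lra.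
  apply: le_trans pow4 _; rewrite ler_peMr ?powR_ge0 //.
  by rewrite (le_trans b1).
have c_ge : beta <= alpha * c'.
  rewrite -cE; apply: le_trans (ltW c_large); apply: le_trans b2 _.
  rewrite ler_peMl ?sqr_ge0 //; apply: le_trans pow4.
  by rewrite lerDl mulr_ge0 ?ltW // ln_gt0 // ltr1n.
have n_pow : 1 + alpha * ln n%:R <= n%:R `^ alpha.
  by rewrite /powR gt_eqF // expR_ge1Dx.
have c'0 : 0 <= c' by rewrite mulr_ge0 ?subr_ge0 ?ltW.
have ln_n0 : 0 <= ln n%:R :> R by rewrite ln_ge0 // ler1n.
have := ler_wpM2l c'0 n_pow; have := ler_wpM2r ln_n0 c_ge.
have := ler_wpM2l (ltW b0) (n_le n0); rewrite ln10E in c'_ge; nra.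
Qed.

Lemma profile_M_bound n : (0 < n)%N ->
  5 * ratio_profile alpha C n * (1 + n%:R) `^ beta <= M * 2 `^ (beta - 1).
Proof.
move=> n0; set K := K_const alpha C beta.
have b1 := beta_ge1; have b0 : 0 < beta by lra.
have K0 : 0 <= K by exact: powR_ge0.
have K_alpha : K `^ alpha = beta ^+ 2 / c.
  rewrite /K /K_const -powRrM mulVf ?gt_eqF // powRr1 //.
  by rewrite divr_ge0 ?sqr_ge0 ?ltW.
have truncK := @truncn_itv R (4 * K); have K4 : 0 <= 4 * K by rewrite mulr_ge0.
have /andP[N_le N_gt] := truncK K4; rewrite -/N in N_le N_gt.
have [v v_le vM] : exists2 v, beta * ln (1 + n%:R) + ln 5 -
    (beta - 1) * ln 2 - C * (1 - alpha) * n%:R `^ alpha <= v & expR v <= M.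
  have [N0|N_pos] := posnP N.
    exists 0; last by rewrite expR0 M_const_ge1.
    rewrite subr_le0; apply: profile_le_small => //.
    move: N_gt; rewrite N0 => K_lt.
    have : (4 * K) `^ alpha < 1 `^ alpha.
      by apply: gt0_ltr_powR; rewrite ?nnegrE.
    by rewrite powR1 powRM // K_alpha mulrA ltr_pdivrMr // mul1r.
  (* From 4 K < N + 1 <= 2 N follows K <= N <= m. *)
  have large m : (N <= m)%N -> beta ^+ 2 <= c * m%:R `^ alpha.
    move=> Nm; rewrite -ler_pdivrMl // mulrC -K_alpha.
    apply: ge0_ler_powR; rewrite ?nnegrE ?(ltW alpha_gt0) //.
    have : N%:R <= m%:R :> R by rewrite ler_nat.
    have : 1 <= N%:R :> R by rewrite ler1n.
    by move: N_gt; rewrite -natr1; lra.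
  have [n_N|N_n] := leqP n N.
    (* Up to N the maximum M compensates, with t = N, s = n and r = 0: the claim for n reduces to
       the one for N because C alpha n^alpha <= C alpha N^alpha. *)
    exists (p N%:R - p n%:R - p 0%:R); last exact: M_const_ge.
    rewrite p_fun0 subr0 /p_fun.
    have := profile_le_large N_pos (large _ (leqnn N)).
    have : n%:R `^ alpha <= N%:R `^ alpha.
      by apply: ge0_ler_powR; rewrite ?nnegrE ?(ltW alpha_gt0) ?ler_nat.
    move=> /(ler_wpM2l (ltW (mulr_gt0 C_gt0 alpha_gt0))).
    lra.
  exists 0; last by rewrite expR0 M_const_ge1.
  by rewrite subr_le0; apply: profile_le_large => //; exact: large (ltnW N_n).
have n1 : 0 < 1 + n%:R :> R by rewrite ltr_pwDl.
apply: (@le_trans _ _ (expR v * 2 `^ (beta - 1))); last first.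
  by rewrite ler_wpM2r ?powR_ge0.
have powE (a t : R) : 0 < a -> a `^ t = expR (t * ln a).
  by move=> a0; rewrite /powR gt_eqF.
rewrite (powE _ beta n1) (powE 2) // /ratio_profile.
have -> : 5 = expR (ln 5) :> R by rewrite lnK ?posrE.
by rewrite -!expRD ler_expR; lra.
Qed.

End Constants.

(** * Quotients of uniform algebras *)

Section CubeSpace.
Variables (R : realType) (I : choiceType).

Definition cube : set (prod_topology (fun _ : I => R)) := [set f | forall i, -1 <= f i <= 1].

Lemma set_type_compact (T : topologicalType) (K : set T) :
  compact K -> compact [set: set_type K].
Proof.
move=> K_compact F F_proper _.
have [|p [Kp p_cluster]] := K_compact (set_val @ F) _.
  apply: (@filterS _ F _ setT) => [x _|]; [exact: set_valP | exact: filterT].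
exists (SigSub (mem_set Kp)); split=> // S B FS [_ [[W oW <-] /= Wp WB]].
have [_ [[s Ss <-] Ws]] : (set_val @` S) `&` W !=set0.
  apply: p_cluster; last exact: open_nbhs_nbhs.
  by apply: (@filterS _ F _ S) => // s Ss; exists s.
by exists s; split=> //; exact: WB.
Qed.

Lemma set_type_hausdorff (T : topologicalType) (K : set T) :
  hausdorff_space T -> hausdorff_space (set_type K).
Proof.
move=> T_haus x y xy.
suff e : set_val x = set_val y by exact: val_inj.
apply: T_haus => A B Ax By.
have pre (v : set_type K) (D : set T) : nbhs (set_val v) D ->
    nbhs v [set u : set_type K | D (set_val u)].
  exact: (@initial_continuous (set_type K) T set_val v).
by have [z [Az Bz]] := xy _ _ (pre _ _ Ax) (pre _ _ By); exists (set_val z).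
Qed.

Lemma cube_compact : compact [set: set_type cube].
Proof.
apply: set_type_compact.
have -> : cube = [set f : prod_topology (fun _ : I => R) | forall i, [set` `[-1, 1]%R] (f i)].
  by apply/seteqP; split=> f fP i; have := fP i; rewrite /= in_itv.
apply: (@tychonoff I (fun _ => R) (fun _ => [set` `[-1, 1]%R])) => i.
exact: segment_compact.
Qed.

Lemma cube_hausdorff : hausdorff_space (set_type cube).
Proof.
apply: set_type_hausdorff.
apply: (@hausdorff_product I (fun=> R)) => i; exact: Rhausdorff.
Qed.

Lemma cube_coord_continuous i : continuous (fun x : set_type cube => val x i : R).
Proof.
move=> x; apply: (@continuous_comp _ _ _ set_val (fun f : prod_topology (fun _ : I => R) => f i)).
  exact: initial_continuous.
exact: (@proj_continuous I (fun=> R) i).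
Qed.

End CubeSpace.

Section ComplexContinuity.
Variables (R : realType) (T : topologicalType).
Local Notation C := R[i].

Lemma continuous_Complex (f g : T -> R) : continuous f -> continuous g ->
  continuous (fun x => Complex (f x) (g x) : C^o).
Proof.
move=> f_cont g_cont x; apply/cvgrPdist_le => e e0.
have [e_re eE] : 0 < complex.Re e /\ e = (complex.Re e)%:C%C.
  move: e e0 => [a b]; rewrite ltcE /= => /andP[/eqP-> a0].
  by split.
have e2 : 0 < complex.Re e / 2 by rewrite divr_gt0.
have /cvgrPdist_le/(_ _ e2) f_near := f_cont x.
have /cvgrPdist_le/(_ _ e2) g_near := g_cont x.
near=> t; rewrite norm_normc eE lecR; apply: le_trans (normc_le_ReIm _) _ => /=.
have le1 : `|f x - f t| <= complex.Re e / 2 by near: t.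
have le2 : `|g x - g t| <= complex.Re e / 2 by near: t.
by rewrite [leRHS]splitr; apply: lerD.
Unshelve. all: by end_near.
Qed.

Lemma continuous_ccst (c : C) : continuous ((fun=> c) : T -> C^o).
Proof. by move=> x; exact: cvg_cst. Qed.

Lemma continuous_cadd (f g : T -> C) :
  continuous (f : T -> C^o) -> continuous (g : T -> C^o) ->
  continuous ((fun x => f x + g x) : T -> C^o).
Proof. by move=> fc gc x; apply: cvgD; [exact: fc | exact: gc]. Qed.

Lemma continuous_cmul (f g : T -> C) :
  continuous (f : T -> C^o) -> continuous (g : T -> C^o) ->
  continuous ((fun x => f x * g x) : T -> C^o).
Proof. by move=> fc gc x; apply: cvgM; [exact: fc | exact: gc]. Qed.

Lemma continuous_csum (J : Type) (r : seq J) (F : J -> T -> C) :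
  (forall j, continuous (F j : T -> C^o)) ->
  continuous ((fun x => \sum_(j <- r) F j x) : T -> C^o).
Proof.
move=> F_cont; elim: r => [|j r IHr].
  rewrite (_ : (fun x => _) = (fun=> 0 : C^o)); first by move=> x; exact: cvg_cst.
  by apply/funext => x; rewrite big_nil.
rewrite (_ : (fun x => _) = (fun x => (F j x : C^o) + \sum_(j <- r) F j x)).
  by move=> x; apply: cvgD; [exact: F_cont | exact: IHr].
by apply/funext => x; rewrite big_cons.
Qed.

Lemma continuous_cprod (J : Type) (r : seq J) (F : J -> T -> C) :
  (forall j, continuous (F j : T -> C^o)) ->
  continuous ((fun x => \prod_(j <- r) F j x) : T -> C^o).
Proof.
move=> F_cont; elim: r => [|j r IHr].
  rewrite (_ : (fun x => _) = (fun=> 1 : C^o)); first by move=> x; exact: cvg_cst.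
  by apply/funext => x; rewrite big_nil.
rewrite (_ : (fun x => _) = (fun x => (F j x : C^o) * \prod_(j <- r) F j x)).
  by move=> x; apply: cvgM; [exact: F_cont | exact: IHr].
by apply/funext => x; rewrite big_cons.
Qed.

End ComplexContinuity.

Section PolynomialLists.
Variables (R : realType) (I : eqType).
Local Notation C := R[i].
Implicit Types (r : seq (C * seq I)).

Definition poly_mul r r' : seq (C * seq I) :=
  [seq (t.1 * t'.1, t.2 ++ t'.2) | t <- r, t' <- r'].
Definition poly_scale (c : C) r : seq (C * seq I) :=
  [seq (c * t.1, t.2) | t <- r].

Lemma poly_lift_cat (B : lalgType C) (b : I -> B) r r' :
  poly_lift b (r ++ r') = poly_lift b r + poly_lift b r'.
Proof. exact: big_cat. Qed.

Lemma poly_lift_scale (B : lalgType C) (b : I -> B) c r :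
  poly_lift b (poly_scale c r) = c *: poly_lift b r.
Proof.
rewrite /poly_lift big_map scaler_sumr; apply: eq_bigr => t _ /=.
by rewrite scalerA.
Qed.

Lemma poly_lift_mul (B : algType C) (b : I -> B) r r' :
  poly_lift b (poly_mul r r') = poly_lift b r * poly_lift b r'.
Proof.
rewrite /poly_lift big_allpairs_dep mulr_suml; apply: eq_bigr => t _ /=.
rewrite mulr_sumr; apply: eq_bigr => t' _ /=.
by rewrite big_cat -scalerAl -scalerAr scalerA.
Qed.

Lemma poly_eval_lift r (z : I -> C) : poly_eval r z = poly_lift (z : I -> C^o) r.
Proof. by []. Qed.

Lemma poly_eval_cat r r' (z : I -> C) :
  poly_eval (r ++ r') z = poly_eval r z + poly_eval r' z.
Proof. exact: big_cat. Qed.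

Lemma poly_eval_scale c r (z : I -> C) :
  poly_eval (poly_scale c r) z = c * poly_eval r z.
Proof. exact: (poly_lift_scale (z : I -> C^o)). Qed.

Lemma poly_eval_mul r r' (z : I -> C) :
  poly_eval (poly_mul r r') z = poly_eval r z * poly_eval r' z.
Proof. exact: (poly_lift_mul (z : I -> C^o)). Qed.

Lemma poly_eval_bounded r (b : R) : 1 <= b -> exists k : R, forall z : I -> C,
  (forall i, normc (z i) <= b) -> normc (poly_eval r z) <= k.
Proof.
move=> b1; exists (\sum_(t <- r) normc t.1 * b ^+ size t.2) => z zb.
apply: le_trans (normc_sum _ _ _) _; apply: ler_sum => t _.
rewrite normcM ler_wpM2l ?normc_ge0 // normc_prod.
elim: (t.2) => [|i s IHs] /=; first by rewrite big_nil expr0.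
rewrite big_cons exprS ler_pM ?normc_ge0 ?prodr_ge0 // => j _.
exact: normc_ge0.
Qed.

End PolynomialLists.

(* Davie: if polynomials without constant term in elements of norm at most [d] are
   bounded by their supremum over the polydisc, then the polynomial calculus
   extends to the closure of the coordinate polynomials on a cube, and its
   kernel presents the algebra as a quotient of a uniform algebra. *)
Section QuotientOfUniformAlgebra.
Variables (R : realType) (G : groupType) (w : weight R G).
Local Notation C := R[i].
Local Notation A := (weighted_l1 w).
Variables (d k : R).
Hypothesis d_gt0 : 0 < d.

Definition l1_centre : set A := [set a | forall b, a * b = b * a].

(** Made total by the value 0 outside the ball of the centre, so that all of [A] can index the
    variables. *)
Definition generator (x : A) : A := if `[< l1_centre x /\ l1N x <= d >] then x else 0.

Hypothesis calculus_bound : forall (r : seq (C * seq A)) (nu : R),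
  (forall z, (forall i, normc (z i) <= 1) -> normc (poly_eval r z) <= nu) ->
  l1N (poly_lift generator r) <= k * nu.

Variables (X : topologicalType) (coordinate : X -> A -> C).
Hypothesis coordinate_continuous :
  forall x, continuous ((fun f => coordinate f x) : X -> C^o).
Hypothesis normc_coordinate : forall f x, normc (coordinate f x) <= 2.
Hypothesis coordinate_onto : forall z : A -> C, (forall x, normc (z x) <= 1) ->
  exists f, coordinate f = z.

(** The closure of the graph of the polynomial calculus: one polynomial has to approximate the
    function and the element at once. As a relation it is linear and multiplicative right away; it
    is single-valued by [calculus_bound] and total on its domain by completeness. *)
Definition calculus (u : X -> C) (a : A) : Prop :=
  continuous (u : X -> C^o) /\ forall e : R, 0 < e -> exists r,
    (forall f, normc (u f - poly_eval r (coordinate f)) <= e) /\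
    l1N (a - poly_lift generator r) <= e.

Definition calculus_domain : set (X -> C) :=
  [set u | continuous (u : X -> C^o) /\ forall e : R, 0 < e -> exists r,
    forall f, normc (u f - poly_eval r (coordinate f)) <= e].

Lemma calculus_in_domain u a : calculus u a -> calculus_domain u.
Proof.
by move=> [u_cont ua]; split=> // e /ua[r [ur _]]; exists r.
Qed.

Lemma calculus_bound_cube (r : seq (C * seq A)) (nu : R) :
  (forall f, normc (poly_eval r (coordinate f)) <= nu) ->
  l1N (poly_lift generator r) <= k * nu.
Proof.
by move=> r_le; apply: calculus_bound => z /coordinate_onto[f <-].
Qed.

Lemma generator_centre x : l1_centre (generator x).
Proof.
rewrite /generator; case: asboolP => [[]//|_] b; by rewrite mul0r mulr0.
Qed.

Lemma poly_lift_centre r : l1_centre (poly_lift generator r).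
Proof.
move=> b; rewrite /poly_lift mulr_suml mulr_sumr; apply: eq_bigr => t _.
rewrite -scalerAl -scalerAr; congr (_ *: _).
elim: t.2 => [|x s IHs]; first by rewrite big_nil mul1r mulr1.
by rewrite big_cons -mulrA IHs !mulrA generator_centre.
Qed.

Lemma l1_centre_closed a : (forall e : R, 0 < e -> exists b, l1_centre b /\ l1N (a - b) <= e) ->
  l1_centre a.
Proof.
move=> a_approx b; apply/subr0_eq.
apply: (@l1N_eq0_eps _ _ _ _ (2 * l1N b)) => e /a_approx[a' [a'_c le_e]].
rewrite (_ : a * b - b * a = (a - a') * b - b * (a - a')); last first.
  by rewrite mulrBl mulrBr a'_c opprB addrA subrK.
apply: le_trans (l1NB _ _) _.
have := l1NM (a - a') b; have := l1NM b (a - a').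
have := ler_wpM2l (l1N_ge0 b) le_e; lra.
Qed.

Lemma calculus_centre u a : calculus u a -> l1_centre a.
Proof.
move=> [_ ua]; apply: l1_centre_closed => e /ua[r [_ ar]].
by exists (poly_lift generator r); split=> //; exact: poly_lift_centre.
Qed.

Lemma calculus_domain_bounded u : calculus_domain u ->
  exists B : R, 0 <= B /\ forall f, normc (u f) <= B.
Proof.
move=> [_ /(_ 1 ltr01)[r ur]].
have [q qP] := poly_eval_bounded r (ler1n R 2).
exists (1 + `|q|); split; first by rewrite addr_ge0.
move=> f; rewrite -(subrK (poly_eval r (coordinate f)) (u f)).
apply: le_trans (normcD _ _) _; apply: lerD; first exact: ur.
by apply: le_trans (qP _ (normc_coordinate f)) (ler_norm _).
Qed.

Lemma poly_eval_continuous r :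
  continuous ((fun f => poly_eval r (coordinate f)) : X -> C^o).
Proof.
apply: (@continuous_csum R X _ r (fun t f =>
  t.1 * \prod_(i <- t.2) coordinate f i)) => t.
apply: continuous_cmul; first exact: continuous_ccst.
by apply: (@continuous_cprod R X _ t.2 (fun x f => coordinate f x)) => x;
  exact: coordinate_continuous.
Qed.

Lemma calculus_poly r :
  calculus (fun f => poly_eval r (coordinate f)) (poly_lift generator r).
Proof.
split; first exact: poly_eval_continuous.
move=> e e0; exists r; split=> [f|]; first by rewrite subrr normc0 ltW.
by rewrite subrr l1N0 ltW.
Qed.

Lemma calculusD u v a b : calculus u a -> calculus v b ->
  calculus (fun f => u f + v f) (a + b).
Proof.
move=> [u_cont ua] [v_cont vb]; split=> [|e e0].
  exact: continuous_cadd.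
have e2 : 0 < e / 2 by rewrite divr_gt0.
have [r [ur ar]] := ua _ e2; have [s [vs bs]] := vb _ e2.
exists (r ++ s); split=> [f|].
  rewrite poly_eval_cat opprD addrACA; apply: le_trans (normcD _ _) _.
  by have := ur f; have := vs f; lra.
rewrite poly_lift_cat opprD addrACA; apply: le_trans (l1ND _ _) _; lra.
Qed.

Lemma calculusZ c u a : calculus u a -> calculus (fun f => c * u f) (c *: a).
Proof.
move=> [u_cont ua]; split=> [|e e0].
  by apply: continuous_cmul; [exact: continuous_ccst | exact: u_cont].
have c1 : 0 < 1 + normc c by rewrite ltr_pwDl ?normc_ge0.
have e2 : 0 < e / (1 + normc c) by rewrite divr_gt0.
have c_le x : x <= e / (1 + normc c) -> 0 <= x -> normc c * x <= e.
  by rewrite ler_pdivlMr // => *; have := normc_ge0 c; nra.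
have [r [ur ar]] := ua _ e2; exists (poly_scale c r); split=> [f|].
  by rewrite poly_eval_scale -mulrBr normcM c_le ?normc_ge0.
by rewrite poly_lift_scale -scalerBr l1NZ c_le ?l1N_ge0.
Qed.

Lemma calculusB u v a b : calculus u a -> calculus v b ->
  calculus (fun f => u f - v f) (a - b).
Proof.
move=> ua vb; rewrite -[- b]scaleN1r.
rewrite (_ : (fun f => u f - v f) = fun f => u f + -1 * v f).
  exact: (calculusD ua (calculusZ (-1) vb)).
by apply/funext => f; rewrite mulN1r.
Qed.

Lemma calculus_norm_le u a (B : R) : 0 <= k -> calculus u a ->
  (forall f, normc (u f) <= B) -> l1N a <= k * B.
Proof.
move=> k0 [_ ua] uB; apply/ler_addgt0Pl => e e0.
have k1 : 0 < 1 + k by rewrite ltr_pwDl.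
have e2 : 0 < e / (1 + k) by rewrite divr_gt0.
have [r [ur ar]] := ua _ e2.
rewrite -(subrK (poly_lift generator r) a); apply: le_trans (l1ND _ _) _.
have := @calculus_bound_cube r (B + e / (1 + k)).
have /[swap] /[apply] : forall f, normc (poly_eval r (coordinate f)) <= B + e / (1 + k).
  move=> f; rewrite -(subrK (u f) (poly_eval r (coordinate f))).
  rewrite addrC; apply: le_trans (normcD _ _) _; apply: lerD => //.
  by rewrite -opprB normc_opp.
have eE : e = e / (1 + k) + k * (e / (1 + k)).
  by field; rewrite gt_eqF.
rewrite {-1}eE; lra.
Qed.

Lemma calculus_unique u a b : 0 <= k -> calculus u a -> calculus u b -> a = b.
Proof.
move=> k0 ua ub; apply/subr0_eq/l1N_eq0.
have := calculus_norm_le (B := 0) k0 (calculusB ua ub); rewrite mulr0; apply.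
by move=> f; rewrite subrr normc0.
Qed.

Lemma calculusM u v a b : calculus u a -> calculus v b ->
  calculus (fun f => u f * v f) (a * b).
Proof.
move=> ua vb.
have [B [B0 uB]] := calculus_domain_bounded (calculus_in_domain ua).
have [D [D0 vD]] := calculus_domain_bounded (calculus_in_domain vb).
case: ua => u_cont ua; case: vb => v_cont vb; split=> [|e e0].
  exact: continuous_cmul.
pose q := 2 + B + D + l1N a + l1N b.
have q0 : 0 < q by rewrite /q; have := l1N_ge0 a; have := l1N_ge0 b; lra.
pose e' := Num.min 1 (e / q).
have e'0 : 0 < e' by rewrite lt_min ltr01 divr_gt0.
have e'1 : e' <= 1 by rewrite ge_min lexx.
have e'q : e' * q <= e by rewrite -ler_pdivlMr // ge_min lexx orbT.
have [r [ur ar]] := ua _ e'0; have [s [vs bs]] := vb _ e'0.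
have mul_le (x y z t : R) : 0 <= x <= e' -> 0 <= y -> 0 <= z -> 0 <= t <= e' ->
    x * y + (z + x) * t <= e' * (1 + y + z).
  by move=> /andP[x0 xe] y0 z0 /andP[t0 te]; nra.
exists (poly_mul r s); split=> [f|].
  rewrite poly_eval_mul; have := ur f; have := vs f.
  set p := u f - _; set p' := v f - _ => le1 le2.
  rewrite (_ : _ - _ = p * v f + (u f - p) * p'); last by rewrite /p /p'; ring.
  apply: le_trans (normcD _ _) _; rewrite !normcM.
  apply: le_trans (lerD (lexx _) (ler_wpM2r (normc_ge0 p') (normcB (u f) p))) _.
  apply: le_trans (mul_le _ _ _ _ _ _ _ _) _; rewrite ?normc_ge0 //.
  apply: le_trans e'q; rewrite ler_wpM2l ?(ltW e'0) // /q.
  by have := uB f; have := vD f; have := l1N_ge0 a; have := l1N_ge0 b; lra.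
rewrite poly_lift_mul; move: ar bs.
set p := a - _; set p' := b - _ => le1 le2.
rewrite (_ : _ - _ = p * b + (a - p) * p'); last first.
  by rewrite subKr mulrBl mulrBr addrA subrK.
apply: le_trans (l1ND _ _) _.
apply: le_trans (lerD (l1NM _ _) (l1NM _ _)) _.
apply: le_trans (lerD (lexx _) (ler_wpM2r (l1N_ge0 p') (l1NB a p))) _.
apply: le_trans (mul_le _ _ _ _ _ _ _ _) _; rewrite ?l1N_ge0 //.
by apply: le_trans e'q; rewrite ler_wpM2l ?(ltW e'0) // /q; lra.
Qed.

(** Polynomials within 1/(n+1) of [u] give a Cauchy sequence in [A], by [calculus_bound_cube]; its
    limit is the value. *)
Lemma calculus_total u : 0 <= k -> calculus_domain u -> exists a, calculus u a.
Proof.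
move=> k0 [u_cont u_approx].
have pos n : 0 < n.+1%:R^-1 :> R by rewrite invr_gt0.
have /choice[r rP] : forall n, exists r, forall f,
    normc (u f - poly_eval r (coordinate f)) <= n.+1%:R^-1.
  by move=> n; exact: u_approx (pos n).
have dist m n : l1N (poly_lift generator (r m) - poly_lift generator (r n)) <=
    k * (m.+1%:R^-1 + n.+1%:R^-1).
  rewrite -[- poly_lift _ _]scaleN1r -poly_lift_scale -poly_lift_cat.
  apply: calculus_bound_cube => f; rewrite poly_eval_cat poly_eval_scale mulN1r.
  rewrite (_ : _ - _ = (u f - poly_eval (r n) (coordinate f)) -
    (u f - poly_eval (r m) (coordinate f))); last by ring.
  by apply: le_trans (normcB _ _) _; rewrite addrC lerD.
have small (e : R) : 0 < e -> exists K, forall n, (K <= n)%N -> n.+1%:R^-1 <= e.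
  move=> e0; have [K KP] : exists K, e^-1 < K%:R.
    by exists (Num.bound e^-1); apply: archi_boundP; rewrite invr_ge0 ltW.
  exists K => n Kn; rewrite invf_ple ?posrE // (le_trans (ltW KP)) //.
  by rewrite ler_nat ltnW.
have [|a aP] := @l1_complete _ _ w (fun n => poly_lift generator (r n)).
  move=> e e0; have k1 : 0 < 1 + 2 * k by rewrite ltr_pwDl // mulr_ge0.
  have [K KP] := small _ (divr_gt0 e0 k1); exists K => m n Km Kn.
  apply: le_trans (dist m n) _.
  apply: (@le_trans _ _ (k * (e / (1 + 2 * k) + e / (1 + 2 * k)))).
    by rewrite ler_wpM2l // lerD ?KP.
  have eE : e = e / (1 + 2 * k) + 2 * k * (e / (1 + 2 * k)).
    by field; rewrite gt_eqF.
  by have := divr_gt0 e0 k1; move: (e / _) eE => x eE x0; rewrite eE; lra.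
exists a; split=> // e e0.
have [K1 K1P] := small _ e0; have [K2 K2P] := aP _ e0.
exists (r (maxn K1 K2)); split=> [f|]; last by rewrite K2P ?leq_maxr.
by apply: le_trans (rP _ f) _; rewrite K1P ?leq_maxl.
Qed.

(** Scaled to norm exactly d, a central element is its own generator, so the coordinate that it
    indexes is sent to it. Scaling back, with coordinates of modulus at most 2, gives the factor 2 /
    d. *)
Lemma calculus_onto a : l1_centre a ->
  exists u, calculus u a /\ forall f, normc (u f) <= 2 / d * l1N a.
Proof.
move=> a_c; have [a0|a_neq0] := eqVneq (l1N a) 0.
  exists (fun f => poly_eval [::] (coordinate f)); split=> [|f].
    have -> : a = poly_lift generator [::].
      by rewrite /poly_lift big_nil; apply: l1N_eq0; rewrite a0.
    exact: calculus_poly.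
  by rewrite /poly_eval big_nil normc0 a0 mulr0.
have a_gt0 : 0 < l1N a by rewrite lt_def a_neq0 l1N_ge0.
pose c := d / l1N a; have c0 : 0 < c by rewrite divr_gt0.
pose x := c%:C%C *: a; have Nx : l1N x = d.
  by rewrite l1NZ normc_real gtr0_norm // divfK.
have x_gen : generator x = x.
  rewrite /generator; case: asboolP => // -[]; split; last by rewrite Nx.
  by move=> b; rewrite -scalerAl -scalerAr a_c.
exists (fun f => poly_eval [:: ((c^-1)%:C%C, [:: x])] (coordinate f)).
split=> [|f].
  have -> : a = poly_lift generator [:: ((c^-1)%:C%C, [:: x])].
    rewrite /poly_lift !big_seq1 /= x_gen scalerA -rmorphM mulVf ?gt_eqF //.
    by rewrite scale1r.
  exact: calculus_poly.
rewrite /poly_eval !big_seq1 /= normcM normc_real gtr0_norm ?invr_gt0 //.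
rewrite mulrC (_ : 2 / d * l1N a = 2 * c^-1).
  by rewrite ler_wpM2r ?normc_coordinate // invr_ge0 ltW.
by rewrite /c invf_div mulrAC mulrA.
Qed.

Hypothesis k_ge0 : 0 <= k.
Hypothesis X_compact : compact [set: X].
Hypothesis X_hausdorff : hausdorff_space X.
Hypothesis coordinate_separates : forall f g, (forall x, coordinate f x = coordinate g x) ->
  f = g.

Let ideal : set (X -> C) := [set u | calculus u 0].

Lemma calculus_domain_calculus u : calculus_domain u <-> exists a, calculus u a.
Proof.
by split=> [/(calculus_total k_ge0)//|[a /calculus_in_domain]].
Qed.

Lemma calculus_uniform_algebra : uniform_algebra calculus_domain.
Proof.
split=> //; split=> [u [] //|c|u v|v v_cont v_approx|f g fg].
- apply/calculus_domain_calculus; exists (poly_lift generator [:: (c, [::])]).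
  rewrite (_ : (fun=> c) = fun f => poly_eval [:: (c, [::])] (coordinate f)).
    exact: calculus_poly.
  by apply/funext => f; rewrite /poly_eval big_seq1 big_nil mulr1.
- move=> /calculus_domain_calculus[a ua] /calculus_domain_calculus[b vb].
  split; apply/calculus_domain_calculus; first by exists (a + b); exact: calculusD.
  by exists (a * b); exact: calculusM.
- split=> // e e0; have e2 : 0 < e / 2 by rewrite divr_gt0.
  have [u [_ /(_ _ e2)[r ur]] vu] := v_approx _ e2; exists r => f.
  rewrite -(subrK (u f) (v f)) -addrA; apply: le_trans (normcD _ _) _.
  by have := vu f; have := ur f; lra.
- have [x xP] : exists x, coordinate f x <> coordinate g x.
    apply: contrapT => /forallNP fgx; move/eqP: fg; apply.
    by apply: coordinate_separates => x; apply: contrapT; exact: fgx.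
  exists (fun h => poly_eval [:: (1, [:: x])] (coordinate h)).
    by apply/calculus_domain_calculus; eexists; exact: calculus_poly.
  by apply/eqP; rewrite /poly_eval !big_seq1 /= !mul1r.
Qed.

Lemma calculus_closed_ideal : closed_ideal calculus_domain ideal.
Proof.
split=> [u /calculus_in_domain //||u v u0 v0|u v|v [v_cont v_approx] v_lim].
- have := calculus_poly [::]; rewrite /poly_lift big_nil /ideal /=.
  rewrite (_ : (fun f => _) = fun=> 0); first exact.
  by apply/funext => f; rewrite /poly_eval big_nil.
- by rewrite /ideal /= -[0]addr0; exact: calculusD.
- move=> /calculus_domain_calculus[a ua] v0.
  by rewrite /ideal /= -(mulr0 a); exact: calculusM.
have [a va] : exists a, calculus v a by exact/calculus_domain_calculus.
suff a0 : a = 0 by rewrite /ideal /= -a0.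
apply: (@l1N_eq0_eps _ _ _ _ k) => e /v_lim[u u0 vu].
have := calculusB va u0; rewrite subr0 => /calculus_norm_le; exact.
Qed.

Lemma coset_calculus u a : calculus u a -> Defs.coset ideal u = [set v | calculus v a].
Proof.
move=> ua; apply/seteqP; split=> [_ [v v0 ->]|v va] /=.
  by rewrite -[a]addr0; exact: calculusD.
exists (fun f => v f - u f); last by apply/funext => f; rewrite addrC subrK.
by rewrite /ideal /= -(subrr a); exact: calculusB.
Qed.

Lemma na_centreP g : na_set (na_centre (l1_algebra w)) g <->
  exists a : A, l1_fun a = g /\ l1_centre a.
Proof.
split=> [[/= g_fin g_comm]|[a [<- a_c]]].
  have gl : g \in l1_set w by exact/asboolP.
  exists (WeightedL1 gl); split=> // b; apply: val_inj.
  by apply: g_comm; have /asboolP := l1P b.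
split=> [|h /= h_fin]; first by have /asboolP := l1P a.
have hl : h \in l1_set w by exact/asboolP.
exact: (congr1 (@l1_fun R G w) (a_c (WeightedL1 hl))).
Qed.

(** The isomorphism runs opposite to the calculus: it sends an element to the fibre over it, which
    is a coset of the kernel by [coset_calculus]. *)
Let presentation (g : G -> C) : set (X -> C) :=
  [set u | exists a : A, l1_fun a = g /\ calculus u a].

Let presentationE (a : A) : presentation (l1_fun a) = [set u | calculus u a].
Proof.
apply/seteqP; split=> [u [b [ba ub]]|u ua] /=; last by exists a.
by have <- : b = a by exact: val_inj.
Qed.

Lemma centre_isomorphic_to_Q_algebra :
  isomorphic_to_Q_algebra (na_centre (l1_algebra w)).
Proof.
exists X, calculus_domain, ideal; split.
- exact: calculus_uniform_algebra.
- exact: calculus_closed_ideal.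
exists presentation; split.
- split=> [_ /na_centreP[a [<- a_c]]|g h|P [u /calculus_domain_calculus[a ua] <-]].
  + rewrite presentationE; have [u [ua _]] := calculus_onto a_c.
    exists u; last exact: coset_calculus.
    exact: calculus_in_domain ua.
  + move=> /set_mem/na_centreP[a [<- a_c]] /set_mem/na_centreP[b [<- b_c]].
    rewrite !presentationE => ab; have [u [ua _]] := calculus_onto a_c.
    have ub : calculus u b by have : [set u | calculus u a] u by []; rewrite ab.
    by rewrite (calculus_unique k_ge0 ua ub).
  + exists (l1_fun a); first by apply/na_centreP; exists a; split=> //;
      exact: calculus_centre ua.
    by rewrite presentationE (coset_calculus ua).
- move=> _ _ /na_centreP[a [<- a_c]] /na_centreP[b [<- b_c]].
  rewrite -[na_add _ _]/(l1_fun (a + b)) !presentationE.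
  apply/seteqP; split=> [u uab|_ [p [q [pa qb ->]]]] /=; last first.
    exact: (calculusD pa qb).
  (* Only [a] is lifted; the difference from [u] then lies over [b], so the sums of representatives
     fill the whole fibre. *)
  have [p [pa _]] := calculus_onto a_c; exists p, (fun f => u f - p f).
  have := calculusB uab pa; rewrite addrC addKr => qb.
  by split; [exact: pa | exact: qb | apply/funext => f; rewrite addrC subrK].
- move=> c _ /na_centreP[a [<- a_c]].
  rewrite -[na_scale _ _]/(l1_fun (c *: a)) !presentationE.
  apply/seteqP; split=> [u uca|_ [p [v [pa v0 ->]]]] /=; last first.
    by rewrite -[c *: a]addr0; exact: (calculusD (calculusZ c pa) v0).
  have [p [pa _]] := calculus_onto a_c; exists p, (fun f => u f - c * p f).
  have := calculusB uca (calculusZ c pa); rewrite subrr => v0.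
  by split; [exact: pa | exact: v0 | apply/funext => f; rewrite addrC subrK].
- move=> _ _ /na_centreP[a [<- a_c]] /na_centreP[b [<- b_c]].
  rewrite -[na_mul _ _]/(l1_fun (a * b)) !presentationE.
  apply/seteqP; split=> [u uab|_ [p [q [v [pa qb v0 ->]]]]] /=; last first.
    by rewrite -[a * b]addr0; exact: (calculusD (calculusM pa qb) v0).
  have [p [pa _]] := calculus_onto a_c; have [q [qb _]] := calculus_onto b_c.
  exists p, q, (fun f => u f - p f * q f).
  have := calculusB uab (calculusM pa qb); rewrite subrr => v0.
  split; [exact: pa | exact: qb | exact: v0 |].
  by apply/funext => f; rewrite addrC subrK.
have k1 : 0 < 1 + k by rewrite ltr_pwDl.
have d2 : 0 < 2 / d by rewrite divr_gt0.
(* Every representative obeys [calculus_norm_le], which gives the lower constant; the one from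
   [calculus_onto] gives the upper. [1 + k] stands for [k] in order to be invertible. *)
exists (1 + k)^-1, (2 / d + 1); split; [by rewrite invr_gt0 | by rewrite addr_gt0 |].
move=> _ /na_centreP[a [<- a_c]]; rewrite presentationE /=.
rewrite -[fine _]/(l1N a).
have [u [ua u_le]] := calculus_onto a_c.
have [x0 _] : exists f, coordinate f = fun=> 0.
  by apply: coordinate_onto => x; rewrite normc0.
have sup_le (p : X -> C) (B : R) : (forall f, normc (p f) <= B) -> sup_norm p <= B.
  move=> pB; apply: ge_sup => [|_ [x _ <-]]; last exact: pB.
  by exists (normc (p x0)), x0.
have le_sup p : calculus p a -> forall f, normc (p f) <= sup_norm p.
  move=> /calculus_in_domain/calculus_domain_bounded[B [_ pB]] f.
  apply: ub_le_sup; last by exists f.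
  by exists B => _ [x _ <-].
have sup_ge0 p : calculus p a -> 0 <= sup_norm p.
  by move=> pa; apply: le_trans (le_sup p pa x0); exact: normc_ge0.
have lower p : calculus p a -> (1 + k)^-1 * l1N a <= sup_norm p.
  move=> pa; rewrite ler_pdivrMl //.
  apply: le_trans (calculus_norm_le k_ge0 pa (le_sup p pa)) _.
  by rewrite mulrDl mul1r lerDr sup_ge0.
apply/andP; split.
  apply: lb_le_inf; first by exists (sup_norm u), u.
  by move=> _ [p pa <-]; exact: lower.
apply: (@le_trans _ _ (sup_norm u)).
  apply: ge_inf; last by exists u.
  by exists ((1 + k)^-1 * l1N a) => _ [p pa <-]; exact: lower.
apply: (@le_trans _ _ (2 / d * l1N a)).
  exact: sup_le.
by rewrite ler_wpM2r ?l1N_ge0 // lerDl.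
Qed.

End QuotientOfUniformAlgebra.

(** * Growth series and the radius delta *)

Section SphereSums.
Variables (R : realType) (G : groupType) (F : set G) (f : {poly R}) (lambda : R).
Hypothesis F_gen : symmetric_generating_set F.
Hypothesis f_growth :
  forall n : nat, lambda * f.[n%:R] <= (ball_size F n)%:R <= f.[n%:R].

Lemma sphere_size_ge0 n : 0 <= sphere_size F R n.
Proof.
rewrite subr_ge0 ler_nat; apply: fsubset_leq_card; apply/fsubsetP => x.
by rewrite !in_ball_fset // => /leq_trans; apply; exact: leq_pred.
Qed.

Lemma sphere_size_le n :
  sphere_size F R n <= f.[n%:R] - lambda * f.[n.-1%:R].
Proof.
have /andP[_ le1] := f_growth n; have /andP[le2 _] := f_growth n.-1.
exact: lerB.
Qed.

Lemma horner_le_pow n : (0 < n)%N ->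
  f.[n%:R] <= (\sum_(i < size f) `|f`_i|) * n%:R ^+ size f.
Proof.
move=> n0; rewrite horner_coef mulr_suml; apply: ler_sum => i _.
apply: le_trans (ler_norm _) _; rewrite normrM normrX normr_nat.
by rewrite ler_wpM2l // ler_weXn2l ?ler1n // ltnW.
Qed.

End SphereSums.

Lemma sum_inv_sqr_le (R : realType) (N : nat) :
  \sum_(1 <= n < N.+1) (n%:R ^+ 2)^-1 <= 2 :> R.
Proof.
case: N => [|N]; first by rewrite big_geq.
suff : \sum_(1 <= n < N.+2) (n%:R ^+ 2)^-1 <= 2 - (N.+1%:R)^-1 :> R.
  by move/le_trans; apply; rewrite gerBl.
elim: N => [|N IHN]; first by rewrite big_nat1 expr1n invr1; lra.
rewrite big_nat_recr //=; apply: le_trans (lerD IHN (lexx _)) _.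
have N1 : 0 < N.+1%:R :> R by rewrite ltr0n.
rewrite -[N.+2%:R]natr1; move: N1; move: (N.+1%:R : R) => x x0.
have x1 : 0 < x + 1 by rewrite addr_gt0.
rewrite -addrA lerD2l -subr_ge0.
have -> : - (x + 1)^-1 - (- x^-1 + ((x + 1) ^+ 2)^-1) = (x * (x + 1) ^+ 2)^-1.
  by field; rewrite !gt_eqF.
by rewrite invr_ge0 mulr_ge0 ?sqr_ge0 ?ltW.
Qed.

Section SphereSeries.
Variables (R : realType) (G : groupType) (F : set G) (f : {poly R}) (alpha C : R).
Hypothesis F_gen : symmetric_generating_set F.
Hypothesis alpha01 : 0 < alpha < 1.
Hypothesis C_gt0 : 0 < C.
Hypothesis f_growth : growth_bound F f.

(** The exponential series gives exp x >= x^(p+1) / (p+1)!, with p so large that alpha (p + 1) >=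
    s. *)
Lemma ratio_profile_sqr_le (s : nat) : exists2 B : R, 0 <= B &
  forall n, (0 < n)%N -> n%:R ^+ s * ratio_profile alpha C n ^+ 2 <= B.
Proof.
have /andP[a0 a1] := alpha01.
set c := 2 * (C * (1 - alpha)).
have c0 : 0 < c by rewrite !mulr_gt0 // subr_gt0.
set p := (Num.truncn (s%:R / alpha)).
have sp : s%:R <= alpha * p.+1%:R.
  rewrite mulrC -ler_pdivrMr //; apply: ltW.
  by rewrite /p -(@truncn_lt_nat R) // divr_ge0 // ltW.
exists (p.+1`!%:R / c ^+ p.+1) => [|n n0].
  by rewrite divr_ge0 ?exprn_ge0 // ltW.
have n_gt0 : 0 < n%:R :> R by rewrite ltr0n.
set x := c * n%:R `^ alpha.
have x0 : 0 < x by rewrite mulr_gt0 ?powR_gt0.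
have -> : ratio_profile alpha C n ^+ 2 = (expR x)^-1.
  rewrite /ratio_profile -expRM_natr -expRN; congr expR.
  by rewrite /x /c; ring.
rewrite ler_pdivrMr ?expR_gt0 //.
have exp_ge : x ^+ p.+1 / p.+1`!%:R <= expR x.
  by apply: le_trans (expR_ge1Dxn p (ltW x0)); rewrite lerDr.
have fact_gt0 : 0 < p.+1`!%:R :> R by rewrite ltr0n fact_gt0.
apply: (@le_trans _ _ (p.+1`!%:R / c ^+ p.+1 * (x ^+ p.+1 / p.+1`!%:R))); last first.
  by rewrite ler_wpM2l // divr_ge0 ?exprn_ge0 // ltW.
have -> : p.+1`!%:R / c ^+ p.+1 * (x ^+ p.+1 / p.+1`!%:R) = (n%:R `^ alpha) ^+ p.+1.
  have cancel (a b u : R) : a != 0 -> b != 0 -> a / b * (b * u / a) = u.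
    by move=> ? ?; field; apply/andP.
  rewrite (_ : x ^+ p.+1 = c ^+ p.+1 * (n%:R `^ alpha) ^+ p.+1) ; last by rewrite -exprMn.
  by rewrite cancel // ?expf_neq0 ?gt_eqF.
rewrite -[_ ^+ p.+1]powR_mulrn ?powR_ge0 // -powRrM -powR_mulrn ?(ltW n_gt0) //.
by apply: ler_powR; rewrite ?ler1n.
Qed.

(** Spheres grow at most like n^(size f), so decay of order [size f] + 2 leaves a multiple of n^-2.
    As beta does not enter, the bound holds even when [growth_series] diverges. *)
Lemma sphere_sum_bounded : exists2 B : R, 0 <= B & forall N,
  \sum_(1 <= n < N.+1) sphere_size F R n * ratio_profile alpha C n ^+ 2 <= B.
Proof.
have [B B0 B_le] := ratio_profile_sqr_le (size f).+2.
pose A := \sum_(i < size f) `|f`_i|; have A0 : 0 <= A by exact: sumr_ge0.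
exists (A * B * 2) => [|N]; first by rewrite !mulr_ge0.
apply: (@le_trans _ _ (\sum_(1 <= n < N.+1) A * B * (n%:R ^+ 2)^-1)); last first.
  rewrite -mulr_sumr; apply: ler_wpM2l; last exact: sum_inv_sqr_le.
  exact: mulr_ge0.
rewrite !big_nat; apply: ler_sum => n /andP[n0 _].
have n_gt0 : 0 < n%:R :> R by rewrite ltr0n.
rewrite ler_pdivlMr ?exprn_gt0 //.
have le1 : sphere_size F R n <= A * n%:R ^+ size f.
  apply: le_trans (horner_le_pow f n0); apply: le_trans (f_growth n).
  by rewrite gerBl.
apply: (@le_trans _ _ (A * n%:R ^+ size f * ratio_profile alpha C n ^+ 2 * n%:R ^+ 2)).
  by do 2 (apply: ler_wpM2r; first exact: sqr_ge0).
have -> : A * n%:R ^+ size f * ratio_profile alpha C n ^+ 2 * n%:R ^+ 2 =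
    A * (n%:R ^+ (size f).+2 * ratio_profile alpha C n ^+ 2).
  by rewrite -[(size f).+2]addn2 exprD; ring.
by rewrite ler_wpM2l // B_le.
Qed.

Lemma exp_weight_multiplier_exists :
  exists2 D : R, 0 <= D &
    ratio_multiplier_bound (exp_weight_weight F_gen alpha01 C_gt0) D.
Proof.
have [B B0 B_le] := sphere_sum_bounded.
exists (3 / 2 + 2 * (Grothendieck_constant R * Num.sqrt B)).
  have := Grothendieck_constant_ge1 R; have := sqrtr_ge0 B.
  by move=> ? ?; rewrite addr_ge0 ?mulr_ge0 ?divr_ge0 //; lra.
by apply: exp_weight_multiplier => [|N]; rewrite ?sqrtr_ge0 // sqr_sqrtr.
Qed.

End SphereSeries.

Section VonNeumannRadius.
Variables (R : realType) (G : groupType) (F : set G) (d : nat) (f : {poly R}).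
Variables (lambda alpha C : R).
Hypothesis F_gen : symmetric_generating_set F.
Hypothesis f_growth :
  forall n : nat, lambda * f.[n%:R] <= (ball_size F n)%:R <= f.[n%:R].
Hypothesis alpha01 : 0 < alpha < 1.
Hypothesis C_gt0 : 0 < C.
Let beta := beta_const d lambda alpha C.
Let K := Grothendieck_constant R.
Let mu := M_const alpha C beta * 2 `^ (beta - 1).

Let X_ge1 : 1 <= K * mu.
Proof.
have b1 : 1 <= beta by exact: beta_ge1.
have pow1 : 1 <= 2 `^ (beta - 1) :> R 
    by rewrite -[leLHS](powRr0 (2 : R)) ler_powR ?subr_ge0 ?ler1n.
have M1 : 1 <= M_const alpha C beta by exact: M_const_ge1.
apply: mulr_ege1; first exact: Grothendieck_constant_ge1.
exact: mulr_ege1.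
Qed.

Let mu_ge0 : 0 <= mu.
Proof.
have M1 : 1 <= M_const alpha C beta by exact: M_const_ge1.
by rewrite mulr_ge0 ?powR_ge0 // (le_trans _ M1).
Qed.

Let term n := (f.[n%:R] - lambda * f.[n.-1%:R]) / (1 + n%:R) `^ (2 * beta).

Let term_ge0 n : 0 <= term n.
Proof.
rewrite divr_ge0 ?powR_ge0 //.
by apply: le_trans (sphere_size_le f_growth n); exact: sphere_size_ge0.
Qed.

(** By [profile_M_bound], q(n)^2 <= (mu / 5)^2 (1 + n)^(- 2 beta), and the sphere sizes are at most
    the numerators of the series; so Q = (mu / 5) sqrt s is admissible. *)
Lemma growth_series_multiplier (s : R) : growth_series f lambda beta = s%:E ->
  0 <= s /\ ratio_multiplier_bound (exp_weight_weight F_gen alpha01 C_gt0)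
    (3 / 2 + 2 * (K * (mu / 5 * Num.sqrt s))).
Proof.
move=> sE.
have partial N : \sum_(1 <= n < N.+1) term n <= s.
  rewrite -lee_fin -sE -sumEFin.
  by apply: nneseries_lim_ge => n _ _; rewrite lee_fin.
have s0 : 0 <= s by have := partial 0%N; rewrite big_geq.
split=> //; apply: exp_weight_multiplier => [|N].
  by rewrite mulr_ge0 ?sqrtr_ge0 // divr_ge0.
rewrite exprMn sqr_sqrtr //.
apply: le_trans (ler_wpM2l (sqr_ge0 (mu / 5)) (partial N)).
rewrite mulr_sumr !big_nat; apply: ler_sum => n /andP[n0 _].
have P0 : 0 < (1 + n%:R) `^ beta :> R by rewrite powR_gt0 // ltr_pwDl.
have q_le : ratio_profile alpha C n <= mu / 5 / (1 + n%:R) `^ beta.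
  rewrite ler_pdivlMr // ler_pdivlMr // mulrC mulrA.
  exact: (profile_M_bound d lambda alpha01 C_gt0 n0).
have -> : (mu / 5) ^+ 2 * term n = (f.[n%:R] - lambda * f.[n.-1%:R]) *
    (mu / 5 / (1 + n%:R) `^ beta) ^+ 2.
  rewrite /term [2 * beta]mulrC powRrM -[2]/(2%:R) powR_mulrn ?powR_ge0 //.
  by rewrite [in RHS]exprMn exprVn [RHS]mulrCA mulrA.
apply: ler_pM; [exact: sphere_size_ge0 | exact: sqr_ge0 | exact: sphere_size_le |].
by apply: lerXn2r; rewrite ?nnegrE ?expR_ge0 // !divr_ge0 ?powR_ge0.
Qed.

(** The 2/5 is the 2 of the multiplier bound over the 5 of [profile_M_bound]. With u = sqrt s, the
    left side divided by e exceeds 1 + 2/5 x u by at most 2/5 + 1/2 = 9/10; as x >= 1, it is enough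
    that sqrt (1 + u^2) >= 9/10 + 2/5 u. *)
Lemma radius_estimate (e x s : R) : 5 / 2 <= e -> 1 <= x -> 0 <= s ->
  1 + e * (3 / 2 + 2 / 5 * x * Num.sqrt s) <= e * (1 + x * Num.sqrt (1 + s)).
Proof.
move=> e_ge x1 s0; set u := Num.sqrt s; set v := Num.sqrt (1 + s).
have u0 : 0 <= u by exact: sqrtr_ge0.
have v0 : 0 <= v by exact: sqrtr_ge0.
have v_sqr : v ^+ 2 = 1 + u ^+ 2 by rewrite !sqr_sqrtr // addr_ge0.
have v_ge : 9 / 10 + 2 / 5 * u <= v.
  rewrite -[leRHS]ger0_norm // -sqrtr_sqr -[leLHS]ger0_norm; last by lra.
  rewrite -sqrtr_sqr ler_wsqrtr // v_sqr.
  (* 3/7 is the vertex of the quadratic polynomial left after squaring. *)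
  by have := sqr_ge0 (u - 3 / 7); lra.
have e0 : 0 <= e by lra.
have h1 : 9 / 10 <= x * (v - 2 / 5 * u).
  by rewrite -[leLHS]mul1r ler_pM //; lra.
have := ler_wpM2l e0 h1; lra.
Qed.

Lemma delta_const_multiplier : exists D : R,
  [/\ 0 <= D, ratio_multiplier_bound (exp_weight_weight F_gen alpha01 C_gt0) D,
      0 <= delta_const d f lambda alpha C
    & delta_const d f lambda alpha C * (1 + expR 1 * D) <= 1].
Proof.
have X0 : 0 < K * mu by exact: lt_le_trans X_ge1.
have series_ge0 : (0 <= growth_series f lambda beta)%E.
  by rewrite /growth_series; apply: nneseries_ge0 => n _ _; rewrite lee_fin; exact: term_ge0.
rewrite /delta_const -/beta -/K -[K * _ * _]mulrA -/mu.
case sE : (growth_series f lambda beta) series_ge0 => [s| |] // _.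
  have [s0 mult] := growth_series_multiplier sE.
  exists (3 / 2 + 2 * (K * (mu / 5 * Num.sqrt s))).
  have K0 : 0 <= K by apply: le_trans (Grothendieck_constant_ge1 R).
  have D0 : 0 <= 3 / 2 + 2 * (K * (mu / 5 * Num.sqrt s)).
    have : 0 <= K * (mu / 5 * Num.sqrt s).
      by apply: mulr_ge0 => //; rewrite mulr_ge0 ?sqrtr_ge0 // divr_ge0.
    by move=> ?; lra.
  have v0 : 0 <= K * mu * Num.sqrt (1 + s) by rewrite mulr_ge0 ?sqrtr_ge0 ?(ltW X0).
  have E0 : 0 < expR 1 * (1 + K * mu * Num.sqrt (1 + s)).
    by rewrite mulr_gt0 ?expR_gt0 // ltr_pwDl.
  have -> : fine ((expR 1)^-1%:E * (1 + (K * mu)%:E * sqrte (1 + s%:E))^-1)%E =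
      (expR 1 * (1 + K * mu * Num.sqrt (1 + s)))^-1.
    rewrite -[sqrte _]/(Num.sqrt (1 + s))%:E -EFinM -EFinD inver.
    by rewrite gt_eqF ?ltr_pwDl //= invfM.
  split=> //; first by rewrite invr_ge0 ltW.
  rewrite ler_pdivrMl // mulr1.
  have -> : 3 / 2 + 2 * (K * (mu / 5 * Num.sqrt s)) =
    3 / 2 + 2 / 5 * (K * mu) * Num.sqrt s by field.
  exact: radius_estimate (expR1_ge R) X_ge1 s0.
(* The series diverges and [delta_const] is 0; a finite D is still supplied, for the presentation as
   a quotient. *)
have [D D0 mult] := exp_weight_multiplier_exists F_gen alpha01 C_gt0
  (fun n => proj2 (andP (f_growth n))).
have -> : fine ((expR 1)^-1%:E * (1 + (K * mu)%:E * sqrte (1 + +oo))^-1)%E = 0.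
  by rewrite addey // /= gt0_muley ?lte_fin // addey //= mulr0.
by exists D; rewrite mul0r.
Qed.

End VonNeumannRadius.

(* mpoly is not imported, so its instances are inactive. *)
#[local] Canonical mpoly.mpoly_multinom__canonical__eqtype_Equality.

(** * Multivariate polynomials as lists of words *)

Section PolynomialsWithoutConstantTerm.
Variables (R : realType) (n : nat).
Local Notation C := R[i].

Definition monomial_word (m : mpoly.multinom n) : seq 'I_n :=
  flatten [seq nseq (mpoly.fun_of_multinom m i) i | i <- enum 'I_n].

Definition poly_words (P : mpoly.mpoly n C) : seq (C * seq 'I_n) :=
  [seq (mpoly.mcoeff m P, monomial_word m) | m <- mpoly.msupp P].

Lemma monomial_word_eq0 m : monomial_word m = [::] -> m = mpoly.mnm0 (n:=n).
Proof.
move=> m0; apply/mpoly.mnmP => i; rewrite mpoly.mnm0E; apply/eqP/contraT => mi.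
have : i \in monomial_word m.
  apply/flattenP; exists (nseq (mpoly.fun_of_multinom m i) i).
    by apply/mapP; exists i; rewrite ?mem_enum.
  by rewrite mem_nseq lt0n mi eqxx.
by rewrite m0.
Qed.

Lemma poly_words_eval P (z : 'I_n -> C) :
  poly_eval (poly_words P) z = mpoly.meval z P.
Proof.
rewrite mpoly.mevalE /poly_eval /poly_words big_map; apply: eq_bigr => m _ /=.
congr (_ * _); rewrite big_flatten big_map big_enum /=; apply: eq_bigr => i _.
by rewrite big_nseq iter_mulr_1.
Qed.

Lemma poly_words_size P : mpoly.mcoeff (mpoly.mnm0 (n:=n)) P = 0 ->
  all (fun t => (0 < size t.2)%N) (poly_words P).
Proof.
move=> P0; rewrite all_map; apply/allP => m mP /=.
rewrite lt0n size_eq0; apply: contraTneq mP => /monomial_word_eq0->.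
by rewrite mpoly.mcoeff_msupp P0 eqxx.
Qed.

(** Boundedness on the polydisc makes the supremum in [polydisc_norm] a genuine upper bound. *)
Lemma meval_le_polydisc_norm P (z : 'I_n -> C) : (forall i, normc (z i) <= 1) ->
  normc (mpoly.meval z P) <= polydisc_norm P.
Proof.
move=> z1; have [k kP] := poly_eval_bounded (poly_words P) (lexx (1 : R)).
apply: ub_le_sup; last by exists z.
by exists k => _ [y y1 <-]; rewrite -poly_words_eval; exact: kP.
Qed.

Variables (G : groupType) (w : weight R G).
Local Notation A := (weighted_l1 w).
Local Notation Z := (na_centre (l1_algebra w)).

Lemma foldl_convolution (x : A) (s : seq A) :
  foldl (@convolution R G) x [seq l1_fun y | y <- s] =
  l1_fun (x * \prod_(y <- s) y).
Proof.
elim: s x => [|y s IHs] x; first by rewrite big_nil mulr1.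
by rewrite big_cons mulrA -IHs.
Qed.

(** Without constant term no word is empty, so the default [na_zero] of [na_monomial] is never
    taken, and the left-nested products are products in the unital algebra. *)
Lemma na_eval_l1 P (a : 'I_n -> A) : mpoly.mcoeff (mpoly.mnm0 (n:=n)) P = 0 ->
  na_eval P ((fun i => l1_fun (a i)) : 'I_n -> na_sort Z) =
  l1_fun (poly_lift a (poly_words P)).
Proof.
move=> P0; have := poly_words_size P0.
rewrite /na_eval /poly_lift /poly_words => /allP words.
have {}words m : m \in mpoly.msupp P -> monomial_word m != [::].
  move=> mP; rewrite -size_eq0 -lt0n.
  exact: (words (mpoly.mcoeff m P, _) (map_f _ mP)).
elim: (mpoly.msupp P) words => [|m s IHs] words.
  by rewrite !big_nil.
rewrite big_cons [map _ (_ :: _)]/= [in RHS]big_cons IHs; last first.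
  by move=> m' m's; apply: words; rewrite inE m's orbT.
rewrite -[RHS]/(na_add (A := Z) (l1_fun _) (l1_fun _)).
congr (na_add (A := Z) _ _).
rewrite -[RHS]/(na_scale (A := Z) _ (l1_fun _)).
congr (na_scale (A := Z) _ _).
rewrite /na_monomial /=.
have -> : flatten [seq nseq (mpoly.fun_of_multinom m i) (l1_fun (a i)) | i <- enum 'I_n] =
    [seq l1_fun y | y <- [seq a i | i <- monomial_word m]].
  rewrite -map_comp /monomial_word map_flatten -map_comp; congr flatten.
  by apply: eq_map => i; rewrite /= map_nseq.
have := words m (mem_head _ _); case: (monomial_word m) => // i t _ /=.
by rewrite big_cons (foldl_convolution (a i)) big_map.
Qed.

End PolynomialsWithoutConstantTerm.

(** * Both conclusions for the centre *)

Section Centre.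
Variables (R : realType) (G : groupType) (w : weight R G) (D : R).
Hypothesis D_ge0 : 0 <= D.
Hypothesis D_mult : ratio_multiplier_bound w D.
Local Notation C := R[i].
Local Notation A := (weighted_l1 w).
Local Notation Z := (na_centre (l1_algebra w)).

Lemma von_Neumann_centre (delta : R) : 0 <= delta ->
  delta * (1 + expR 1 * D) <= 1 -> von_Neumann Z delta 1.
Proof.
move=> delta0 delta_le n g gP P P0.
have /choice[a aP] i : exists a : A, l1_fun a = g i /\ l1_centre a.
  by apply/na_centreP; case: (gP i).
have -> : g = fun i => l1_fun (a i) by apply/funext => i; case: (aP i).
rewrite na_eval_l1 // mul1r; apply: (@poly_lift_bound _ _ w _ a delta D) => //.
- by move=> i j; case: (aP i) => _; apply.
- by move=> i; case: (gP i) => _; case: (aP i) => <-.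
- exact: poly_words_size.
by move=> z z1; rewrite poly_words_eval; exact: meval_le_polydisc_norm.
Qed.

(** The largest radius that [poly_lift_bound] admits; unlike delta, it is always positive. *)
Let d : R := (1 + expR 1 * D)^-1.

Let denominator_gt0 : 0 < 1 + expR 1 * D.
Proof. by rewrite ltr_pwDl // mulr_ge0 ?expR_ge0. Qed.

Let d_gt0 : 0 < d. Proof. by rewrite invr_gt0. Qed.

Lemma l1N_generator (x : A) : l1N (generator d x) <= d.
Proof. by rewrite /generator; case: asboolP => [[]//|_]; rewrite l1N0 ltW. Qed.

(** A uniform algebra contains the constants, which the von Neumann inequality excludes. The
    constant term is the value at 0, hence at most [nu]; the rest is then at most 2 [nu] on the
    polydisc. *)
Lemma poly_lift_generator_bound (r : seq (C * seq A)) (nu : R) :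
  (forall z, (forall i, normc (z i) <= 1) -> normc (poly_eval r z) <= nu) ->
  l1N (poly_lift (generator d) r) <= (l1N (1 : A) + 2) * nu.
Proof.
move=> r_le; pose c := \sum_(t <- r | (size t.2 == 0)%N) t.1.
pose r' := [seq t <- r | (0 < size t.2)%N].
have liftE (B : lalgType C) (b : A -> B) : poly_lift b r = c *: 1 + poly_lift b r'.
  rewrite /poly_lift big_filter (bigID (fun t => size t.2 == 0%N)) /=.
  congr (_ + _); last by apply: eq_bigl => t; rewrite lt0n.
  rewrite scaler_suml; apply: eq_bigr => -[t [|//]] _ /=.
  by rewrite big_nil.
have evalE z : poly_eval r z = c + poly_eval r' z.
  by rewrite (poly_eval_lift r) liftE /GRing.scale /= mulr1.
have c_le : normc c <= nu.
  have := r_le (fun=> 0); rewrite evalE /poly_eval big_filter big1 ?addr0.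
    by apply=> i; rewrite normc0.
  by move=> [t [|i s]] //= _; rewrite big_cons mul0r mulr0.
rewrite liftE; apply: le_trans (l1ND _ _) _.
rewrite l1NZ mulrDl mulrC; apply: lerD.
  by rewrite ler_wpM2l ?l1N_ge0.
apply: (@poly_lift_bound _ _ w _ (generator d) d D) => //.
- by move=> i j; exact: generator_centre.
- exact: l1N_generator.
- exact: ltW.
- by rewrite mulVf ?gt_eqF.
- by apply/allP => t; rewrite mem_filter => /andP[].
move=> z z1; rewrite (_ : poly_eval r' z = poly_eval r z - c).
  apply: le_trans (normcB _ _) _; have := r_le z z1; lra.
by rewrite evalE addrC addKr.
Qed.

(** Two real coordinates form a complex one: the square [-1, 1]^2 contains the unit disc and lies in
    the disc of radius 2, and a real cube is compact by Tychonoff's theorem. *)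
Let coordinate (x : set_type (@cube R (A * bool)%type)) (b : A) : C :=
  Complex (val x (b, false)) (val x (b, true)).

Lemma Q_algebra_centre : isomorphic_to_Q_algebra Z.
Proof.
apply: (@centre_isomorphic_to_Q_algebra _ _ w d _ d_gt0 poly_lift_generator_bound
  (set_type (@cube R (A * bool)%type)) coordinate).
- move=> b; apply: continuous_Complex; exact: cube_coord_continuous.
- move=> x b; apply: le_trans (normc_le_ReIm _) _ => /=.
  have x1 i : `|val x i| <= 1 by rewrite ler_norml; exact: (set_valP x i).
  by have := x1 (b, false); have := x1 (b, true); lra.
- move=> z z1.
  pose v : prod_topology (fun _ : A * bool => R) := fun i =>
    if i.2 then complex.Im (z i.1) else complex.Re (z i.1).
  have v_cube : v \in @cube R (A * bool)%type.
    apply/mem_set => -[b s]; rewrite -ler_norml /v /=.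
    by apply: le_trans (z1 b); case: s; [exact: normc_Im | exact: normc_Re].
  exists (SigSub v_cube); apply/funext => b.
  by rewrite /coordinate /= /v /=; case: (z b).
- by rewrite addr_ge0 ?l1N_ge0.
- exact: cube_compact.
- exact: cube_hausdorff.
move=> x y xy; apply: val_inj; apply/funext => -[b s].
by case: (xy b) => re im; case: s.
Qed.

End Centre.

Theorem corollary4p2 (R : realType) (G : groupType) (F : set G) (d : nat)
    (f : {poly R}) (lambda alpha C : R) :
  infinite_set [set: G] ->
  symmetric_generating_set F ->
  polynomial_growth R F ->
  order_of_growth R F d ->
  size f = d.+1 ->
  0 < lambda <= 1 ->
  (forall n : nat, lambda * f.[n%:R] <= (ball_size F n)%:R <= f.[n%:R]) ->
  0 < alpha < 1 ->
  0 < C ->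
  let A := na_centre (l1_algebra (exp_weight F alpha C)) in
  isomorphic_to_Q_algebra A /\
  von_Neumann A (delta_const d f lambda alpha C) 1.
Proof.
move=> _ F_gen _ _ _ _ f_growth alpha01 C_gt0 A.
have [D [D0 D_mult delta0 delta_le]] :=
  delta_const_multiplier d F_gen f_growth alpha01 C_gt0.
split; first exact: Q_algebra_centre D0 D_mult.
exact: von_Neumann_centre D0 D_mult _ delta0 delta_le.
Qed.
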